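(* Let $P\subset\mathbb{R}^d$ ($d\ge2$) be a $d$-dimensional polytope in general position and let $f$ be any contracting reflection law. If $P$ is obtuse, then the contracting billiard map $\Phi_{f,P}$ is uniformly hyperbolic (on $D$).
   Context: **Polytopes.** A polytope is a compact finite intersection of closed half-spaces of $\mathbb{R}^d$. Let $P$ be a $d$-dimensional polytope with $(d-1)$-dimensional faces $F_1,\dots,F_N$ (called faces), relative interiors $F_i^\circ$, inward unit normals $\eta_i$, and skeleton $\Sigma P=\bigcup_i\partial F_i$. $P$ is in general position (generic) if (1) for any set of $d$ faces of $P$ their normals are linearly independent, and (2) the normals to the faces incident with any given vertex are linearly independent (so exactly $d$ faces meet at each vertex). **Obtuse polytopes.** At a vertex of $P$ let $\eta_{i_1},\dots,\eta_{i_d}$ be the inward unit normals of the $d$ incident faces. There are a unit vector $e$ and $\ell>0$ with $\langle\eta_{i_j},e\rangle=\ell$ for all $j$ ($\ell$ is the distance from the origin to the affine hyperplane through the points $\eta_{i_j}$). The barycentric angle $\phi\in(0,\pi/2)$ at the vertex is defined by $\sin\phi=\ell$. $P$ is obtuse if the barycentric angle at every vertex is greater than $\pi/4$. **Notation.** $\mathbb{S}$ is the unit sphere of $\mathbb{R}^d$; $\mathbb{S}^+_\eta=\{v\in\mathbb{S}:\langle v,\eta\rangle>0\}$; $P_\eta(v)=\langle v,\eta\rangle\eta$; $P_{\eta^\perp}(v)=v-\langle v,\eta\rangle\eta$; $R_\eta(v)=v-2\langle v,\eta\rangle\eta$. **Contracting laws.** A contracting law is a family of $C^2$ maps $C_\eta:\mathbb{S}^+_\eta\to\mathbb{S}^+_\eta$,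 $\eta\in\mathbb{S}$, with: $C_\eta(\eta)=\eta$; $C_\eta(v)=a_\eta(v)P_\eta(v)+b_\eta(v)P_{\eta^\perp}(v)$ for non-negative $C^2$ functions $a_\eta,b_\eta$; $0<\sup_{v}\|DC_\eta(v)\|<1$; $O\circ C_\eta=C_{O\eta}\circ O$ for every orthogonal $O$. It is determined by a $C^2$ function $f:[0,\pi/2)\to[0,\pi/2)$ with $f(0)=0$ and $0<\lambda(f):=\sup|f'|<1$, through $C_\eta(v)=\frac{\cos f(\theta)}{\cos\theta}P_\eta(v)+\frac{\sin f(\theta)}{\sin\theta}P_{\eta^\perp}(v)$, $\theta=\arccos\langle v,\eta\rangle$. Such an $f$ is called a contracting reflection law. **Billiard map.** $M=\bigcup_i F_i^\circ\times\mathbb{S}^+_{\eta_i}$; $M'$ is the set of $(p,v)\in M$ such that the half-line $\{p+tv:t\ge0\}$ does not meet $\Sigma P$. For $(p,v)\in M'$ let $\tau>0$ be the least $t>0$ with $p+tv\in F_j^\circ$ for some $j$; then $\Phi_{f,P}(p,v)=(p+\tau v,\,C_{\eta_j}(R_{\eta_j}(v)))$. Write $\Phi=\Phi_{f,P}$. $M^+=\{x\in M:\Phi^n(x)\in M'\ \forall n\ge0\}$ and $D=\bigcap_{n\ge0}\Phi^n(M^+)$. Standing convention: $\Phi$ restricted to $D$ is regarded as an invertible map of $D$, with invertible derivative. **Uniform hyperbolicity.** $\Phi$ is uniformly hyperbolic (on $D$) if for $x\in D$ there is a continuous splitting $T_xM=E^s(x)\oplus E^{u}(x)$ with $D\Phi(E^s(x))=E^s(\Phi(x))$,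 $D\Phi(E^{u}(x))=E^{u}(\Phi(x))$, and constants $\lambda<1$, $\sigma>1$, $C>0$ such that for all $n\ge1$: $\|D\Phi^n|_{E^s}\|\le C\lambda^n$ and $\|D\Phi^{-n}|_{E^{u}}\|\le C\sigma^{-n}$ on $D$. *)

(* Defs.v *)
From HB Require Import structures.
From mathcomp Require Import all_boot all_order all_algebra.
From mathcomp Require Import all_classical all_reals all_analysis.

Set Implicit Arguments.
Unset Strict Implicit.
Unset Printing Implicit Defensive.

Import Order.TTheory GRing.Theory Num.Theory.
Import numFieldNormedType.Exports.

Local Open Scope classical_set_scope.
Local Open Scope ring_scope.

(* The library norm on row vectors and on pairs is the sup norm.  It is only
   used through the topology it induces; lengths and angles use the Euclidean
   structure below. *)
Section Euclidean.
Context {R : realType} {d : nat}.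
Implicit Types u v : 'rV[R]_d.

Definition dot u v : R := (u *m v^T) ord0 ord0.
Definition enorm u : R := Num.sqrt (dot u u).

(* Euclidean norm of R^d x R^d = R^(2d). *)
Definition enorm2 (w : 'rV[R]_d * 'rV[R]_d) : R :=
  Num.sqrt (dot w.1 w.1 + dot w.2 w.2).

Definition proj eta v := dot v eta *: eta.
Definition proj_orth eta v := v - dot v eta *: eta.
Definition reflect eta v := v - (2 * dot v eta) *: eta.

(* A contains k + 1 affinely independent points. *)
Definition affdim_ge (A : set 'rV[R]_d) (k : nat) :=
  exists (a : 'rV[R]_d) (X : 'M[R]_(k, d)),
    [/\ A a, forall i, A (a + row i X) & row_free X].

Definition has_affdim (A : set 'rV[R]_d) (k : nat) :=
  affdim_ge A k /\ ~ affdim_ge A k.+1.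

End Euclidean.

Section HRepresentation.
Context {R : realType} {d N : nat}.
Variables (eta : 'I_N -> 'rV[R]_d) (c : 'I_N -> R).

Definition hrep_body : set 'rV[R]_d :=
  [set x | forall i, c i <= dot x (eta i)].
Definition hrep_plane (i : 'I_N) : set 'rV[R]_d :=
  [set x | dot x (eta i) = c i].
Definition hrep_face (i : 'I_N) : set 'rV[R]_d :=
  hrep_body `&` hrep_plane i.

End HRepresentation.

(* A d-dimensional polytope of R^d, given by its irredundant half-space
   representation: the i-th half-space is {x | <x, normal i> >= offset i}, and
   the sets P `&` {x | <x, normal i> = offset i} are (d-1)-dimensional and
   pairwise distinct.  Since every (d-1)-dimensional face of P spans one of the
   bounding hyperplanes, these are exactly the faces F_1, ..., F_N. *)
Record polytope (R : realType) (d : nat) := Polytope {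
  nfaces : nat;
  normal : 'I_nfaces -> 'rV[R]_d;
  offset : 'I_nfaces -> R;
  _ : forall i, enorm (normal i) = 1;
  _ : compact (hrep_body normal offset);
  _ : has_affdim (hrep_body normal offset) d;
  _ : forall i, has_affdim (hrep_face normal offset i) d.-1;
  _ : injective (hrep_face normal offset)
}.

Section Polytope.
Context {R : realType} {d : nat} (P : polytope R d).
Implicit Types (i : 'I_(nfaces P)) (p : 'rV[R]_d).

Definition body : set 'rV[R]_d := hrep_body (@normal _ _ P) (@offset _ _ P).
Definition plane i : set 'rV[R]_d :=
  hrep_plane (@normal _ _ P) (@offset _ _ P) i.
Definition face i : set 'rV[R]_d :=
  hrep_face (@normal _ _ P) (@offset _ _ P) i.

(* plane i is the affine hull of face i, so this is its relative interior. *)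
Definition relint_face i : set 'rV[R]_d :=
  [set p | face i p /\ within (plane i) (nbhs p) (face i)].

Definition skeleton : set 'rV[R]_d :=
  \bigcup_(i in [set: 'I_(nfaces P)]) (face i `\` relint_face i).

(* p is a vertex when {p} is the intersection of P with a supporting
   hyperplane. *)
Definition vertex p :=
  body p /\ exists a : 'rV[R]_d,
    forall q, body q -> q <> p -> dot p a < dot q a.

Definition incident p : pred 'I_(nfaces P) := fun i => `[< face i p >].

Definition general_position :=
  (forall A : {set 'I_(nfaces P)}, #|A| = d ->
     free [seq normal i | i <- enum A]) /\
  (forall p, vertex p -> free [seq normal i | i <- enum (incident p)]).

Definition barycentric_angle p (phi : R) :=
  0 < phi < pi / 2 /\
  exists2 e : 'rV[R]_d, enorm e = 1 &
    forall i, incident p i -> dot (normal i) e = sin phi.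

Definition obtuse :=
  forall p, vertex p -> exists2 phi, barycentric_angle p phi & pi / 4 < phi.

End Polytope.

Section ReflectionLaw.
Context {R : realType}.

Definition has_derivative_on (A : set R) (f f' : R -> R) :=
  forall t, A t ->
    ((f s - f t) / (s - t)) @[s --> within (A `\ t) (nbhs t)] --> f' t.

(* The derivatives at 0 are one-sided. *)
Definition contracting_reflection_law (f : R -> R) :=
  let I := [set t : R | 0 <= t < pi / 2] in
  [/\ forall t, I t -> I (f t),
      f 0 = 0 &
      exists f1 f2 : R -> R,
        [/\ has_derivative_on I f f1,
            has_derivative_on I f1 f2,
            {within I, continuous f2} &
            (0 < ereal_sup [set `|f1 t|%:E | t in I] < 1)%E]].

(* At v = eta both proj_orth eta v and sin theta vanish, and the value is eta
   because x / 0 = 0. *)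
Definition contraction {d : nat} (f : R -> R) (eta v : 'rV[R]_d) : 'rV[R]_d :=
  let theta := acos (dot v eta) in
  (cos (f theta) / cos theta) *: proj eta v +
  (sin (f theta) / sin theta) *: proj_orth eta v.

End ReflectionLaw.

(* L is a derivative at x of the restriction of F to A.  When A is a
   submanifold, L is determined on the tangent space of A at x. *)
Definition has_diff_on {R : realType} {V : normedModType R}
    (A : set V) (F : V -> V) (x : V) (L : V -> V) :=
  forall eps : R, 0 < eps -> \forall y \near within A (nbhs x),
    `|F y - F x - L (y - x)| <= eps * `|y - x|.

(* E restricted to A is a continuous field of subspaces: it has continuous
   local frames. *)
Definition continuous_subbundle {R : realType} {d : nat}
    (V := ('rV[R]_d * 'rV[R]_d)%type) (A : set V) (E : V -> {vspace V}) :=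
  forall x, A x -> exists (k : nat) (e : 'I_k -> V -> V) (U : set V),
    [/\ nbhs x U,
        forall i, {within A `&` U, continuous (e i)} &
        forall y, A y -> U y -> basis_of (E y) [tuple e i y | i < k]].

Section Billiard.
Context {R : realType} {d : nat} (P : polytope R d) (f : R -> R).
Let V := ('rV[R]_d * 'rV[R]_d)%type.
Implicit Types x y : V.

(* The relative interiors of the faces are pairwise disjoint, so the disjoint
   union defining the phase space can be taken inside R^d x R^d. *)
Definition phase : set V :=
  [set x | exists i : 'I_(nfaces P),
     [/\ relint_face i x.1, enorm x.2 = 1 & 0 < dot x.2 (normal i)]].

Definition tangent x : set V :=
  [set w | exists i : 'I_(nfaces P),
     [/\ relint_face i x.1, dot w.1 (normal i) = 0 & dot w.2 x.2 = 0]].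

Definition regular : set V :=
  [set x | phase x /\ forall t, 0 <= t -> ~ skeleton P (x.1 + t *: x.2)].

Definition collision x y :=
  exists (j : 'I_(nfaces P)) (tau : R),
    [/\ 0 < tau,
        relint_face j (x.1 + tau *: x.2),
        forall (k : 'I_(nfaces P)) t,
          0 < t < tau -> ~ relint_face k (x.1 + t *: x.2) &
        y = (x.1 + tau *: x.2,
             contraction f (normal j) (reflect (normal j) x.2))].

(* Only meaningful on regular x, where collision x has exactly one element. *)
Definition billiard_map x : V := xget x (collision x).

Definition forward_regular : set V :=
  [set x | forall n, regular (iter n billiard_map x)].

Definition billiard_core : set V :=
  \bigcap_(n in [set: nat]) (iter n billiard_map @` forward_regular).

(* The standing convention that the billiard map is an invertible map of
   billiard_core with invertible derivative. *)
Definition invertible_on_core :=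
  set_bij billiard_core billiard_core billiard_map /\
  forall x (L : 'End(V)), billiard_core x ->
    has_diff_on phase billiard_map x L ->
    set_bij (tangent x) (tangent (billiard_map x)) L.

Definition diff_iter (n : nat) x (L : 'End(V)) :=
  has_diff_on phase (iter n billiard_map) x L.

(* K is the derivative at x of the n-th iterate of the inverse of billiard_map
   on billiard_core, i.e. the inverse of the derivative of the n-th iterate at
   the n-th preimage y of x. *)
Definition diff_iter_inv (n : nat) x (K : 'End(V)) :=
  exists y (L : 'End(V)),
    [/\ billiard_core y, iter n billiard_map y = x, diff_iter n y L,
        L @` tangent y = tangent x &
        forall w, tangent y w -> K (L w) = w].

Definition uniformly_hyperbolic :=
  exists Es Eu : V -> {vspace V},
    [/\ forall x, billiard_core x ->
          [set w | w \in (Es x + Eu x)%VS] = tangent x /\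
          (Es x :&: Eu x = 0)%VS,
        continuous_subbundle billiard_core Es,
        continuous_subbundle billiard_core Eu,
        forall x, billiard_core x -> exists L : 'End(V),
          [/\ diff_iter 1 x L,
              (L @: Es x)%VS = Es (billiard_map x) &
              (L @: Eu x)%VS = Eu (billiard_map x)] &
        exists lambda sigma C : R,
          [/\ 0 < lambda < 1, 1 < sigma, 0 < C &
            forall n x, (1 <= n)%N -> billiard_core x ->
              (exists2 L : 'End(V), diff_iter n x L &
                 forall w, w \in Es x ->
                   enorm2 (L w) <= C * lambda ^+ n * enorm2 w) /\
              (exists2 K : 'End(V), diff_iter_inv n x K &
                 forall w, w \in Eu x ->
                   enorm2 (K w) <= C * sigma ^- n * enorm2 w)]].

End Billiard.

(* Main.v *)
(* A collision turns the velocity v into v' = b v + g eta, where eta is the normal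
   of the face hit, 0 <= b <= mu < 1 and g >= kap > 0.  The derivative of the map
   is block triangular.  On the velocity component it is a contraction by mu, and
   the subspace {(u, 0)} of position displacements is invariant; summing a
   geometrically convergent series gives an invariant complement, a graph over
   the velocities, which is the stable space and is continuous as a uniform limit.

   On {(u, 0)} the component of u orthogonal to the velocity never shrinks, and it
   stays nearly constant over k collisions only if it is nearly orthogonal to all
   the normals met.  So uniform expansion follows once any k consecutive normals
   span the space.  Otherwise, by general position, all faces met lie in a set of
   linearly independent normals, and the velocity drifts in a direction having a
   positive product with all of them.  The orbit then has bounded length, so many
   consecutive collisions take place near a common point of the faces involved,
   which therefore share a vertex.  At a vertex with barycentric angle larger than
   pi/4 the normals have pairwise positive products, and after a bounded number of
   collisions the velocity points away from all these faces: a contradiction. *)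
From HB Require Import structures.
Require Import Defs.
From mathcomp Require Import all_boot all_order all_algebra.
From mathcomp Require Import all_classical all_reals all_analysis.
From mathcomp Require Import ring lra.

Set Implicit Arguments.
Unset Strict Implicit.
Unset Printing Implicit Defensive.

Import Order.TTheory GRing.Theory Num.Theory.
Import numFieldNormedType.Exports.

Local Open Scope classical_set_scope.
Local Open Scope ring_scope.

(** * Euclidean vectors *)

(** The core need not be compact, so no constant can be drawn from compactness of the phase space.
    Uniformity comes instead from the finite number of faces, pairs of faces and sets of faces,
    together with the compactness of P itself. Expansion is measured on the component of u
    orthogonal to the velocity because one collision increases its square by exactly (1 - b^2) c^2,
    where c is the component of the new displacement along the old velocity. This component controls
    u itself because every core point is an image, so its velocity has product at least [kap] with
    the normal of its face. The series for the stable space converges by duality. Its terms contain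
    projections back onto the previous faces, and on the planes of the faces these invert the
    derivative acting on position displacements. Expansion of that derivative bounds the
    projections, so the contraction of velocities alone makes the terms geometric. Normal incidence
    is the singular point of the law: the quotient of sines is 0 / 0 there and [acos] has no
    derivative, so differentiability and continuity of the derivative need separate estimates at
    this point. *)

Section Euclidean.
Context {R : realType} {d : nat}.
Implicit Types u v w : 'rV[R]_d.

Lemma dotE u v : dot u v = \sum_k u ord0 k * v ord0 k.
Proof. by rewrite /dot mxE; apply: eq_bigr => k _; rewrite !mxE. Qed.

Lemma dotC u v : dot u v = dot v u.
Proof. by rewrite !dotE; apply: eq_bigr => k _; rewrite mulrC. Qed.

Lemma dotDl u v w : dot (u + v) w = dot u w + dot v w.
Proof. by rewrite /dot mulmxDl mxE. Qed.

Lemma dotDr u v w : dot w (u + v) = dot w u + dot w v.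
Proof. by rewrite !(dotC w) dotDl. Qed.

Lemma dotZl a u v : dot (a *: u) v = a * dot u v.
Proof. by rewrite /dot -scalemxAl mxE. Qed.

Lemma dotZr a u v : dot u (a *: v) = a * dot u v.
Proof. by rewrite !(dotC u) dotZl. Qed.

Lemma dotNl u v : dot (- u) v = - dot u v.
Proof. by rewrite -scaleN1r dotZl mulN1r. Qed.

Lemma dotNr u v : dot u (- v) = - dot u v.
Proof. by rewrite !(dotC u) dotNl. Qed.

Lemma dot0l u : dot 0 u = 0.
Proof. by rewrite -(scale0r 0) dotZl mul0r. Qed.

Lemma dot0r u : dot u 0 = 0.
Proof. by rewrite dotC dot0l. Qed.

Lemma dotBl u v w : dot (u - v) w = dot u w - dot v w.
Proof. by rewrite dotDl dotNl. Qed.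

Lemma dotBr u v w : dot w (u - v) = dot w u - dot w v.
Proof. by rewrite dotDr dotNr. Qed.

Definition bilin := (dotDl, dotDr, dotBl, dotBr, dotZl, dotZr, dotNl, dotNr,
  dot0l, dot0r).

Lemma dot_suml (I : finType) (Q : pred I) (F : I -> 'rV[R]_d) w :
  dot (\sum_(i | Q i) F i) w = \sum_(i | Q i) dot (F i) w.
Proof.
by apply: (big_morph (fun u => dot u w)) => [u v|]; rewrite ?dotDl ?dot0l.
Qed.

Lemma dot_sumr (I : finType) (Q : pred I) (F : I -> 'rV[R]_d) w :
  dot w (\sum_(i | Q i) F i) = \sum_(i | Q i) dot w (F i).
Proof. by rewrite dotC dot_suml; apply: eq_bigr => i _; rewrite dotC. Qed.

Lemma dot_delta u k : dot u (delta_mx ord0 k) = u ord0 k.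
Proof.
rewrite dotE (bigD1 k) //= big1 ?addr0 ?mxE ?eqxx ?mulr1 // => l lk.
by rewrite mxE (negbTE lk) andbF mulr0.
Qed.

Lemma dot_ge0 u : 0 <= dot u u.
Proof. by rewrite dotE; apply: sumr_ge0 => k _; rewrite -expr2 sqr_ge0. Qed.

Lemma dot_eq0 u : dot u u = 0 -> u = 0.
Proof.
move=> /eqP; rewrite dotE psumr_eq0 => [|k _]; last by rewrite -expr2 sqr_ge0.
move=> /allP h; apply/rowP => k; rewrite mxE.
have := h k (mem_index_enum _); rewrite /= -expr2 sqrf_eq0.
by move/eqP; rewrite (_ : 0 = ord0) //; apply: val_inj.
Qed.

Lemma dot_gt0 u : u != 0 -> 0 < dot u u.
Proof.
move=> u0; rewrite lt_neqAle dot_ge0 andbT eq_sym.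
by apply: contra_neq u0; exact: dot_eq0.
Qed.

Lemma enorm_ge0 u : 0 <= enorm u.
Proof. exact: sqrtr_ge0. Qed.

Lemma enorm_sqr u : enorm u ^+ 2 = dot u u.
Proof. by rewrite /enorm sqr_sqrtr // dot_ge0. Qed.

Lemma enorm0 : enorm (0 : 'rV[R]_d) = 0.
Proof. by rewrite /enorm dot0l sqrtr0. Qed.

Lemma enorm_gt0 u : u != 0 -> 0 < enorm u.
Proof. by move=> u0; rewrite /enorm sqrtr_gt0 dot_gt0. Qed.

Lemma enorm_le u a : 0 <= a -> dot u u <= a ^+ 2 -> enorm u <= a.
Proof. by move=> a0 h; rewrite -ler_sqr ?nnegrE ?enorm_ge0 // enorm_sqr. Qed.

Lemma enorm_unit u : enorm u = 1 -> dot u u = 1.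
Proof. by move=> h; rewrite -enorm_sqr h expr1n. Qed.

Lemma unit_enorm u : dot u u = 1 -> enorm u = 1.
Proof. by move=> h; rewrite /enorm h sqrtr1. Qed.

Lemma enormZ a u : enorm (a *: u) = `|a| * enorm u.
Proof.
by rewrite /enorm !bilin mulrA -expr2 sqrtrM ?sqr_ge0 // sqrtr_sqr.
Qed.

Lemma enormN u : enorm (- u) = enorm u.
Proof. by rewrite /enorm !bilin opprK. Qed.

Lemma dot_le u v : dot u v <= enorm u * enorm v.
Proof.
have [->|u0] := eqVneq u 0; first by rewrite dot0l enorm0 mul0r.
have [->|v0] := eqVneq v 0; first by rewrite dot0r enorm0 mulr0.
have nu := enorm_gt0 u0; have nv := enorm_gt0 v0.
have := dot_ge0 (enorm v *: u - enorm u *: v).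
rewrite !bilin (dotC v u) -!enorm_sqr => h.
suff : 0 <= enorm u * enorm v * (enorm u * enorm v - dot u v).
  by rewrite pmulr_rge0 ?mulr_gt0 // subr_ge0.
lra.
Qed.

Lemma dot_norm_le u v : `|dot u v| <= enorm u * enorm v.
Proof.
by rewrite ler_norml dot_le andbT lerNl -dotNl -(enormN u) dot_le.
Qed.

Lemma enormD u v : enorm (u + v) <= enorm u + enorm v.
Proof.
apply: enorm_le; first by rewrite addr_ge0 ?enorm_ge0.
have := dot_le u v; rewrite !bilin (dotC v u) sqrrD !enorm_sqr; lra.
Qed.

Lemma enormB u v : enorm (u - v) <= enorm u + enorm v.
Proof. by rewrite -(enormN v) enormD. Qed.

Lemma ler_norm_entry m n (M : 'M[R]_(m, n)) i j : `|M i j| <= `|M|.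
Proof.
rewrite [leRHS]/Num.norm /= mx_normrE; apply/bigmax_geP; right => /=.
by exists (i, j).
Qed.

Lemma norm_le_enorm u : `|u| <= enorm u.
Proof.
rewrite [leLHS]/Num.norm /= mx_normrE; apply/bigmax_leP.
split=> [|[i j] _ /=]; first exact: enorm_ge0.
rewrite ord1 -[leRHS]ger0_norm ?enorm_ge0 // -ler_sqr ?nnegrE //.
rewrite !real_normK ?num_real // enorm_sqr dotE (bigD1 j) //= -expr2 lerDl.
by apply: sumr_ge0 => k _; rewrite -expr2 sqr_ge0.
Qed.

(** The sharp factor is the square root of [d]; [d.+1] avoids a root and is positive even for
    [d = 0], so that it can be divided by. *)
Lemma enorm_le_norm u : enorm u <= d.+1%:R * `|u|.
Proof.
apply: enorm_le; first by rewrite mulr_ge0.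
rewrite dotE; apply: (@le_trans _ _ (\sum_(k < d) `|u| ^+ 2)).
  apply: ler_sum => k _; rewrite -expr2 -[leLHS]real_normK ?num_real //.
  by rewrite ler_sqr ?nnegrE // ler_norm_entry.
rewrite sumr_const card_ord exprMn -[leLHS]mulr_natl; apply: ler_wpM2r.
  exact: sqr_ge0.
by rewrite -natrX ler_nat (leq_trans (leqnSn d)) // expnS expn1 leq_pmulr.
Qed.

End Euclidean.

(** * Limits of matrices and products along a filter *)

Section Convergence.
Context {R : realType} {T : Type} {F : set_system T} {FF : Filter F}.

Lemma cvg_mx m n (M : T -> 'M[R]_(m, n)) (N : 'M[R]_(m, n)) :
  (forall i j, M t i j @[t --> F] --> N i j) -> M t @[t --> F] --> N.
Proof.
move=> h A [Q NQ sQ]; rewrite /nbhs /=.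
have hF : \forall t \near F, forall ij : 'I_m * 'I_n, Q ij.1 ij.2 (M t ij.1 ij.2).
  apply: filter_forall => -[i j]; apply: (h i j); exact: NQ.
by apply: filterS hF => t Qt; apply: sQ => i j; exact: (Qt (i, j)).
Qed.

Lemma cvg_sumr (I : Type) (r : seq I) (Q : pred I) (u : I -> T -> R) a :
  (forall i, Q i -> u i t @[t --> F] --> a i) ->
  \sum_(i <- r | Q i) u i t @[t --> F] --> \sum_(i <- r | Q i) a i.
Proof. by apply: cvg_big; exact: add_continuous. Qed.

Lemma cvg_entry m n (M : T -> 'M[R]_(m, n)) (N : 'M[R]_(m, n)) i j :
  M t @[t --> F] --> N -> M t i j @[t --> F] --> N i j.
Proof.
move=> h; apply: (@continuous_cvg _ _ _ _ FF M (fun A : 'M[R]_(m, n) => A i j)) => //.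
exact: coord_continuous.
Qed.

Lemma cvg_dot d (u v : T -> 'rV[R]_d) a b :
  u t @[t --> F] --> a -> v t @[t --> F] --> b ->
  dot (u t) (v t) @[t --> F] --> dot a b.
Proof.
move=> ha hb; rewrite dotE.
under eq_fun do rewrite dotE.
apply: cvg_sumr => k _; apply: cvgM; exact: cvg_entry.
Qed.

End Convergence.

(** * Faces of a polytope in general position *)

Section Polytopes.
Context {R : realType} {d : nat} (P : polytope R d).
Local Notation N := (nfaces P).
Local Notation eta := (@normal _ _ P).
Local Notation off := (@offset _ _ P).
Implicit Types (i j k : 'I_N) (p q w v : 'rV[R]_d).

Lemma normal_enorm i : enorm (eta i) = 1.
Proof. by case: P i. Qed.

Lemma normal_unit i : dot (eta i) (eta i) = 1.
Proof. exact/enorm_unit/normal_enorm. Qed.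

Lemma body_compact : compact (body P).
Proof. by rewrite /body; case: P. Qed.

Lemma body_nonempty : exists p, body P p.
Proof.
have [a [X [ha _ _]]] : affdim_ge (body P) d by rewrite /body; case: P => ? ? ? ? ? [].
by exists a.
Qed.

Lemma body_bounded : exists2 B : R, 0 < B & forall p, body P p -> enorm p <= B.
Proof.
have [M [Mr hM]] := compact_bounded body_compact.
exists (d.+1%:R * (`|M| + 1)); first by rewrite mulr_gt0 // ltr_wpDl.
move=> p hp; apply: le_trans (enorm_le_norm p) _.
by rewrite ler_pM2l //; apply: hM hp; rewrite (le_lt_trans (ler_norm M)) // ltrDl.
Qed.

(** A bounded set contains no ray, whereas non-negative products with all normals would keep
    [p + t *: w] in P for every [t >= 0]. *)
Lemma recession w : w != 0 -> exists i, dot w (eta i) < 0.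
Proof.
move=> w0; apply: contrapT => h.
have hw i : 0 <= dot w (eta i) by rewrite leNgt; apply/negP => hi; apply: h; exists i.
have [p hp] := body_nonempty; have [B B0 hB] := body_bounded.
have nw := enorm_gt0 w0.
(* This makes [t *: w] longer than the difference of two points of P can be. *)
pose t := (2 * B + 1) / enorm w.
have t0 : 0 <= t by rewrite divr_ge0 ?enorm_ge0 //; lra.
have hq : body P (p + t *: w).
  move=> i; rewrite !bilin; apply: le_trans (hp i) _.
  by rewrite lerDl mulr_ge0.
have : enorm (t *: w) <= 2 * B.
  have -> : t *: w = (p + t *: w) - p by rewrite [p + _]addrC addrK.
  by rewrite (le_trans (enormB _ _)) //; have := hB _ hq; have := hB _ hp; lra.
by rewrite enormZ ger0_norm // /t divfK ?gt_eqF //; lra.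
Qed.

(** General position speaks only of sets of exactly [d] faces; this ensures that smaller sets can be
    completed to such a set. *)
Lemma nfaces_ge : (d <= N)%N.
Proof.
pose M : 'M[R]_(N, d) := \matrix_i eta i.
have hM v i : (v *m M^T) ord0 i = dot v (eta i).
  rewrite dotE mxE; apply: eq_bigr => k _; by rewrite !mxE.
have : row_free M^T.
  apply: inj_row_free => v hv; apply: contrapT => /eqP v0.
  have [i] := recession v0; by rewrite -hM hv mxE ltxx.
by rewrite -row_leq_rank => h; apply: leq_trans h (rank_leq_col _).
Qed.

Section GeneralPosition.
Hypothesis gp : general_position P.

(** [A'] consists of the first [d] entries of an enumeration listing [A] before its complement,
    which serves both to enlarge small sets and to shrink large ones. *)
Lemma set_of_card_d (A : {set 'I_N}) : exists A' : {set 'I_N},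
  [/\ #|A'| = d, (#|A| <= d)%N -> A \subset A' & (d <= #|A|)%N -> A' \subset A].
Proof.
pose s := enum A ++ enum (~: A).
have us : uniq s.
  rewrite cat_uniq !enum_uniq /= andbT; apply/hasPn => x.
  by rewrite !mem_enum inE.
have ss : size s = N by rewrite size_cat -!cardE cardsC card_ord.
exists [set x in take d s]; split.
- rewrite cardsE (card_uniqP _) ?take_uniq // size_takel // ss; exact: nfaces_ge.
- move=> h; apply/fintype.subsetP => x xA; rewrite inE take_cat -cardE ltnNge h /=.
  by rewrite mem_cat mem_enum xA.
- rewrite leq_eqVlt => /orP h; apply/fintype.subsetP => x; rewrite inE take_cat -cardE.
  case: h => [/eqP <-|->]; last by move/mem_take; rewrite mem_enum.
  by rewrite ltnn subnn take0 cats0 mem_enum.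
Qed.

Definition normal_mx (A : {set 'I_N}) : 'M[R]_(#|A|, d) :=
  \matrix_k eta (enum_val k).

Lemma normal_mx_mul (A : {set 'I_N}) w (k : 'I_#|A|) :
  (normal_mx A *m w^T) k ord0 = dot w (eta (enum_val k)).
Proof. by rewrite dotE mxE; apply: eq_bigr => l _; rewrite !mxE mulrC. Qed.

Lemma normal_mx_free (A : {set 'I_N}) : #|A| = d -> row_free (normal_mx A).
Proof.
move=> cA; have /freeP fr : free [tuple eta (enum_val k) | k < #|A|].
  rewrite (_ : tval _ = [seq eta i | i <- enum A]); first exact: (proj1 gp).
  have sz : size [tuple eta (enum_val k) | k < #|A|] = size [seq eta i | i <- enum A].
    by rewrite size_tuple size_map -cardE.
  apply: (@eq_from_nth _ 0) => // l; rewrite size_tuple => hl.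
  have i0 : 'I_N := enum_val (Ordinal hl).
  rewrite (nth_map i0) -?cardE // (nth_mktuple _ _ (Ordinal hl)).
  by rewrite (enum_val_nth i0).
apply: inj_row_free => v hv; apply/rowP => k; rewrite mxE.
apply: (fr (v ord0)); rewrite -[RHS]hv mulmx_sum_row.
by apply: eq_bigr => l _; rewrite rowK nth_mktuple.
Qed.

Lemma normals_dual (A : {set 'I_N}) (g : 'I_N -> R) : (#|A| <= d)%N ->
  exists w, forall i, i \in A -> dot w (eta i) = g i.
Proof.
move=> cA; have [A' [cA' /(_ cA) sA _]] := set_of_card_d A.
pose M := normal_mx A'; pose G : 'cV[R]_#|A'| := \col_k g (enum_val k).
exists (pinvmx M *m G)^T => i /(fintype.subsetP sA) iA'.
rewrite -(enum_rankK_in iA' iA') -normal_mx_mul trmxK mulmxA.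
by rewrite mulmxVp ?normal_mx_free // mul1mx mxE.
Qed.

Lemma normals_span (A : {set 'I_N}) w : (d <= #|A|)%N ->
  (forall i, i \in A -> dot w (eta i) = 0) -> w = 0.
Proof.
move=> cA h; have [A' [cA' _ /(_ cA) sA]] := set_of_card_d A.
have /row_fullP [B hB] : row_full (normal_mx A').
  by have /eqP := normal_mx_free cA'; rewrite /row_full => ->; exact/eqP.
apply: trmx_inj; rewrite trmx0 -[LHS]mul1mx -hB -mulmxA.
rewrite (_ : _ *m w^T = 0) ?mulmx0 //; apply/colP => k.
by rewrite normal_mx_mul mxE h // (fintype.subsetP sA) // enum_valP.
Qed.

Lemma span_or_dual (A : {set 'I_N}) :
  (forall w, (forall i, i \in A -> dot w (eta i) = 0) -> w = 0) \/
  exists w, forall i, i \in A -> dot w (eta i) = 1.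
Proof.
have [cA|/ltnW cA] := leqP d #|A|; first by left=> w; exact: normals_span.
by right; exact: (normals_dual (fun=> 1)).
Qed.

Hypothesis d2 : (2 <= d)%N.

(** Two faces form a set of at most [d] elements because [d >= 2], so there is a motion inside one
    hyperplane that crosses the other. *)
Lemma normal_separated i k : i != k ->
  exists2 t, dot t (eta i) = 0 & dot t (eta k) = 1.
Proof.
move=> ik; have : (#|[set i; k]%SET| <= d)%N by rewrite cards2 ik.
case/(normals_dual (fun l => if l == k then 1 else 0)) => t ht.
by exists t; rewrite ht ?inE ?eqxx ?orbT // (negbTE ik).
Qed.

Lemma near_dot_gt (a : R) p v : a < dot p v -> \forall q \near p, a < dot q v.
Proof.
move=> h; have hc : dot q v @[q --> p] --> dot p v by apply: (cvg_dot (F := nbhs p)); [exact: cvg_id|exact: cvg_cst].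
exact: (cvgr_gt _ hc).
Qed.

(** Replaces the topological definition by strict inequalities, which are open conditions. If a
    second constraint [k] were tight at [p], arbitrarily small motions inside [plane i] would
    violate it, and [face i] would not be a neighbourhood of [p] in [plane i]. *)
Lemma relint_faceP i p : relint_face i p <->
  dot p (eta i) = off i /\ forall k, k != i -> off k < dot p (eta k).
Proof.
split=> [[[hb hp] hn]|[hp hk]].
  split=> // k ki; rewrite lt_neqAle hb andbT; apply/negP => /eqP e.
  have [t ti tk] : exists2 t, dot t (eta i) = 0 & dot t (eta k) = 1.
    by apply: normal_separated; rewrite eq_sym.
  have hc : p - s *: t @[s --> (0 : R)] --> p - 0 *: t.
    by apply: cvgB; [exact: cvg_cst|apply: cvgZr_tmp; exact: cvg_id].
  rewrite scale0r subr0 in hc.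
  have [e' /= e0 he] := (nbhs_ballP _ _).1 (hc _ hn).
  have := he (e' / 2); rewrite /ball /= sub0r normrN gtr0_norm ?divr_gt0 //.
  rewrite ltr_pdivrMr // ltr_pMr // ltr1n => /(_ isT); case.
    by rewrite /plane /hrep_plane /= !bilin ti mulr0 subr0.
  by move=> /(_ k) + _; rewrite !bilin tk mulr1 -e lerBrDl gerDr leNgt divr_gt0.
have hb : body P p.
  by move=> k; have [->|/hk/ltW//] := eqVneq k i; rewrite hp.
split; first by split.
have : \forall q \near p, forall k, k != i -> off k < dot q (eta k).
  apply: (@filter_forall _ _ _ (nbhs p)) => k; have [->|ki] := eqVneq k i; first by apply: nearW.
  by apply: filterS (near_dot_gt (hk k ki)) => q hq _.
apply: filterS => q hq hqi; split=> // k.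
by have [->|/hq/ltW//] := eqVneq k i; rewrite (_ : dot _ _ = off i).
Qed.

Lemma relint_face_body i p : relint_face i p -> body P p.
Proof. by case=> -[]. Qed.

Lemma relint_face_inj i k p : relint_face i p -> relint_face k p -> i = k.
Proof.
move=> /relint_faceP[h _] /relint_faceP[_ h']; apply/eqP/negP => ik.
by have := h' i (introT negP ik); rewrite h ltxx.
Qed.

Lemma not_skeleton k p : body P p -> dot p (eta k) = off k ->
  ~ skeleton P p -> relint_face k p.
Proof.
by move=> hb hk hs; apply: contrapT => hr; apply: hs; exists k.
Qed.

End GeneralPosition.
End Polytopes.

(** * Consecutive normals span *)

Section FiniteBounds.
Context {R : realType}.

Lemma fin_lower_bound (I : finType) (Q : I -> Prop) (F : I -> R) :
  (forall i, Q i -> 0 < F i) -> exists2 e, 0 < e & forall i, Q i -> e <= F i.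
Proof.
move=> h; exists (\big[Num.min/1]_(i | `[< Q i >]) F i).
  by apply/bigmin_gtP; split=> // i /asboolP; exact: h.
by move=> i Qi; apply: bigmin_le_cond; exact/asboolP.
Qed.

Lemma fin_upper_bound (I : finType) (F : I -> R) :
  exists2 M, 0 < M & forall i, F i <= M.
Proof.
exists (1 + \sum_i `|F i|); first by rewrite ltr_pwDl // sumr_ge0.
move=> i; apply: le_trans (ler_norm _) _; rewrite (bigD1 i) //= addrCA lerDl.
by rewrite addr_ge0 // sumr_ge0.
Qed.

Lemma exp_small (mu e : R) : 0 <= mu < 1 -> 0 < e ->
  exists n0, forall n, (n0 <= n)%N -> mu ^+ n < e.
Proof.
move=> /andP[mu0 mu1] e0.
have h : mu ^+ n @[n --> \oo] --> 0 by apply: cvg_expr; rewrite ger0_norm.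
have [n0 _ hn] := cvgr_lt _ h _ e0.
by exists n0 => n /hn.
Qed.

Lemma nat_large (x : R) : exists n : nat, x < n%:R.
Proof.
by exists (Num.bound `|x|); rewrite (le_lt_trans (ler_norm x)) ?archi_boundP.
Qed.

End FiniteBounds.

Section Spanning.
Context {R : realType} {d : nat} (P : polytope R d).
Local Notation N := (nfaces P).
Local Notation eta := (@normal _ _ P).
Local Notation off := (@offset _ _ P).
Implicit Types (p q w v : 'rV[R]_d).

Definition active p : {set 'I_N} := [set k | dot p (eta k) == off k]%SET.

(* The sum of the active normals is minimal exactly on the smallest face
   containing p; a second point q of it would give, on the ray from p through q
   at its exit from P, a point with one more active constraint. *)
Lemma maximal_active_vertex p : body P p ->
  (forall q, body P q -> active p \subset active q -> active q \subset active p) ->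
  vertex P p.
Proof.
move=> hp mx; split=> //; exists (\sum_(k in active p) eta k) => q hq qp.
have ap k : k \in active p -> dot p (eta k) = off k by rewrite inE => /eqP.
rewrite !dot_sumr ltNge; apply/negP => le.
have aq k : k \in active p -> dot q (eta k) = off k.
  move=> ka; have h l : l \in active p -> 0 <= dot q (eta l) - dot p (eta l).
    by move=> /ap ->; rewrite subr_ge0 hq.
  have /eqP : \sum_(l in active p) (dot q (eta l) - dot p (eta l)) == 0.
    rewrite eq_le sumr_ge0 // andbT sumrB subr_le0 //.
  move=> /psumr_eq0P /(_ k ka) h0; apply/eqP; rewrite -subr_eq0 -(ap k ka).
  by rewrite h0.
have z0 : q - p != 0 by rewrite subr_eq0; exact/eqP.
have [k0 hk0] := recession P z0.
pose Q k := dot (q - p) (eta k) < 0.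
pose t k := (dot p (eta k) - off k) / (- dot (q - p) (eta k)).
case: (arg_minP t (hk0 : Q k0)) => k Qk tk.
have nk : k \notin active p.
  by apply: contraL Qk => ka; rewrite /Q dotBl aq ?ap // subrr ltxx.
have t0 : 0 <= t k by rewrite divr_ge0 ?subr_ge0 ?hp // oppr_ge0 ltW.
pose r := p + t k *: (q - p).
have hr : body P r.
  move=> l; rewrite /r dotDl dotZl.
  have [hl|hl] := ltP (dot (q - p) (eta l)) 0; last first.
    by rewrite ler_wpDr ?hp // mulr_ge0.
  have := tk l hl; rewrite {2}/t ler_pdivlMr ?oppr_gt0 //; lra.
have sr : active p \subset active r.
  apply/fintype.subsetP => l la; rewrite inE /r !bilin aq // ap // subrr mulr0.
  by rewrite addr0.
have /fintype.subsetP /(_ k) := mx r hr sr; rewrite (negbTE nk) inE => /contraFF.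
move=> /(_ erefl) /negP; apply; rewrite /r dotDl dotZl /t.
by apply/eqP; field; rewrite lt_eqF.
Qed.

(** Active sets have at most [N] elements, so among those containing [active q] one has the largest
    size; it is maximal for inclusion and belongs to a vertex. *)
Lemma face_vertex q : body P q -> exists2 p, vertex P p & active q \subset active p.
Proof.
move=> hq.
pose Q n := `[< exists p, [/\ body P p, active q \subset active p & #|active p| = n] >].
have exQ : exists n, Q n by exists #|active q|; apply/asboolP; exists q.
have ubQ n : Q n -> (n <= N)%N.
  by move=> /asboolP[p [_ _ <-]]; rewrite -[leqRHS]card_ord max_card.
case: (ex_maxnP exQ ubQ) => n /asboolP[p [hp sp cp]] mx.
exists p => //; apply: maximal_active_vertex => // r hr sr.
suff /eqP -> : active p == active r by [].
rewrite eqEcard sr cp; apply: mx; apply/asboolP; exists r; split=> //.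
exact: fintype.subset_trans sp sr.
Qed.

(** Both normals have product [sin phi] with the unit vector [e], so the squared length of
    [eta i + eta k - (2 * sin phi) *: e] is [2 * (dot (eta i) (eta k) + cos (2 * phi))]. It is
    non-negative, hence the product is at least [- cos (2 * phi)], which is positive for [phi]
    between [pi / 4] and [pi / 2]. *)
Lemma obtuse_normals_acute p i k : obtuse P -> vertex P p ->
  dot p (eta i) = off i -> dot p (eta k) = off k -> 0 < dot (eta i) (eta k).
Proof.
move=> ob vp hi hk; have [phi [/andP[phi0 phi2] [e e1 he]] hphi] := ob p vp.
have inc l : dot p (eta l) = off l -> incident p l.
  by move=> hl; apply/asboolP; split=> //; case: vp.
have : cos (phi *+ 2) < 0.
  have p0 : 0 < pi :> R by exact: pi_gt0.
  rewrite mulr2n -(@cos_pihalf R) ltr_cos; first lra.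
    by rewrite in_itv /=; apply/andP; split; lra.
  by rewrite in_itv /=; apply/andP; split; lra.
rewrite cos_mulr2n => hc; have := cos2Dsin2 phi; set c := cos phi in hc *.
have := dot_ge0 (eta i + eta k - (2 * sin phi) *: e).
rewrite !bilin !normal_unit (dotC e (eta k)) (dotC e (eta i)) !he ?inc //.
rewrite (enorm_unit e1) (dotC (eta k)); lra.
Qed.

End Spanning.

(** * Escape from vertices and spanning by consecutive normals *)

Section Itineraries.
Context {R : realType} {d : nat} (P : polytope R d).
Local Notation N := (nfaces P).
Local Notation eta := (@normal _ _ P).
Local Notation off := (@offset _ _ P).

(* The billiard reduced to what the combinatorial argument uses: b is the factor
   contracting the tangential velocity and g the velocity gained along the
   normal at a collision. *)
Record itinerary (mu kap : R) (i : nat -> 'I_N) (p v : nat -> 'rV[R]_d) : Prop :=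
  Itinerary {
    it_body : forall n, body P (p n);
    it_face : forall n, dot (p n) (eta (i n)) = off (i n);
    it_unit : forall n, dot (v n) (v n) = 1;
    it_step : forall n, exists2 t, 0 < t & p n.+1 = p n + t *: v n;
    it_bounce : forall n, exists b g,
      [/\ 0 <= b <= mu, kap <= g & v n.+1 = b *: v n + g *: eta (i n.+1)];
    it_hit : forall n, dot (v n) (eta (i n.+1)) < 0
  }.

Lemma itinerary_shift mu kap i p v m : itinerary mu kap i p v ->
  itinerary mu kap (fun n => i (m + n)%N) (fun n => p (m + n)%N)
    (fun n => v (m + n)%N).
Proof.
case=> h1 h2 h3 h4 h5 h6.
by split=> n; rewrite ?addnS; [exact: h1|exact: h2|exact: h3|exact: h4|exact: h5|exact: h6].
Qed.

Section Constants.
Variables mu kap : R.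
Hypotheses (mu01 : 0 <= mu < 1) (kap0 : 0 < kap).

(** Each bounce multiplies the product with [w] by some [b <= mu] and adds at least [kap * delta].
    Only the last gain is kept: the induction carries the lower bound [- (mu ^+ n * W)], which also
    holds at [n = 0]. *)
Lemma velocity_drift i p v w W delta M : itinerary mu kap i p v ->
  0 <= W -> - W <= dot (v 0%N) w -> 0 <= delta ->
  (forall n, (1 <= n <= M)%N -> delta <= dot (eta (i n)) w) ->
  forall n, (1 <= n <= M)%N -> kap * delta - mu ^+ n * W <= dot (v n) w.
Proof.
move=> it W0 h0 d0 hd n; case/andP: mu01 => m0 m1.
suff : (n <= M)%N -> - (mu ^+ n * W) <= dot (v n) w /\
    ((1 <= n)%N -> kap * delta - mu ^+ n * W <= dot (v n) w).
  by move=> h /andP[n1 /h[_]]; apply.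
elim: n => [_|n IH nM]; first by rewrite expr0 mul1r.
have [IH1 _] := IH (ltnW nM).
suff h : kap * delta - mu ^+ n.+1 * W <= dot (v n.+1) w.
  split=> //; apply: le_trans h; rewrite lerBrDr addrC subrr.
  by rewrite mulr_ge0 // ltW.
have [b [g [/andP[b0 bm] hg ->]]] := it_bounce it n.
rewrite !bilin addrC lerD //.
  have : 0 <= mu ^+ n * W by rewrite mulr_ge0 // exprn_ge0.
  rewrite exprS; nra.
by apply: ler_pM => //; [exact: ltW|exact: hd].
Qed.

Hypotheses (gp : general_position P) (ob : obtuse P).

(** If two faces share a point they share a vertex, where their normals are acute; the bound is
    uniform because there are finitely many pairs of faces. *)
Lemma incident_normals_acute : exists2 kap2, 0 < kap2 & forall i k q, body P q ->
  dot q (eta i) = off i -> dot q (eta k) = off k -> kap2 <= dot (eta i) (eta k).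
Proof.
pose Q (ik : 'I_N * 'I_N) := exists q, [/\ body P q,
  dot q (eta ik.1) = off ik.1 & dot q (eta ik.2) = off ik.2].
have [ik [q [hq h1 h2]]|e e0 he] := @fin_lower_bound R _ Q (fun ik => dot (eta ik.1) (eta ik.2)).
  have [p vp /fintype.subsetP sp] := face_vertex hq.
  have ap k : dot q (eta k) = off k -> dot p (eta k) = off k.
    by move=> hk; have := sp k; rewrite !inE hk eqxx => /(_ isT)/eqP.
  exact: obtuse_normals_acute ob vp (ap _ h1) (ap _ h2).
by exists e => // i k q hq h1 h2; apply: (he (i, k)); exists q.
Qed.

Definition concurrent (A : {set 'I_N}) :=
  exists2 q, body P q & forall i, i \in A -> dot q (eta i) = off i.

(** For a fixed [A] without a common point, the sum of the slacks is continuous and positive on the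
    compact body, so it has a positive minimum and some slack is at least this minimum divided by
    [N.+1]. There are finitely many sets [A]. *)
Lemma nonconcurrent_gap : exists2 eps, 0 < eps & forall A p, ~ concurrent A ->
  body P p -> exists2 i, i \in A & eps <= dot p (eta i) - off i.
Proof.
have gap (A : {set 'I_N}) : exists e, ~ concurrent A -> 0 < e /\ forall p, body P p ->
    exists2 i, i \in A & e <= dot p (eta i) - off i.
  pose g p := \sum_(i in A) (dot p (eta i) - off i).
  have cg : continuous g.
    move=> p; apply: (cvg_sumr (F := nbhs p)) => i _; apply: cvgB; last exact: cvg_cst.
    by apply: (cvg_dot (F := nbhs p)); [exact: cvg_id|exact: cvg_cst].
  have [c] := compact_EVT_min (body_nonempty P) (@body_compact _ _ P)
    (continuous_subspaceT cg).
  rewrite inE => hc mc; exists (g c / N.+1%:R) => nA.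
  have ge0 i p : body P p -> 0 <= dot p (eta i) - off i by rewrite subr_ge0; exact.
  have gc : 0 < g c.
    rewrite lt_neqAle sumr_ge0 ?andbT => [|i _]; last exact: ge0.
    apply/negP; rewrite eq_sym psumr_eq0 => [/allP h|i _]; last exact: ge0.
    apply: nA; exists c => // i iA; apply/eqP; rewrite -subr_eq0.
    by have := h i (mem_index_enum _); rewrite iA.
  split; first by rewrite divr_gt0.
  move=> p hp; apply: contrapT => hn.
  have lt i : i \in A -> dot p (eta i) - off i <= g c / N.+1%:R.
    by move=> iA; apply/ltW; rewrite ltNge; apply/negP => h; apply: hn; exists i.
  have := mc p; rewrite inE => /(_ hp); apply/negP; rewrite -ltNge.
  apply: (@le_lt_trans _ _ (\sum_(i in A) g c / N.+1%:R)); first exact: ler_sum.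
  rewrite sumr_const -[ltLHS]mulr_natr mulrAC -mulrA gtr_pMr // ltr_pdivrMr //.
  by rewrite mul1r ltr_nat ltnS -[leqRHS]card_ord max_card.
have [e he] := choice gap.
have [eps e0 heps] := @fin_lower_bound R _ (fun A => ~ concurrent A) e
  (fun A nA => proj1 (he A nA)).
exists eps => // A p nA hp; have [i iA hi] := (he A nA).2 p hp.
by exists i => //; apply: le_trans hi; exact: heps.
Qed.

(* While all the faces met share a point, hence a vertex, their normals are
   pairwise acute; the velocity becomes dominated by its last normal component
   and points away from all of them, so no further collision is possible. *)
Lemma itinerary_escape : exists m eps, 0 < eps /\ forall i p v,
  itinerary mu kap i p v ->
  exists2 s, (s <= m)%N & eps <= enorm (p s - p 0%N).
Proof.
have [kap2 k20 hk2] := incident_normals_acute.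
have [eps e0 heps] := nonconcurrent_gap.
have [n0 hn0] := exp_small mu01 (mulr_gt0 kap0 k20).
exists n0.+2, eps; split=> // i p v it.
pose A : {set 'I_N} := [set k | [exists s : 'I_n0.+3, k == i s]]%SET.
have iA s : (s <= n0.+2)%N -> i s \in A.
  by move=> hs; rewrite inE; apply/existsP; exists (Ordinal (hs : s < n0.+3)%N).
(* Velocity number [n0.+1] is about to hit face number [n0.+2]. After [n0.+1] bounces off faces
   whose normals are acute with that one, its product with that normal is already non-negative. *)
have nA : ~ concurrent A.
  move=> [q hq hA]; have := it_hit it n0.+1; apply/negP; rewrite -leNgt.
  have acute n : (n <= n0.+2)%N -> kap2 <= dot (eta (i n)) (eta (i n0.+2)).
    by move=> hn; apply: (hk2 _ _ q) => //; apply: hA; exact: iA.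
  apply: le_trans (velocity_drift (W := 1) (delta := kap2) (M := n0.+1) it _ _ _ _ _) => //.
  - by rewrite mulr1 subr_ge0 ltW // hn0.
  - rewrite lerNl -dotNl; apply: le_trans (dot_le _ _) _.
    by rewrite enormN normal_enorm unit_enorm ?mulr1 // (it_unit it).
  - exact: ltW.
  - by move=> n /andP[_ nM]; apply: acute; apply: leqW.
  - by rewrite ltnS leqnn.
(* The starting point is at distance at least [eps] from the plane of some face of the window, and
   the orbit reaches that face at time [s]. *)
have [k kA hk] := heps A (p 0%N) nA (it_body it 0%N).
move: kA; rewrite inE => /existsP[s /eqP ks]; exists s; first by rewrite -ltnS.
apply: le_trans hk _; rewrite {}ks -(it_face it s) -dotBl.
by rewrite -enormN opprB (le_trans (dot_le _ _)) // normal_enorm mulr1.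
Qed.

(* If the normals met do not span, general position yields w with
   dot (eta i) w = 1 for all of them, so after a transient the orbit progresses
   in the direction w by a definite fraction of its length; since windows of m
   collisions have length at least eps, this exceeds the diameter of P. *)
Lemma itinerary_spans : exists k, forall i p v, itinerary mu kap i p v ->
  forall w, (forall n, (1 <= n <= k)%N -> dot w (eta (i n)) = 0) -> w = 0.
Proof.
(* [w] is chosen as a function of the set of faces, so that its length is bounded over all
   itineraries by a maximum over finitely many sets. *)
have dual (A : {set 'I_N}) : exists w, (exists w', forall i, i \in A -> dot w' (eta i) = 1) ->
    forall i, i \in A -> dot w (eta i) = 1.
  have [[w hw]|h] := pselect (exists w', forall i, i \in A -> dot w' (eta i) = 1).
    by exists w.
  by exists 0 => /h.
have [wA hwA] := choice dual.
have [W W0 hW] := @fin_upper_bound R _ (fun A => enorm (wA A)).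
have [B B0 hB] := body_bounded P.
have [m [eps [e0 hesc]]] := itinerary_escape.
(* From [n0] on, the remainder of the initial velocity costs less than half of the gain [kap]. *)
have [n0 hn0] := exp_small mu01 (divr_gt0 (divr_gt0 kap0 (ltr0Sn R 1)) W0).
pose c := eps * (kap / 2).
have c0 : 0 < c by rewrite mulr_gt0 ?divr_gt0.
(* [2 * B * W] bounds the total progress along [w], and each of [q] windows contributes at least
   [c]. *)
have [q hq] := nat_large (2 * B * W / c).
exists (n0.+1 + q * m)%N => i p v it.
set k := (_ + _)%N.
pose A : {set 'I_N} := [set l | [exists s : 'I_k.+1, (1 <= s)%N && (l == i s)]]%SET.
have iA s : (1 <= s <= k)%N -> i s \in A.
  move=> /andP[s1 sk]; rewrite inE; apply/existsP.
  by exists (Ordinal (sk : s < k.+1)%N); rewrite s1 eqxx.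
have [sp|du] := span_or_dual gp A.
  move=> w hw; apply: sp => l; rewrite inE => /existsP[s /andP[s1 /eqP ->]].
  by rewrite hw // s1 -ltnS ltn_ord.
pose w := wA A; have hw n : (1 <= n <= k)%N -> dot (eta (i n)) w = 1.
  by move=> hn; rewrite dotC (hwA A du) // iA.
have fwd n : (n0.+1 <= n <= k)%N -> kap / 2 <= dot (v n) w.
  move=> /andP[n1 nk]; have n2 : (1 <= n <= k)%N by rewrite nk (leq_trans _ n1).
  have := velocity_drift (w := w) (W := W) (delta := 1) (M := k) it (ltW W0) _ ler01 _ n2.
  have hmu := hn0 n (ltnW n1); rewrite ltr_pdivlMr // in hmu.
  have h1 : - W <= dot (v 0%N) w.
    rewrite lerNl -dotNl; apply: le_trans (dot_le _ _) _.
    by rewrite enormN unit_enorm ?mul1r ?(it_unit it) // hW.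
  move=> /(_ h1) h; have {}h : kap * 1 - mu ^+ n * W <= dot (v n) w.
    by apply: h => l hl; rewrite hw.
  lra.
have prog n s : (n0.+1 <= n)%N -> (n + s <= k)%N ->
    kap / 2 * enorm (p (n + s)%N - p n) <= dot (p (n + s)%N - p n) w.
  move=> hn; elim: s => [|s IH] hs.
    by rewrite addn0 subrr enorm0 dot0l mulr0.
  rewrite addnS in hs *; have [t t0 ->] := it_step it (n + s)%N.
  rewrite addrAC dotDl dotZl.
  have := enormD (p (n + s)%N - p n) (t *: v (n + s)%N).
  rewrite enormZ gtr0_norm // (unit_enorm (it_unit it _)) mulr1.
  have := IH (ltnW hs); have : kap / 2 <= dot (v (n + s)%N) w.
    by apply: fwd; rewrite (leq_trans hn) ?leq_addr //= ltnW.
  move: kap0 t0; move: (kap) (enorm _) (enorm _) (dot _ _) (dot _ _) => *; nra.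
have windows j : (j <= q)%N ->
    j%:R * c <= dot (p (n0.+1 + j * m)%N - p n0.+1) w.
  elim: j => [_|j IH jq]; first by rewrite mul0r mul0n addn0 subrr dot0l.
  have hk : (n0.+1 + j.+1 * m <= k)%N by rewrite leq_add2l leq_mul2r jq orbT.
  have [s sm hs] := hesc _ _ _ (itinerary_shift (n0.+1 + j * m)%N it).
  rewrite addn0 in hs.
  have a1 : (n0.+1 <= n0.+1 + j * m)%N by rewrite leq_addr.
  have e1 : (n0.+1 + j.+1 * m = n0.+1 + j * m + s + (m - s))%N.
    by rewrite -addnA -addnA subnKC // mulSn (addnC m).
  (* The displacement by [eps] is reached after [s <= m] collisions; the remaining [m - s]
     collisions of the window cannot undo the progress. *)
  have p1 : c <= dot (p (n0.+1 + j * m + s)%N - p (n0.+1 + j * m)%N) w.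
    apply: le_trans (prog _ _ a1 _); last first.
      by apply: leq_trans hk; rewrite e1 leq_addr.
    by rewrite /c mulrC ler_pM2l // divr_gt0.
  have p2 : 0 <= dot (p (n0.+1 + j.+1 * m)%N - p (n0.+1 + j * m + s)%N) w.
    rewrite e1; apply: le_trans (prog _ _ _ _); rewrite -?e1 //.
      by rewrite mulr_ge0 ?enorm_ge0 // divr_ge0 // ltW.
    by rewrite (leq_trans a1) // leq_addr.
  have := IH (ltnW jq); move: p1 p2; rewrite !dotBl -natr1 mulrDl mul1r; lra.
have := windows q (leqnn q); rewrite -/k => hk.
have : dot (p k - p n0.+1) w <= 2 * B * W.
  apply: le_trans (dot_le _ _) _; apply: ler_pM; rewrite ?enorm_ge0 //; last exact: hW.
  apply: le_trans (enormB _ _) _; have := hB _ (it_body it k).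
  by have := hB _ (it_body it n0.+1); lra.
move: hq; rewrite ltr_pdivrMr //; lra.
Qed.

End Constants.

End Itineraries.

(** * Contracting reflection laws *)

Section WithinDerivative.
Context {R : realType}.
Implicit Types (A : set R) (f g : R -> R) (t L : R).

(** This form has no quotient at [s = t], and it puts the one-sided derivative at angle [0] and the
    two-sided ones under the same chain rule. *)
Definition deriv_within A t f L := forall e, 0 < e ->
  \forall s \near t, A s -> `|f s - f t - L * (s - t)| <= e * `|s - t|.

Lemma has_derivative_within A f f1 t : has_derivative_on A f f1 -> A t ->
  deriv_within A t f (f1 t).
Proof.
move=> h At e e0; have /cvgrPdist_le /(_ e e0) hq := h t At.
rewrite near_withinE in hq; apply: filterS hq => s hs As; have [->|st] := eqVneq s t.
  by rewrite !subrr mulr0 subrr !normr0 mulr0.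
have st0 : s - t != 0 by rewrite subr_eq0.
have := hs (conj As (elimN eqP st)).
rewrite -(ler_pM2r (x := `|s - t|)) ?normr_gt0 // -normrM.
rewrite (_ : (f1 t - _) * (s - t) = - (f s - f t - f1 t * (s - t))) ?normrN //.
by field.
Qed.

Lemma is_derive_within A f t L : is_derive t 1 f L -> deriv_within A t f L.
Proof.
move=> [hd hL] e e0; have hcv : (fun h => h^-1 *: (f (h *: 1 + t) - f t)) @ 0^' --> L.
  by rewrite -hL.
have [r /= r0 hr] := (nbhs_ballP _ _).1 ((cvgrPdist_le _ _).1 hcv e e0).
apply/nbhs_ballP; exists r => //= s sr _.
have [->|st] := eqVneq s t; first by rewrite !subrr mulr0 subrr !normr0 mulr0.
have st0 : s - t != 0 by rewrite subr_eq0.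
have sr' : ball 0 r (s - t) by rewrite /ball /= sub0r normrN distrC.
have := hr (s - t) sr' st0.
rewrite /GRing.scale /= mulr1 subrK.
rewrite -(ler_pM2r (x := `|s - t|)) ?normr_gt0 // -normrM => h.
apply: (le_trans _ h); rewrite -normrN le_eqVlt; apply/orP; left; apply/eqP.
by congr `|_|; field.
Qed.

Lemma deriv_within_cvg A f t L : deriv_within A t f L ->
  f s @[s --> within A (nbhs t)] --> f t.
Proof.
move=> h; apply/cvgrPdist_lt => e e0.
have hM : 0 < `|L| + 2 by rewrite ltr_wpDl.
have hd : 0 < e / (`|L| + 2) by rewrite divr_gt0.
have hb : \forall s \near t, `|t - s| < e / (`|L| + 2).
  by apply/nbhs_ballP; exists (e / (`|L| + 2)).
have h1 := h 1 ltr01.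
rewrite near_withinE; apply: (filterS2 _ _ h1 hb) => s + hs As => /(_ As).
rewrite mul1r => h2; rewrite distrC; rewrite distrC in hs.
have -> : f s - f t = f s - f t - L * (s - t) + L * (s - t) by rewrite subrK.
apply: le_lt_trans (ler_normD _ _) _; rewrite normrM.
by move: hs; rewrite ltr_pdivlMr //; have := normr_ge0 (s - t); nra.
Qed.

Lemma deriv_within_comp A f g t L M : deriv_within A t f L ->
  is_derive (f t) 1 g M -> deriv_within A t (g \o f) (M * L).
Proof.
move=> hf /(is_derive_within setT) hg e e0.
have c0 : 0 < `|M| + `|L| + 1 by rewrite ltr_wpDl // addr_ge0.
pose e1 := Num.min 1 (e / (`|M| + `|L| + 1)).
have e10 : 0 < e1 by rewrite lt_min ltr01 divr_gt0.
have e11 : e1 <= 1 by rewrite ge_min lexx.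
have e1e : e1 * (`|M| + `|L| + 1) <= e by rewrite -ler_pdivlMr // ge_min lexx orbT.
have h1 := hf e1 e10.
have h2 : \forall s \near within A (nbhs t), True -> 
    `|g (f s) - g (f t) - M * (f s - f t)| <= e1 * `|f s - f t|.
  exact: (deriv_within_cvg hf) (hg e1 e10).
rewrite near_withinE in h2.
apply: (filterS2 _ _ h1 h2) => s + + As => /(_ As) a1 /(_ As Logic.I) a2.
have -> : g (f s) - g (f t) - M * L * (s - t) =
  (g (f s) - g (f t) - M * (f s - f t)) + M * (f s - f t - L * (s - t)) by ring.
apply: le_trans (ler_normD _ _) _; rewrite normrM.
have a3 : `|f s - f t| <= (`|L| + 1) * `|s - t|.
  have -> : f s - f t = f s - f t - L * (s - t) + L * (s - t) by rewrite subrK.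
  apply: le_trans (ler_normD _ _) _; rewrite normrM.
  have := normr_ge0 (s - t); nra.
apply: le_trans (ler_wpM2r (normr_ge0 (s - t)) e1e).
have := normr_ge0 (s - t); have := normr_ge0 M; have := normr_ge0 L.
nra.
Qed.


Lemma deriv_within_is_derive A f t L : nbhs t A -> deriv_within A t f L ->
  is_derive t 1 f L.
Proof.
move=> nA h.
have cv : (fun h => h^-1 *: (f (h *: 1 + t) - f t)) @ 0^' --> L.
  apply/cvgrPdist_le => e e0.
  have hn : \forall s \near t, `|f s - f t - L * (s - t)| <= e * `|s - t|.
    by apply: (filterS2 _ _ nA (h e e0)) => s As; apply.
  have [r /= r0 hr] := (nbhs_ballP _ _).1 hn.
  exists r => //= s; rewrite /ball /= sub0r normrN => sr s0.
  have := hr (s *: 1 + t); rewrite /ball /= opprD addrCA subrr addr0 normrN.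
  rewrite /GRing.scale /= mulr1 => /(_ sr); rewrite addrK.
  rewrite -ler_pdivrMr ?normr_gt0 // -normfV -normrM => h1; apply: le_trans h1.
  rewrite -normrN le_eqVlt; apply/orP; left; apply/eqP; congr `|_|.
  by field.
by split; [exact: (cvgP _ cv)|exact: (cvg_lim _ cv)].
Qed.
End WithinDerivative.

Definition angles {R : realType} : set R := [set t | 0 <= t < pi / 2].

Section Angles.
Context {R : realType}.
Implicit Types (c t : R).

Lemma angles0 : angles (0 : R).
Proof. by rewrite /angles /= lexx divr_gt0 ?pi_gt0. Qed.

Lemma cos_angles_gt0 t : angles t -> 0 < cos t.
Proof.
by move=> /andP[t0 t1]; apply: cos_gt0_pihalf; rewrite t1 (lt_le_trans _ t0) //
  oppr_lt0 divr_gt0 ?pi_gt0.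
Qed.

Lemma sin_angles_ge0 t : angles t -> 0 <= sin t.
Proof.
move=> /andP[t0 t1]; apply: sin_ge0_pi; rewrite t0 (le_trans (ltW t1)) //.
by have := pi_gt0 R; lra.
Qed.

Lemma sin_angles_gt0 t : angles t -> t != 0 -> 0 < sin t.
Proof.
move=> /andP[t0 t1] tn0; apply: sin_gt0_pihalf; rewrite t1 andbT.
by rewrite lt_neqAle eq_sym tn0.
Qed.

Lemma cos_angles_le t s : 0 <= t -> t <= s -> s <= pi -> cos s <= cos t.
Proof.
move=> t0 ts sp; rewrite leNgt ltr_cos ?in_itv /= -?leNgt //.
  by rewrite (le_trans t0 ts).
by rewrite t0 (le_trans ts).
Qed.

Lemma acos_angles c : 0 < c <= 1 -> angles (acos c).
Proof.
move=> /andP[c0 c1]; have cI : c \in `[-1, 1].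
  by rewrite in_itv /= c1 andbT (le_trans _ (ltW c0)) // lerN10.
have a0 : 0 <= acos c by rewrite acos_ge0.
rewrite /angles /= a0 /= ltNge; apply/negP => h.
have := cos_angles_le (divr_ge0 (pi_ge0 R) (ler0n _ 2)) h (acos_lepi cI).
by rewrite acosK // cos_pihalf leNgt c0.
Qed.

Lemma cos_acos c : 0 < c <= 1 -> cos (acos c) = c.
Proof.
by move=> /andP[c0 c1]; rewrite acosK // in_itv /= c1 andbT (le_trans _ (ltW c0)) // lerN10.
Qed.

Lemma acos_eq0 c : 0 < c <= 1 -> acos c = 0 -> c = 1.
Proof. by move=> /cos_acos {2}<- ->; rewrite cos0. Qed.

(** At [c = 1], the case of normal incidence, one-sided continuity is derived from the monotonicity
    of [cos]. *)
Lemma cvg_acos c : 0 < c <= 1 ->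
  acos s @[s --> within [set s | 0 < s <= 1] (nbhs c)] --> acos c.
Proof.
move=> /andP[c0]; rewrite le_eqVlt => /orP[/eqP ->|c1]; last first.
  apply: cvg_within_filter; apply: continuous_acos.
  by rewrite c1 andbT (lt_trans _ c0) // ltrN10.
rewrite acos1; apply/cvgrPdist_lt => e e0.
have p0 := pi_gt0 R; pose r := Num.min e (pi / 4).
have r0 : 0 < r by rewrite lt_min e0 divr_gt0.
have rp : r <= pi / 4 by rewrite ge_min lexx orbT.
have cr : cos r < 1 by rewrite -[ltRHS]cos0 ltr_cos ?in_itv /= ?lexx ?(ltW r0) ?(ltW p0) //=; lra.
have hn : \forall s \near (1 : R), cos r < s by exact: lt_nbhsr.
rewrite near_withinE; apply: filterS hn => s hs sI.
have /andP[a0 a1] := acos_angles sI.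
rewrite sub0r normrN ger0_norm //.
have ra : acos s < r.
  rewrite ltNge; apply/negP => ra; have ap : acos s <= pi by lra.
  by have := cos_angles_le (ltW r0) ra ap; rewrite cos_acos // leNgt hs.
by apply: lt_le_trans ra _; rewrite ge_min lexx.
Qed.

Lemma cvg_comp_acos c (g : R -> R) (L : R) : 0 < c <= 1 ->
  g t @[t --> within angles (nbhs (acos c))] --> L ->
  g (acos s) @[s --> within [set s | 0 < s <= 1] (nbhs c)] --> L.
Proof.
move=> cI hg A /hg hA; have := cvg_acos cI hA.
rewrite /nbhs /= /within /= => h; apply: filterS h => s h sI.
by apply: h => //; exact: acos_angles.
Qed.

End Angles.

(** All that the dynamics retains of the law: [mu] bounds both its derivative and the contraction of
    the tangential velocity, and [kap] bounds from below the normal component of an outgoing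
    velocity. *)
Record law_bounds {R : realType} (f f1 : R -> R) (mu kap : R) : Prop := LawBounds {
  lawI : forall t, angles t -> angles (f t);
  law0 : f 0 = 0;
  law_le : forall t, angles t -> f t <= t;
  lawD : forall t, angles t -> deriv_within angles t f (f1 t);
  lawC : forall t, angles t -> f1 s @[s --> within angles (nbhs t)] --> f1 t;
  law_mu : 0 <= mu < 1;
  law_kap : 0 < kap;
  law_deriv : forall t, angles t -> `|f1 t| <= mu;
  law_sin : forall t, angles t -> sin (f t) <= mu * sin t;
  law_cos : forall t, angles t -> kap <= cos (f t)
}.

Section ReflectionLaws.
Context {R : realType}.

Lemma sin_le_id (t : R) : 0 <= t -> sin t <= t.
Proof.
rewrite le_eqVlt => /orP[/eqP <-|t0]; first by rewrite sin0.
have [c _] := @MVT R sin cos 0 t t0 (fun x _ => is_derive_sin x)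
  (continuous_subspaceT (@continuous_sin R)).
by rewrite sin0 !subr0 => ->; rewrite ger_pMl // cos_le1.
Qed.

(* With m the midpoint of lam and 1, sin t - sin (lam t) is at least
   sin (m t) - sin (lam t), to which the mean value theorem applies on an
   interval where cos is bounded below by cos (m pi / 2). *)
Lemma sin_contract (lam : R) : 0 <= lam < 1 -> exists2 mu, 0 <= mu < 1 &
  forall s t, angles t -> 0 <= s <= lam * t -> sin s <= mu * sin t.
Proof.
move=> /andP[l0 l1]; have p0 := pi_gt0 R.
pose m := (1 + lam) / 2; pose k := cos (m * (pi / 2)).
have k0 : 0 < k by apply: cos_gt0_pihalf; rewrite /m; nra.
have k1 : k <= 1 by exact: cos_le1.
exists (1 - (1 - lam) / 2 * k); first by nra.
move=> s t tI /andP[s0 st]; case/andP: (tI) => t0 tp.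
have [t00|tn0] := eqVneq t 0.
  have -> : s = 0 by move: s0 st; rewrite t00; lra.
  by rewrite t00 !sin0 mulr0.
have {tn0}t0 : 0 < t by rewrite lt_neqAle eq_sym tn0.
have sm : s < m * t by rewrite /m; nra.
have [c] := @MVT R sin cos s (m * t) sm (fun x _ => is_derive_sin x)
  (continuous_subspaceT (@continuous_sin R)).
rewrite in_itv /= => /andP[sc cm] hc.
have kc : k <= cos c by apply: cos_angles_le; rewrite /m in cm *; nra.
have mt : sin (m * t) <= sin t.
  by rewrite leNgt ltr_sin ?in_itv /= -?leNgt //; rewrite /m; try (apply/andP; split); nra.
have := sin_le_id (ltW t0); have k2 : k * (m * t - s) <= sin (m * t) - sin s.
  by rewrite hc ler_wpM2r // subr_ge0 ltW.
have : k * ((1 - lam) / 2 * t) <= k * (m * t - s).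
  by rewrite ler_pM2l // /m; lra.
have kl : 0 <= k * ((1 - lam) / 2) by rewrite mulr_ge0 //; lra.
move=> k3 st'; have : k * ((1 - lam) / 2) * sin t <= k * ((1 - lam) / 2) * t.
  exact: ler_wpM2l.
lra.
Qed.

Lemma contracting_law_bounds (f : R -> R) : contracting_reflection_law f ->
  exists f1 mu kap, law_bounds f f1 mu kap.
Proof.
move=> [fI f0 [f1 [f2 [hd1 hd2 _ /andP[sup0 sup1]]]]].
set S := ereal_sup _ in sup0 sup1.
have [lam [l0 l1 hlam]] : exists lam, [/\ 0 <= lam, lam < 1 &
    forall t, angles t -> `|f1 t| <= lam].
  have hS t : angles t -> ((`|f1 t|)%:E <= S)%E.
    by move=> tI; apply: ereal_sup_ubound; exists t.
  case: S sup0 sup1 hS => [r| |] //; rewrite !lte_fin => r0 r1 hr.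
  by exists r; split=> [||t /hr]; rewrite ?lee_fin // ltW.
have fle t : angles t -> 0 <= f t <= lam * t.
  move=> tI; have /andP[-> _] := fI t tI; case/andP: (tI) => t0 tp /=.
  move: t0; rewrite le_eqVlt => /orP[/eqP <-|t0]; first by rewrite f0 mulr0.
  have sI s : 0 <= s <= t -> angles s.
    by move=> /andP[s0 s1]; rewrite /angles /= s0 (le_lt_trans s1).
  have der x : x \in `]0, t[ -> is_derive x 1 f (f1 x).
    rewrite in_itv /= => /andP[x0 xt]; have xI : angles x by apply: sI; rewrite !ltW.
    apply: (deriv_within_is_derive (A := angles)); last exact: has_derivative_within.
    have : nbhs x `]0, t[%classic by apply: near_in_itvoo; rewrite in_itv /= x0.
    apply: filterS => y; rewrite /= in_itv /= => /andP[y0 yt].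
    by apply: sI; rewrite !ltW.
  have con : {within `[0, t], continuous f}.
    apply/subspace_continuousP => x; rewrite /= in_itv /= => xt.
    have := deriv_within_cvg (has_derivative_within hd1 (sI x xt)).
    apply: cvg_trans; apply: cvg_app; apply: within_subset => y.
    by rewrite /= in_itv /=; exact: sI.
  have [c] := MVT t0 der con; rewrite in_itv /= f0 !subr0 => /andP[c0 ct] ->.
  rewrite ler_pM2r //; apply: le_trans (ler_norm _) (hlam _ _).
  by apply: sI; rewrite !ltW.
have [mu' /andP[m0 m1] hmu'] := sin_contract (introT andP (conj l0 l1)).
have p0 := pi_gt0 R.
(* By the mean value theorem [f t <= lam * t < lam * (pi / 2)], so outgoing directions stay away
   from grazing; this is the origin of [kap]. *)
exists f1, (Num.max lam mu'), (cos (lam * (pi / 2))); split=> //.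
- by move=> t tI; case/andP: (fle t tI) => _; case/andP: tI => t0 _; nra.
- by move=> t tI; exact: has_derivative_within.
- by move=> t tI; apply: deriv_within_cvg; exact: (has_derivative_within hd2 tI).
- by rewrite le_max l0 gt_max l1.
- by apply: cos_gt0_pihalf; nra.
- by move=> t /hlam h; rewrite le_max h.
- move=> t tI; apply: le_trans (hmu' _ _ tI (fle t tI)) _.
  by rewrite ler_wpM2r ?sin_angles_ge0 // le_max lexx orbT.
- move=> t tI; case/andP: (fle t tI) => a0 a1; case/andP: tI => t0 t1.
  by apply: cos_angles_le => //; nra.
Qed.


End ReflectionLaws.

(** * Derivative of the contraction *)

Section Contraction.
Context {R : realType} (f f1 : R -> R) (mu kap : R).
Hypothesis H : law_bounds f f1 mu kap.

(* The factor of the tangential component, continued to t = 0, where the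
   quotient in Defs.contraction is the junk value 0. *)
Definition slope (t : R) := if t == 0 then f1 0 else sin (f t) / sin t.
(** The tangential part has length [sin (f t)], and its derivative with respect to [sin t] is
    [f1 t * cos (f t) / cos t]. This is the factor in the plane of [eta] and the velocity, compared
    here with the factor [slope t] across that plane. *)
Definition excess (t : R) := f1 t * cos (f t) / cos t - slope t.

Lemma excess0 : excess 0 = 0.
Proof. by rewrite /excess /slope eqxx (law0 H) cos0; field. Qed.

Lemma slope_sin t : angles t -> slope t * sin t = sin (f t).
Proof.
move=> tI; rewrite /slope; case: eqVneq => [->|t0].
  by rewrite (law0 H) sin0 mulr0.
by rewrite divfK // gt_eqF // sin_angles_gt0.
Qed.

Lemma slope_le t : angles t -> `|slope t| <= mu.
Proof.
move=> tI; rewrite /slope; case: eqVneq => [_|t0]; first exact/(law_deriv H)/angles0.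
have st := sin_angles_gt0 tI t0.
rewrite ger0_norm; first by rewrite ler_pdivrMr // (law_sin H).
by rewrite divr_ge0 ?(ltW st) //; apply: sin_angles_ge0; exact: (lawI H).
Qed.

Lemma cvg_cos_within (t : R) : cos s @[s --> within angles (nbhs t)] --> cos t.
Proof. by apply: cvg_within_filter; exact: continuous_cos. Qed.

Lemma cvg_cosf t : angles t -> cos (f s) @[s --> within angles (nbhs t)] --> cos (f t).
Proof.
move=> tI; have := deriv_within_cvg (lawD H tI).
by apply: continuous_cvg; exact: continuous_cos.
Qed.

Lemma slope_cvg t : angles t ->
  slope s @[s --> within angles (nbhs t)] --> slope t.
Proof.
move=> tI; have [t0|tn0] := eqVneq t 0; last first.
  have h : sin (f s) / sin s @[s --> within angles (nbhs t)] --> sin (f t) / sin t.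
    apply: cvgM.
      have := deriv_within_cvg (lawD H tI).
      by apply: continuous_cvg; exact: continuous_sin.
    apply: cvgV; first by rewrite gt_eqF // sin_angles_gt0.
    by apply: cvg_within_filter; exact: continuous_sin.
  rewrite {2}/slope (negbTE tn0); apply: cvg_trans h.
  apply: near_eq_cvg; apply: cvg_within.
  have tpos : 0 < t by rewrite lt_neqAle eq_sym tn0; case/andP: tI.
  by apply: filterS (lt_nbhsr tpos) => s s0; rewrite /slope gt_eqF.
rewrite {}t0 in tI *; rewrite {2}/slope eqxx.
have hs : is_derive (f 0) 1 (@sin R) 1.
  rewrite (law0 H) -[X in is_derive _ _ _ X](@cos0 R); exact: is_derive_sin.
have h1 := deriv_within_comp (lawD H tI) hs.
have h2 : deriv_within angles 0 (@sin R) 1.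
  by apply: is_derive_within; rewrite -[X in is_derive _ _ _ X](@cos0 R); exact: is_derive_sin.
apply/cvgrPdist_le => e e0.
(* The bound [1 / 2] gives [sin s >= s / 2]; the errors of the two first-order expansions, at most
   [2 * e1 * s] together, are then below [e * sin s]. *)
pose e1 := Num.min (1 / 2) (e / 4).
have e10 : 0 < e1 by rewrite lt_min !divr_gt0.
have e12 : e1 <= 1 / 2 by rewrite ge_min lexx.
have e14 : e1 <= e / 4 by rewrite ge_min lexx orbT.
rewrite near_withinE; apply: (filterS2 _ _ (h1 e1 e10) (h2 e1 e10)) => s + + sI.
move=> /(_ sI) /= a1 /(_ sI) a2; rewrite /slope; case: eqVneq => [_|s0].
  by rewrite subrr normr0 ltW.
have ss := sin_angles_gt0 sI s0.
have sp : 0 <= s by case/andP: sI.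
rewrite (law0 H) sin0 !subr0 !mul1r (ger0_norm sp) in a1 a2.
have f10 := le_trans (law_deriv H tI) (ltW (andP (law_mu H)).2).
rewrite -(ler_pM2r ss); set A := `|_|.
have {A}-> : A * sin s = `|(f1 0 - sin (f s) / sin s) * sin s|.
  by rewrite normrM (gtr0_norm ss).
rewrite mulrBl divfK ?gt_eqF //.
have -> : f1 0 * sin s - sin (f s) =
  - (sin (f s) - f1 0 * s) + f1 0 * (sin s - s) by ring.
apply: le_trans (ler_normD _ _) _; rewrite normrN normrM.
have := normr_ge0 (f1 0); have := normr_ge0 (sin s - s).
have /andP[a3 a4] : - (e1 * s) <= sin s - s <= e1 * s by rewrite -ler_norml.
nra.
Qed.

Lemma excess_cvg t : angles t ->
  excess s @[s --> within angles (nbhs t)] --> excess t.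
Proof.
move=> tI; apply: cvgB; last exact: slope_cvg.
apply: cvgM; first by apply: cvgM; [exact: (lawC H)|exact: cvg_cosf].
apply: cvgV; first by rewrite gt_eqF // cos_angles_gt0.
exact: cvg_cos_within.
Qed.

Section Vectors.
Context {d : nat}.
Implicit Types (eta r y z : 'rV[R]_d).

Definition tangential eta r := r - dot r eta *: eta.
Definition angle eta r : R := acos (dot r eta).

(** The product rule applied to [cos (f t) *: eta + slope t *: n]: the terms come from varying [n],
    [cos (f t)] and [slope t] in this order. For [z] orthogonal to [r] one has
    [dot z n = - (dot r eta * dot z eta)], which gives the last term its form; at [n = 0] that term
    vanishes. *)
Definition dcontraction_tangent eta r z :=
  let t := angle eta r in
  let n := tangential eta r in
  slope t *: tangential eta z + (f1 t * slope t * dot z eta) *: eta +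
  (excess t * dot z n / dot n n) *: n.

(* The derivative of the contraction at r, extended from the tangent space of
   the sphere by the orthogonal projection. *)
Definition dcontraction eta r y := dcontraction_tangent eta r (tangential r y).

Lemma unit_dot_le1 eta r : dot eta eta = 1 -> dot r r = 1 -> dot r eta <= 1.
Proof.
by move=> he hr; apply: le_trans (dot_le _ _) _; rewrite !unit_enorm // mulr1.
Qed.

Section Fixed.
Variables eta r : 'rV[R]_d.
Hypotheses (he : dot eta eta = 1) (hr : dot r r = 1) (rpos : 0 < dot r eta).
Local Notation c := (dot r eta).
Local Notation t := (angle eta r).
Local Notation n := (tangential eta r).

Lemma c_itv : 0 < c <= 1. Proof. by rewrite rpos unit_dot_le1. Qed.
Lemma angle_angles : angles t. Proof. exact: acos_angles c_itv. Qed.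
Lemma cos_angle : cos t = c. Proof. exact: cos_acos c_itv. Qed.
Lemma tangential_orth : dot n eta = 0.
Proof. by rewrite /tangential !bilin he mulr1 subrr. Qed.
Lemma tangential_sqr : dot n n = sin t ^+ 2.
Proof.
by rewrite sin2cos2 cos_angle {2}/tangential dotBr dotZr tangential_orth mulr0
  subr0 /tangential !bilin hr (dotC eta); ring.
Qed.

Lemma contractionE :
  Defs.contraction f eta r = cos (f t) *: eta + slope t *: n.
Proof.
rewrite /Defs.contraction -/(angle eta r) cos_angle /proj /proj_orth scalerA.
rewrite divfK ?gt_eqF //; congr (_ + _); rewrite /slope.
case: eqVneq => [t0|//].
have n0 : n = 0 by apply: dot_eq0; rewrite tangential_sqr t0 sin0 expr0n.
by rewrite -/(tangential eta r) n0 !scaler0.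
Qed.

Lemma slope_tangential : slope t ^+ 2 * dot n n = sin (f t) ^+ 2.
Proof. by rewrite tangential_sqr -exprMn slope_sin //; exact: angle_angles. Qed.

Lemma contraction_unit : dot (Defs.contraction f eta r) (Defs.contraction f eta r) = 1.
Proof.
rewrite contractionE; have := slope_tangential; have := cos2Dsin2 (f t).
move: n tangential_orth => m ho h1 h2.
by rewrite !bilin he (dotC eta) ho; lra.
Qed.

Lemma contraction_normal : dot (Defs.contraction f eta r) eta = cos (f t).
Proof.
rewrite contractionE; move: n tangential_orth => m ho.
by rewrite !bilin he ho; ring.
Qed.

Lemma contraction_normal_ge : kap <= dot (Defs.contraction f eta r) eta.
Proof. by rewrite contraction_normal; apply: (law_cos H); exact: angle_angles. Qed.

Lemma tangential0 : dot n n = 0 -> n = 0.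
Proof. exact: dot_eq0. Qed.

Lemma dot_tangent z : dot z r = 0 -> dot z n = - (c * dot z eta).
Proof. by move=> hz; rewrite {1}/tangential dotBr dotZr hz sub0r. Qed.

Lemma cauchy_tangential z : dot z n ^+ 2 <= (dot z z - dot z eta ^+ 2) * dot n n.
Proof.
have hzn : dot (tangential eta z) n = dot z n.
  by rewrite {1}/tangential dotBl dotZl (dotC eta) tangential_orth mulr0 subr0.
have hzz : dot (tangential eta z) (tangential eta z) = dot z z - dot z eta ^+ 2.
  by rewrite /tangential !bilin he (dotC eta); ring.
rewrite -hzn -hzz -!enorm_sqr -exprMn -real_normK ?num_real //.
by rewrite ler_sqr ?nnegrE ?mulr_ge0 ?enorm_ge0 // dot_norm_le.
Qed.

(** On vectors orthogonal to [r] the derivative scales by [f1] in the plane of [eta] and [r] and by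
    [slope] across it, with orthogonal images; both factors are at most [mu] in absolute value. *)
Lemma dcontraction_tangent_norm z : dot z r = 0 ->
  dot (dcontraction_tangent eta r z) (dcontraction_tangent eta r z)
    <= mu ^+ 2 * dot z z.
Proof.
move=> hz; have ha := dot_tangent hz; have hc := cauchy_tangential z.
have hs := slope_tangential; have hN := tangential_sqr.
have tI := angle_angles; have hcos := cos2Dsin2 t; rewrite cos_angle -hN in hcos.
have b2 : slope t ^+ 2 <= mu ^+ 2.
  rewrite -real_normK ?num_real // ler_sqr ?nnegrE //; first exact: slope_le.
  by case/andP: (law_mu H).
have f2 : f1 t ^+ 2 <= mu ^+ 2.
  rewrite -real_normK ?num_real // ler_sqr ?nnegrE //; first exact: (law_deriv H).
  by case/andP: (law_mu H).
have hk : excess t + slope t = f1 t * cos (f t) / c.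
  by rewrite /excess cos_angle subrK.
have hf := cos2Dsin2 (f t).
have -> : dot (dcontraction_tangent eta r z) (dcontraction_tangent eta r z) =
    slope t ^+ 2 * (dot z z - dot z eta ^+ 2) + f1 t ^+ 2 * slope t ^+ 2 * dot z eta ^+ 2
    + (2 * slope t * excess t + excess t ^+ 2 * (dot n n / dot n n)) *
      (dot z n ^+ 2 / dot n n).
  have hzn : dot (tangential eta z) n = dot z n.
    by rewrite {1}/tangential dotBl dotZl (dotC eta) tangential_orth mulr0 subr0.
  have hze : dot (tangential eta z) eta = 0.
    by rewrite /tangential !bilin he; ring.
  have hzz : dot (tangential eta z) (tangential eta z) = dot z z - dot z eta ^+ 2.
    by rewrite /tangential !bilin he (dotC eta); ring.
  rewrite /dcontraction_tangent; move: hzn hze hzz tangential_orth.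
  move: (tangential eta z) n => zt m hzn hze hzz ho.
  rewrite !bilin hzz hze hzn he (dotC eta zt) (dotC m zt) (dotC eta m) hze hzn ho.
  ring.
have [N0|N0] := eqVneq (dot n n) 0.
  have a0 : dot z n = 0 by rewrite tangential0 ?dot0r.
  have h0 : dot z eta = 0.
    by move: ha; rewrite a0 => /esym/eqP; rewrite oppr_eq0 mulf_eq0 gt_eqF //= => /eqP.
  by rewrite a0 h0 expr0n /= mul0r !mulr0 subr0 !addr0 ler_wpM2r ?dot_ge0.
have Npos : 0 < dot n n by rewrite lt_neqAle eq_sym N0 dot_ge0.
have c0 : c != 0 by rewrite gt_eqF.
(* [Q] is the squared length of the component of [z] in the plane of [eta] and [r], and [W] that of
   the component across it. *)
set Q := dot z n ^+ 2 / (dot n n * c ^+ 2).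
set W := dot z z - Q.
have hh : dot z eta = - dot z n / c by rewrite ha; field.
have W0 : 0 <= W.
  rewrite /W /Q subr_ge0 ler_pdivrMr; last by rewrite mulr_gt0 // exprn_gt0.
  have h2 : c ^+ 2 * dot z eta ^+ 2 = dot z n ^+ 2 by rewrite ha; ring.
  have : dot n n * dot z n ^+ 2 = dot n n * (c ^+ 2 * dot z eta ^+ 2) by rewrite h2.
  have := sqr_ge0 c; nra.
have Q0 : 0 <= Q by rewrite divr_ge0 ?sqr_ge0 // mulr_ge0 ?sqr_ge0 ?dot_ge0.
have -> : dot z z = W + Q by rewrite /W; ring.
rewrite divff // mulr1.
have e1 : 2 * slope t * excess t + excess t ^+ 2 =
    (f1 t * cos (f t) / c) ^+ 2 - slope t ^+ 2 by rewrite -hk; ring.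
rewrite e1 hh.
have e2 : f1 t ^+ 2 * slope t ^+ 2 * (- dot z n / c) ^+ 2 =
    f1 t ^+ 2 * (1 - cos (f t) ^+ 2) * Q.
  have -> : 1 - cos (f t) ^+ 2 = slope t ^+ 2 * dot n n by rewrite hs -hf; ring.
  by rewrite /Q; field; rewrite ?N0 ?c0.
have e3 : (f1 t * cos (f t) / c) ^+ 2 * (dot z n ^+ 2 / dot n n) =
    f1 t ^+ 2 * cos (f t) ^+ 2 * Q by rewrite /Q; field; rewrite ?N0 ?c0.
have e4 : dot z n ^+ 2 / dot n n + (- dot z n / c) ^+ 2 = (c ^+ 2 + dot n n) * Q.
  by rewrite /Q; field; rewrite ?N0 ?c0.
rewrite hcos mul1r in e4.
rewrite mulrBl e3 e2 (mulrDr (mu ^+ 2)).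
have e5 : slope t ^+ 2 * W <= mu ^+ 2 * W by rewrite ler_wpM2r.
have e6 : f1 t ^+ 2 * Q <= mu ^+ 2 * Q by rewrite ler_wpM2r.
apply: le_trans (lerD e5 e6); rewrite le_eqVlt; apply/orP; left; apply/eqP.
move: e4 => /(congr1 (fun q => q - dot z n ^+ 2 / dot n n)).
rewrite addrAC subrr add0r => ->; ring.
Qed.

Lemma dcontraction_norm y : enorm (dcontraction eta r y) <= mu * enorm y.
Proof.
have mu0 : 0 <= mu by case/andP: (law_mu H).
have hz : dot (tangential r y) r = 0 by rewrite /tangential !bilin hr; ring.
apply: enorm_le; first by rewrite mulr_ge0 ?enorm_ge0.
apply: le_trans (dcontraction_tangent_norm hz) _.
rewrite exprMn enorm_sqr ler_wpM2l ?sqr_ge0 //.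
by rewrite /tangential !bilin hr (dotC r); have := sqr_ge0 (dot y r); lra.
Qed.

Lemma dcontraction_orth y :
  dot (dcontraction eta r y) (Defs.contraction f eta r) = 0.
Proof.
have hz : dot (tangential r y) r = 0 by rewrite /tangential !bilin hr; ring.
rewrite /dcontraction; move: (tangential r y) hz => z hz.
have ha := dot_tangent hz.
have hze : dot (tangential eta z) eta = 0.
  by rewrite /tangential !bilin he; ring.
have hzn : dot (tangential eta z) n = dot z n.
  by rewrite {1}/tangential dotBl dotZl (dotC eta) tangential_orth mulr0 subr0.
have hk : excess t + slope t = f1 t * cos (f t) / c.
  by rewrite /excess cos_angle subrK.
rewrite contractionE /dcontraction_tangent.
have [N0|N0] := eqVneq (dot n n) 0.
  have a0 : dot z n = 0 by rewrite tangential0 ?dot0r.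
  have h0 : dot z eta = 0.
    by move: ha; rewrite a0 => /esym/eqP; rewrite oppr_eq0 mulf_eq0 gt_eqF //= => /eqP.
  rewrite a0 h0 N0 (tangential0 N0); move: (tangential eta z) hze => zt hze.
  rewrite !bilin hze; ring.
move: tangential_orth hzn N0 ha hze.
move: (tangential eta z) n => zt m ho hzn N0 ha hze.
rewrite !bilin (dotC eta m) he hze hzn ho.
have -> : excess t = f1 t * cos (f t) / c - slope t by rewrite -hk addrK.
by rewrite ha; field; rewrite N0 gt_eqF.
Qed.

(* A chord r' - r of the sphere is orthogonal to r only up to second order; this
   vector is the coefficient of the resulting quadratic error. *)
Definition second_order : 'rV[R]_d :=
  (slope t / 2) *: n + (f1 t * slope t * c / 2) *: eta
  - (excess t * c ^+ 2 / (2 * dot n n)) *: n.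

Lemma unit_chord z : dot (r + z) (r + z) = 1 -> dot z r = - (dot z z / 2).
Proof. by rewrite !bilin hr (dotC r); lra. Qed.

Lemma dcontraction_chord z : dot (r + z) (r + z) = 1 ->
  dcontraction eta r z = slope t *: tangential eta z +
    (f1 t * slope t * dot z eta) *: eta
    - (excess t * c * dot z eta / dot n n) *: n + dot z z *: second_order.
Proof.
move=> /unit_chord hz; rewrite /dcontraction /dcontraction_tangent.
have hzn : dot (tangential r z) n = - (c * (dot z eta + dot z z / 2 * c)).
  rewrite dot_tangent; first by rewrite {1}/tangential dotBl dotZl hz; ring.
  by rewrite /tangential !bilin hr; ring.
have hze : dot (tangential r z) eta = dot z eta + dot z z / 2 * c.
  by rewrite {1}/tangential dotBl dotZl hz; ring.
have -> : tangential eta (tangential r z) = tangential eta z + (dot z z / 2) *: n.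
  rewrite {1}/tangential hze /tangential hz; apply/rowP => k; rewrite !mxE; ring.
rewrite hzn hze /second_order; move: n => m.
have [N0|N0] := eqVneq (dot m m) 0; last first.
  by apply/rowP => k; rewrite !mxE; field.
by rewrite (dot_eq0 N0) !scaler0; apply/rowP => k; rewrite !mxE; field.
Qed.

End Fixed.
End Vectors.

End Contraction.

(** * Differentiability of the contraction on the sphere *)

Lemma near_enorm {R : realType} {d : nat} (e : R) (r0 : 'rV[R]_d) : 0 < e ->
  \forall r' \near r0, enorm (r' - r0) < e.
Proof.
move=> e0; apply/nbhs_ballP; exists (e / d.+1%:R) => /=; first by rewrite divr_gt0.
move=> r'; rewrite -ball_normE /= distrC => hb.
by apply: le_lt_trans (enorm_le_norm _) _; rewrite mulrC -ltr_pdivlMr.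
Qed.

Lemma near_dot {R : realType} {d : nat} (r v : 'rV[R]_d) (Q : R -> Prop) :
  (\forall s \near dot r v, Q s) -> \forall r' \near r, Q (dot r' v).
Proof.
have hc : dot r' v @[r' --> r] --> dot r v.
  by apply: (cvg_dot (F := nbhs r)); [exact: cvg_id|exact: cvg_cst].
exact: hc.
Qed.

Section ContractionDerivative.
Context {R : realType} (f f1 : R -> R) (mu kap : R).
Hypothesis H : law_bounds f f1 mu kap.
Context {d : nat} (eta r : 'rV[R]_d).
Hypotheses (he : dot eta eta = 1) (hr : dot r r = 1) (rpos : 0 < dot r eta).
Local Notation slp := (slope f f1).
Local Notation exc := (excess f f1).
Local Notation c := (dot r eta).
Local Notation t := (angle eta r).
Local Notation n := (tangential eta r).

Let tI : angles t := angle_angles he hr rpos.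

Section Oblique.
Hypothesis c1 : c < 1.

Let tn0 : t != 0.
Proof.
by apply: contraTneq c1 => t0; rewrite -(cos_angle he hr rpos) t0 cos0 ltxx.
Qed.

Let acos_der : is_derive c 1 (@acos R) (- (sin t)^-1).
Proof.
rewrite sin_acos; last by rewrite (ltW c1) (le_trans _ (ltW rpos)) ?lerN10.
by apply: is_derive1_acos; rewrite c1 (lt_trans _ rpos) ?ltrN10.
Qed.

Let law_der : is_derive (acos c) 1 f (f1 t).
Proof.
have tpos : 0 < t by rewrite lt_neqAle eq_sym tn0; case/andP: tI.
apply: (deriv_within_is_derive (A := angles)); last exact: (lawD H tI).
have : nbhs t `]0, (pi / 2)[%classic.
  by apply: near_in_itvoo; rewrite in_itv /= tpos; case/andP: tI.
by apply: filterS => y; rewrite /= in_itv /= => /andP[y0 yt]; rewrite /angles /= yt ltW.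
Qed.

Lemma cos_law_acos_deriv : is_derive c 1 (fun s => cos (f (acos s))) (f1 t * slp t).
Proof.
have h : is_derive c 1 (cos \o (f \o @acos R)) (- sin (f t) * (f1 t * - (sin t)^-1)).
  exact: (is_derive1_comp (is_derive_cos _) (is_derive1_comp law_der acos_der)).
rewrite (_ : f1 t * slp t = - sin (f t) * (f1 t * - (sin t)^-1)) //.
by rewrite /slope (negbTE tn0); ring.
Qed.

Lemma slope_acos_deriv : is_derive c 1 (fun s => sin (f (acos s)) / sin (acos s))
  (- (exc t * c / dot n n)).
Proof.
have h1 : is_derive c 1 (sin \o (f \o @acos R)) (cos (f t) * (f1 t * - (sin t)^-1)).
  exact: (is_derive1_comp (is_derive_sin _) (is_derive1_comp law_der acos_der)).
have h2 : is_derive c 1 (sin \o @acos R) (cos t * - (sin t)^-1).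
  exact: (is_derive1_comp (is_derive_sin _) acos_der).
have sn0 : sin t != 0 by rewrite gt_eqF // sin_angles_gt0.
have h3 := is_deriveM h1 (is_deriveV sn0 h2).
have -> : (fun s => sin (f (acos s)) / sin (acos s)) =
  (sin \o (f \o @acos R)) * (fun y => ((sin \o @acos R) y)^-1) by apply/funext.
apply: is_derive_eq h3 _; rewrite /GRing.scale /= tangential_sqr // -/(angle eta r).
rewrite /excess /slope (negbTE tn0) (cos_angle he hr rpos).
by field; rewrite sn0 gt_eqF.
Qed.
End Oblique.

(** Where [dot r eta < 1], the coefficients [cos (f t)] and [slope t] are differentiable functions
    of [dot r eta]; at the value [1] the remainder is estimated by hand. *)
Lemma dcontraction_diff (e : R) : 0 < e -> \forall r' \near r, dot r' r' = 1 ->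
  enorm (Defs.contraction f eta r' - Defs.contraction f eta r
    - dcontraction f f1 eta r (r' - r)) <= e * enorm (r' - r).
Proof.
move=> e0.
pose X := second_order f f1 eta r.
pose b1 := exc t * c / dot n n.
(* [b1] and [X] are the coefficients of errors quadratic in [r' - r]; when
   [enorm (r' - r) < e1 / K], each of these errors is at most [e1 * enorm (r' - r)]. *)
pose K := `|b1| + enorm X + 1.
have K0 : 0 < K by rewrite ltr_wpDl // addr_ge0 // enorm_ge0.
pose e1 := e / 4; have e10 : 0 < e1 by rewrite divr_gt0.
have n1 := near_enorm r (divr_gt0 e10 K0).
have n2 : \forall r' \near r, 0 < dot r' eta.
  by apply: (near_dot (Q := fun s => 0 < s)); exact: lt_nbhsr.
pose da r' := cos (f (angle eta r')) - cos (f t).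
pose db r' := slp (angle eta r') - slp t.
suff key : \forall r' \near r, dot r' r' = 1 ->
    `|da r' - f1 t * slp t * dot (r' - r) eta| <= e1 * enorm (r' - r) /\
    enorm (db r' *: tangential eta r' + (b1 * dot (r' - r) eta) *: n) <=
      (2 * e1) * enorm (r' - r).
  apply: (filterS3 _ _ n1 n2 key) => r' + r'pos + hr' => zK /(_ hr') [ka kb].
  have hz : dot (r + (r' - r)) (r + (r' - r)) = 1 by rewrite addrC subrK.
  rewrite (contractionE f f1 he hr' r'pos) (contractionE f f1 he hr rpos).
  rewrite (dcontraction_chord f f1 eta hr hz).
  set z := r' - r in ka kb zK hz *.
  have -> : cos (f (angle eta r')) *: eta + slp (angle eta r') *: tangential eta r' -
    (cos (f t) *: eta + slp t *: n) -
    (slp t *: tangential eta z + (f1 t * slp t * dot z eta) *: eta -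
     (exc t * c * dot z eta / dot n n) *: n + dot z z *: second_order f f1 eta r) =
    (da r' - f1 t * slp t * dot z eta) *: eta +
    (db r' *: tangential eta r' + (b1 * dot z eta) *: n) - dot z z *: X.
    have -> : tangential eta z = tangential eta r' - n.
      by rewrite /z /tangential dotBl; apply/rowP => k; rewrite !mxE; ring.
    rewrite /da /db /b1 /X.
    move: (second_order _ _ _ _) (tangential eta r') n => A B C.
    by apply/rowP => k; rewrite !mxE; ring.
  apply: le_trans (enormB _ _) _; apply: le_trans (lerD (enormD _ _) (lexx _)) _.
  rewrite !enormZ (unit_enorm he) mulr1 (ger0_norm (dot_ge0 z)) -enorm_sqr.
  have h3 : enorm z * enorm X <= e1.
    apply: (@le_trans _ _ (enorm z * K)); last by rewrite -ler_pdivlMr // ltW.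
    by rewrite ler_wpM2l ?enorm_ge0 // /K -addrA addrCA lerDl addr_ge0.
  have h4 : enorm z ^+ 2 * enorm X <= e1 * enorm z.
    by rewrite expr2 -mulrA mulrC ler_wpM2r ?enorm_ge0.
  by move: ka kb h4; rewrite /e1; lra.
have hle z : `|dot z eta| <= enorm z.
  by apply: le_trans (dot_norm_le _ _) _; rewrite (unit_enorm he) mulr1.
have htan z : enorm (tangential eta z) <= enorm z.
  apply: enorm_le; first exact: enorm_ge0.
  rewrite enorm_sqr /tangential !bilin he (dotC eta).
  by have := sqr_ge0 (dot z eta); lra.
have [c1|c1] := ltP c 1.
  have ha := is_derive_within setT (cos_law_acos_deriv c1) e10.
  have hb := is_derive_within setT (slope_acos_deriv c1) e10.
  have hlt : \forall r' \near r, dot r' eta < 1.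
    by apply: (near_dot (Q := fun s => s < 1)); exact: lt_nbhsl.
  have {}ha := near_dot ha; have {}hb := near_dot hb.
  near=> r' => hr'.
  have r'pos : 0 < dot r' eta by near: r'.
  have hsl s : 0 < s < 1 -> slp (acos s) = sin (f (acos s)) / sin (acos s).
    move=> /andP[s0 s1]; rewrite /slope; case: eqVneq => // a0.
    by move: (s1); rewrite (acos_eq0 (introT andP (conj s0 (ltW s1))) a0) ltxx.
  have zK : enorm (r' - r) < e1 / K by near: r'.
  have dz : dot r' eta - c = dot (r' - r) eta by rewrite dotBl.
  split.
    apply: (@le_trans _ _ (e1 * `|dot (r' - r) eta|)); last by rewrite ler_pM2l.
    by rewrite /da -dz; near: r'; apply: filterS ha => r0 /(_ Logic.I).
  (* Replacing [n] by [tangential eta r'] leaves the first-order error of the slope times a bounded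
     vector, plus a cross term quadratic in [r' - r]. *)
  have -> : db r' *: tangential eta r' + (b1 * dot (r' - r) eta) *: n =
     (db r' + b1 * dot (r' - r) eta) *: tangential eta r' -
     (b1 * dot (r' - r) eta) *: tangential eta (r' - r).
    by rewrite /tangential !dotBl; apply/rowP => k; rewrite !mxE; ring.
  apply: le_trans (enormB _ _) _; rewrite !enormZ.
  have t1 : enorm (tangential eta r') <= 1.
    by apply: le_trans (htan _) _; rewrite unit_enorm.
  have h1 : `|db r' + b1 * dot (r' - r) eta| <= e1 * `|dot (r' - r) eta|.
    have : `|sin (f (acos (dot r' eta))) / sin (acos (dot r' eta)) -
       sin (f (acos c)) / sin (acos c) - - b1 * (dot r' eta - c)| <=
       e1 * `|dot r' eta - c| by near: r'; apply: filterS hb => r0 /(_ Logic.I).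
    rewrite /db mulNr opprK dz /angle !hsl ?rpos ?c1 ?r'pos //=.
    by near: r'.
  have h2 : `|db r' + b1 * dot (r' - r) eta| * enorm (tangential eta r') <=
      e1 * enorm (r' - r).
    apply: (@le_trans _ _ (`|db r' + b1 * dot (r' - r) eta| * 1)).
      by rewrite ler_wpM2l.
    by rewrite mulr1 (le_trans h1) // ler_pM2l.
  have h3 : enorm (r' - r) * `|b1| <= e1.
    apply: (@le_trans _ _ (enorm (r' - r) * K)); last by rewrite -ler_pdivlMr // ltW.
    by rewrite ler_wpM2l ?enorm_ge0 // /K -addrA lerDl addr_ge0 ?enorm_ge0.
  have h4 : `|b1 * dot (r' - r) eta| * enorm (tangential eta (r' - r)) <=
      e1 * enorm (r' - r).
    rewrite normrM; apply: ler_pM => //; rewrite ?mulr_ge0 ?enorm_ge0 //.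
    by apply: le_trans h3; rewrite mulrC ler_wpM2r.
  lra.
(* At normal incidence [r = eta] and [n = 0]: products with [eta] vary only to second order, and
   continuity of the slope takes the place of its derivative. *)
have hc1 : c = 1 by apply/eqP; rewrite eq_le c1 unit_dot_le1.
have t0 : t = 0 by rewrite /angle hc1 acos1.
have n0 : n = 0 by apply: dot_eq0; rewrite tangential_sqr // t0 sin0 expr0n.
have hs : \forall s \near within [set s | 0 < s <= 1] (nbhs c),
    `|slp t - slp (acos s)| <= e1.
  have := cvg_comp_acos (c_itv he hr rpos) (slope_cvg H tI).
  by move=> /cvgrPdist_le /(_ e1 e10).
rewrite near_withinE in hs.
have {}hs := near_dot hs.
have n3 := near_enorm r e10.
near=> r' => hr'.
have r'pos : 0 < dot r' eta by near: r'.
have cI' : 0 < dot r' eta <= 1 by rewrite r'pos unit_dot_le1.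
have zK : enorm (r' - r) < e1 by near: r'.
have req : r = eta by apply/eqP; rewrite -subr_eq0 -n0 /tangential hc1 scale1r.
have hz := @unit_chord _ _ r hr (r' - r).
rewrite addrC subrK in hz; have {}hz := hz hr'.
split.
  have s1 : `|slp t| <= 1 by apply: le_trans (slope_le H tI) (ltW (andP (law_mu H)).2).
  have s2 : `|f1 t| <= 1 by apply: le_trans (law_deriv H tI) (ltW (andP (law_mu H)).2).
  have tI' := acos_angles cI'.
  (* The law does not increase angles, so [1 - cos (f t)] is at most [1 - cos t], half the squared
     length of the chord. *)
  have h1 : `|da r'| <= enorm (r' - r) ^+ 2 / 2.
    rewrite /da t0 (law0 H) cos0 distrC ger0_norm ?subr_ge0 ?cos_le1 //.
    rewrite enorm_sqr -(opprK (_ / 2)) -hz req !dotBl he.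
    have : cos (acos (dot r' eta)) <= cos (f (angle eta r')).
      have /andP[a0 a1] := lawI H tI'; apply: cos_angles_le => //.
        exact: (law_le H).
      by case/andP: tI' => _ ?; have := pi_gt0 R; lra.
    by rewrite cos_acos //; lra.
  have h2 : `|dot (r' - r) eta| <= enorm (r' - r) ^+ 2 / 2.
    by rewrite -req hz normrN enorm_sqr ger0_norm // divr_ge0 ?dot_ge0.
  apply: le_trans (ler_normB _ _) _; rewrite !normrM.
  have h3 : `|f1 t| * `|slp t| * `|dot (r' - r) eta| <= `|dot (r' - r) eta|.
    by rewrite -[leRHS]mul1r ler_wpM2r // mulr_ile1.
  have h4 : enorm (r' - r) ^+ 2 <= e1 * enorm (r' - r).
    by rewrite expr2 ler_wpM2r ?enorm_ge0 // ltW.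
  lra.
rewrite n0 scaler0 addr0 enormZ.
have -> : tangential eta r' = tangential eta (r' - r).
  rewrite /tangential dotBl hc1; apply/rowP => k.
  by rewrite !mxE req; ring.
apply: ler_pM; rewrite ?enorm_ge0 //.
apply: (@le_trans _ _ e1); last by rewrite ler_peMl ?ler1n // ltW.
by rewrite /db distrC; move: cI'; near: r'.
Unshelve. all: by end_near. Qed.

End ContractionDerivative.

(** * Continuous dependence of the derivative on the velocity *)

Section ContractionContinuity.
Context {R : realType} (f f1 : R -> R) (mu kap : R).
Hypothesis H : law_bounds f f1 mu kap.
Context {d : nat} (eta r : 'rV[R]_d).
Hypotheses (he : dot eta eta = 1) (hr : dot r r = 1) (rpos : 0 < dot r eta).
Context {T : Type} {F : set_system T} {FF : Filter F} (rr : T -> 'rV[R]_d).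
Hypothesis rr_cvg : rr t @[t --> F] --> r.
Hypothesis rr_unit : \forall t \near F, dot (rr t) (rr t) = 1.

Lemma cvg_tangential (a b : T -> 'rV[R]_d) u v :
  a t @[t --> F] --> u -> b t @[t --> F] --> v ->
  tangential (a t) (b t) @[t --> F] --> tangential u v.
Proof. by move=> ha hb; apply: cvgB => //; apply: cvgZ => //; exact: cvg_dot. Qed.

Lemma cvg_comp_angle (g : R -> R) (L : R) :
  g s @[s --> within angles (nbhs (angle eta r))] --> L ->
  g (angle eta (rr t)) @[t --> F] --> L.
Proof.
move=> hg; have h := cvg_comp_acos (c_itv he hr rpos) hg.
have hc : dot (rr t) eta @[t --> F] --> dot r eta.
  by apply: cvg_dot => //; exact: cvg_cst.
move=> A hA.
have hB : \forall s \near dot r eta, 0 < s <= 1 -> A (g (acos s)) by exact: (h A hA).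
suff : \forall t \near F, A (g (angle eta (rr t))) by [].
apply: (filterS3 FF _ (hc _ hB) rr_unit (cvgr_gt _ hc _ rpos)) => t hA' ut pt.
by apply: hA'; rewrite pt unit_dot_le1.
Qed.

(** Only the last term is delicate: at normal incidence its vector part is bounded but need not
    converge, and it is the factor [excess] that tends to [0]. *)
Lemma dcontraction_cvg y :
  dcontraction f f1 eta (rr t) y @[t --> F] --> dcontraction f f1 eta r y.
Proof.
have tI := angle_angles he hr rpos.
have hz : tangential (rr t) y @[t --> F] --> tangential r y.
  by apply: cvg_tangential => //; exact: cvg_cst.
have hn : tangential eta (rr t) @[t --> F] --> tangential eta r.
  by apply: cvg_tangential => //; exact: cvg_cst.
have hs := cvg_comp_angle (slope_cvg H tI).
have hx := cvg_comp_angle (excess_cvg H tI).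
have hf := cvg_comp_angle (lawC H tI).
have cz : cst eta t @[t --> F] --> eta by exact: cvg_cst.
rewrite /dcontraction /dcontraction_tangent; apply: cvgD; first apply: cvgD.
- by apply: cvgZ => //; exact: cvg_tangential.
- by apply: cvgZ => //; apply: cvgM; [exact: cvgM|exact: cvg_dot].
have [N0|N0] := eqVneq (dot (tangential eta r) (tangential eta r)) 0; last first.
  apply: cvgZ => //; apply: cvgM; first by apply: cvgM => //; exact: cvg_dot.
  by apply: cvgV => //; exact: cvg_dot.
rewrite [X in _ --> _ *: X](dot_eq0 N0) scaler0; apply/cvgr0Pnorm_le => e e0.
have x0 : excess f f1 (angle eta r) = 0.
  have t0 : sin (angle eta r) = 0.
    by apply/eqP; rewrite -sqrf_eq0 -(tangential_sqr he hr rpos) N0.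
  have -> : angle eta r = 0.
    by apply/eqP/negP => /negP /(sin_angles_gt0 tI); rewrite t0 ltxx.
  exact: excess0 H.
rewrite x0 in hx.
have y1 : 0 < enorm y + 1 by rewrite ltr_wpDl ?enorm_ge0.
move/cvgr0Pnorm_le: hx => /(_ _ (divr_gt0 e0 y1)) hx.
apply: (filterS2 FF _ hx rr_unit) => t ht ut.
apply: le_trans (norm_le_enorm _) _; rewrite enormZ.
move: (tangential eta (rr t)) => m.
have [M0|M0] := eqVneq m 0; first by rewrite M0 enorm0 mulr0 ltW.
have nm := enorm_gt0 M0.
rewrite normrM normfV normrM -enorm_sqr (ger0_norm (sqr_ge0 _)).
have hzy : enorm (tangential (rr t) y) <= enorm y.
  apply: enorm_le; first exact: enorm_ge0.
  rewrite enorm_sqr /tangential !bilin ut (dotC (rr t)).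
  by have := sqr_ge0 (dot y (rr t)); lra.
have h1 := dot_norm_le (tangential (rr t) y) m.
have h2 : `|dot (tangential (rr t) y) m| / enorm m ^+ 2 * enorm m <= enorm y.
  rewrite expr2 invfM mulrA divfK ?gt_eqF // ler_pdivrMr //.
  by apply: le_trans h1 _; rewrite ler_wpM2r ?enorm_ge0.
rewrite -2!mulrA; apply: (@le_trans _ _ (e / (enorm y + 1) * enorm y)).
  by apply: ler_pM => //; rewrite ?mulr_ge0 ?invr_ge0 ?sqr_ge0 ?enorm_ge0 // mulrA.
by rewrite mulrAC ler_pdivrMr // ler_pM2l // lerDl.
Unshelve. all: by end_near. Qed.

End ContractionContinuity.

(** * Reflections and the form of a bounce *)

Section Reflection.
Context {R : realType} {d : nat} (eta : 'rV[R]_d).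
Hypothesis he : dot eta eta = 1.
Implicit Types u v : 'rV[R]_d.

Lemma reflect_dot u v : dot (Defs.reflect eta u) (Defs.reflect eta v) = dot u v.
Proof. by rewrite /Defs.reflect !bilin he (dotC eta); ring. Qed.

Lemma reflect_normal v : dot (Defs.reflect eta v) eta = - dot v eta.
Proof. by rewrite /Defs.reflect !bilin he; ring. Qed.

Lemma reflect_linear : linear (Defs.reflect eta).
Proof.
by move=> a u v; rewrite /Defs.reflect !bilin; apply/rowP => k; rewrite !mxE; ring.
Qed.

Lemma reflectB u v : Defs.reflect eta (u - v) = Defs.reflect eta u - Defs.reflect eta v.
Proof. by rewrite /Defs.reflect !bilin; apply/rowP => k; rewrite !mxE; ring. Qed.

Lemma reflect_enorm v : enorm (Defs.reflect eta v) = enorm v.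
Proof. by rewrite /enorm reflect_dot. Qed.

Lemma cvg_reflect {T : Type} {F : set_system T} {FF : Filter F} (a : T -> 'rV[R]_d) v :
  a t @[t --> F] --> v -> Defs.reflect eta (a t) @[t --> F] --> Defs.reflect eta v.
Proof.
move=> ha; apply: cvgB => //; apply: cvgZ; last exact: cvg_cst.
by apply: cvgM; [exact: cvg_cst|apply: cvg_dot => //; exact: cvg_cst].
Qed.

End Reflection.

Lemma contraction_bounce {R : realType} (f f1 : R -> R) (mu kap : R) d
    (eta v : 'rV[R]_d) : law_bounds f f1 mu kap ->
  dot eta eta = 1 -> dot v v = 1 -> dot v eta < 0 ->
  exists b g, [/\ 0 <= b <= mu, kap <= g &
    Defs.contraction f eta (Defs.reflect eta v) = b *: v + g *: eta].
Proof.
move=> H he hv neg; set r := Defs.reflect eta v.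
have hr : dot r r = 1 by rewrite reflect_dot.
have rpos : 0 < dot r eta by rewrite reflect_normal // oppr_gt0.
have tI := angle_angles he hr rpos.
(* At normal incidence the tangential part is zero and every factor fits; [0] satisfies the required
   bounds. *)
pose t := angle eta r; pose b := if t == 0 then 0 else sin (f t) / sin t.
have hb : 0 <= b <= mu.
  rewrite /b; case: eqVneq => [_|t0]; first by rewrite lexx; case/andP: (law_mu H).
  have st := sin_angles_gt0 tI t0.
  rewrite divr_ge0 ?(ltW st) ?ler_pdivrMr ?(law_sin H) //.
  by apply: sin_angles_ge0; exact: (lawI H).
(* [b *: v] brings the normal component [- b * dot r eta], which the second summand cancels. *)
exists b, (cos (f t) + b * dot r eta); split=> //.
  apply: le_trans (law_cos H tI) _; rewrite lerDl mulr_ge0 ?(ltW rpos) //.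
  by case/andP: hb.
rewrite (contractionE f f1 he hr rpos) -/t.
have -> : slope f f1 t *: tangential eta r = b *: tangential eta r.
  rewrite /b /slope; case: eqVneq => // t0.
  by rewrite (dot_eq0 (u := tangential eta r)) ?scaler0 // tangential_sqr // -/t t0 sin0 expr0n.
by rewrite reflect_normal // /tangential reflect_normal // /r /Defs.reflect;
  apply/rowP => k; rewrite !mxE; ring.
Qed.

(** * The billiard map and its derivative *)

Section PairTopology.
Context {R : realType} {V W : normedModType R}.

Lemma norm_pair_le (x : V * W) (e : R) : `|x.1| <= e -> `|x.2| <= e -> `|x| <= e.
Proof. by move=> h1 h2; rewrite prod_normE ge_max h1. Qed.

Lemma norm_fst_le (x : V * W) : `|x.1| <= `|x|.
Proof. by rewrite prod_normE le_max lexx. Qed.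

Lemma norm_snd_le (x : V * W) : `|x.2| <= `|x|.
Proof. by rewrite prod_normE le_max lexx orbT. Qed.

Lemma cvg_fst_nbhs (x : V * W) : y.1 @[y --> x] --> x.1.
Proof. by case: x => a b; exact: cvg_fst. Qed.

Lemma cvg_snd_nbhs (x : V * W) : y.2 @[y --> x] --> x.2.
Proof. by case: x => a b; exact: cvg_snd. Qed.

End PairTopology.

Section Billiard.
Context {R : realType} {d : nat} (P : polytope R d).
Let V := ('rV[R]_d * 'rV[R]_d)%type.
Variables (f f1 : R -> R) (mu kap : R).
Hypothesis H : law_bounds f f1 mu kap.
Hypotheses (gp : general_position P) (d2 : (2 <= d)%N).
Local Notation N := (nfaces P).
Local Notation eta := (@normal _ _ P).
Local Notation off := (@offset _ _ P).
Local Notation Phi := (billiard_map P f).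
Implicit Types (x y : V) (i j k : 'I_N).

Let relintP := relint_faceP gp d2.

Definition hits i j tau x :=
  [/\ relint_face i x.1, dot x.2 x.2 = 1, 0 < dot x.2 (eta i), 0 < tau &
      relint_face j (x.1 + tau *: x.2)].

Lemma hits_neq i j tau x : hits i j tau x -> j != i.
Proof.
move=> [/relintP[hi _] _ vi t0 /relintP[hj _]]; apply/eqP => ji.
move: hj; rewrite ji dotDl dotZl hi => /eqP.
by rewrite -subr_eq0 addrC addKr mulf_eq0 !gt_eqF.
Qed.

Lemma hits_incoming i j tau x : hits i j tau x -> dot x.2 (eta j) < 0.
Proof.
move=> h; have ji := hits_neq h; case: h => /relintP[_ hk] _ _ t0 /relintP[hj _].
have := hk j ji; rewrite -hj dotDl dotZl gtrDl pmulr_rlt0 //.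
Qed.

Lemma hits_tau i j tau x : hits i j tau x ->
  tau = (off j - dot x.1 (eta j)) / dot x.2 (eta j).
Proof.
move=> h; have neg := hits_incoming h; case: h => _ _ _ _ /relintP[<- _].
by rewrite dotDl dotZl; field; rewrite lt_eqF.
Qed.

Lemma hits_collision i j tau x : hits i j tau x -> collision P f x
  (x.1 + tau *: x.2, Defs.contraction f (eta j) (Defs.reflect (eta j) x.2)).
Proof.
move=> h; have ji := hits_neq h; have neg := hits_incoming h.
case: h => /relintP[hi hk] hv vi t0 rj; exists j, tau; split=> // k t /andP[s0 st].
have tle : t / tau < 1 by rewrite ltr_pdivrMr ?mul1r.
move=> /relintP[hkk _]; move: hkk; rewrite dotDl dotZl => e.
have [ki|ki] := eqVneq k i.
  by move: e; rewrite ki hi => /eqP; rewrite -subr_eq0 addrC addKr mulf_eq0 !gt_eqF.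
have := relint_face_body rj k; rewrite dotDl dotZl.
have := hk k ki; rewrite -e; nra.
Qed.

Lemma collision_unique x y z : collision P f x y -> collision P f x z -> z = y.
Proof.
move=> [j [t [t0 rj nj ->]]] [k [s [s0 rk nk ->]]].
have [ts|ts|ts] := ltgtP t s.
- by case: (nk j t); rewrite ?t0.
- by case: (nj k s); rewrite ?s0.
- by rewrite -ts in rk *; rewrite (relint_face_inj gp d2 rj rk).
Qed.

Lemma hits_map i j tau x : hits i j tau x ->
  Phi x = (x.1 + tau *: x.2, Defs.contraction f (eta j) (Defs.reflect (eta j) x.2)).
Proof.
move=> h; apply: xget_unique; first exact: hits_collision h.
by move=> y; apply: collision_unique; exact: hits_collision h.
Qed.

(** The exit time is the least ratio over the faces being approached, which exist because P contains
    no ray; regularity keeps the exit point off the skeleton. *)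
Lemma regular_hits x : regular P x -> exists i j tau, hits i j tau x.
Proof.
move=> [[i [ri hv vi]] ns].
have v0 : x.2 != 0 by apply: contra_eq_neq hv => ->; rewrite enorm0 eq_sym oner_eq0.
have [k0 hk0] := recession P v0.
have hp := relint_face_body ri.
pose Q k := dot x.2 (eta k) < 0.
pose t k := (dot x.1 (eta k) - off k) / (- dot x.2 (eta k)).
case: (arg_minP t (hk0 : Q k0)) => j Qj tj.
have ji : j != i by apply: contraTneq Qj => ->; rewrite /Q -leNgt ltW.
have tpos : 0 < t j.
  by rewrite divr_gt0 ?oppr_gt0 // subr_gt0; apply: (proj2 ((relintP _ _).1 ri)).
have hr : body P (x.1 + t j *: x.2).
  move=> l; rewrite dotDl dotZl.
  have [hl|hl] := ltP (dot x.2 (eta l)) 0; last first.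
    by rewrite ler_wpDr ?hp // mulr_ge0 // ltW.
  have := tj l hl; rewrite {2}/t ler_pdivlMr ?oppr_gt0 //; lra.
exists i, j, (t j); split=> //; first exact: enorm_unit.
apply: not_skeleton => //; last by apply: ns; rewrite ltW.
by rewrite dotDl dotZl /t; field; rewrite lt_eqF.
Qed.

Definition flight j x : R := (off j - dot x.1 (eta j)) / dot x.2 (eta j).

Lemma cvg_pdot x (v : 'rV[R]_d) :
  dot y.1 v @[y --> x] --> dot x.1 v /\ dot y.2 v @[y --> x] --> dot x.2 v.
Proof.
by split; apply: (cvg_dot (F := nbhs x)); try exact: cvg_cst;
  [exact: cvg_fst_nbhs|exact: cvg_snd_nbhs].
Qed.

Lemma flight_cvg i j tau x : hits i j tau x -> flight j y @[y --> x] --> tau.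
Proof.
move=> h; rewrite (hits_tau h); apply: cvgM.
  by apply: cvgB; [exact: cvg_cst|exact: (cvg_pdot _ _).1].
by apply: cvgV; [rewrite lt_eqF // (hits_incoming h)|exact: (cvg_pdot _ _).2].
Qed.

(** All the other constraints are strict at both ends of the segment and stay strict nearby, so the
    pair of faces is locally constant. *)
Lemma hits_near i j tau x : hits i j tau x ->
  \forall y \near x, phase P y -> hits i j (flight j y) y.
Proof.
move=> h; have neg := hits_incoming h; have ji := hits_neq h.
have ht := flight_cvg h; case: h => /relintP[hi hk] hv vi t0 /relintP[hj hl].
have n1 : \forall y \near x, forall k, k != i -> off k < dot y.1 (eta k).
  apply: (@filter_forall _ _ _ (nbhs x)) => k; have [->|ki] := eqVneq k i.
    by apply: nearW.
  apply: filterS (cvgr_gt _ (cvg_pdot x (eta k)).1 _ (hk k ki)) => y hy _.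
  exact: hy.
have n2 : \forall y \near x, dot y.2 (eta j) < 0.
  exact: (cvgr_lt _ (cvg_pdot x (eta j)).2).
have n3 : \forall y \near x, forall k, k != j ->
    off k < dot (y.1 + flight j y *: y.2) (eta k).
  apply: (@filter_forall _ _ _ (nbhs x)) => k; have [->|kj] := eqVneq k j.
    by apply: nearW.
  have hc : dot (y.1 + flight j y *: y.2) (eta k) @[y --> x] -->
      dot (x.1 + tau *: x.2) (eta k).
    apply: (cvg_dot (F := nbhs x)); last exact: cvg_cst.
    apply: cvgD; first exact: cvg_fst_nbhs.
    by apply: cvgZ => //; exact: cvg_snd_nbhs.
  apply: filterS (cvgr_gt _ hc _ (hl k kj)) => y hy _; exact: hy.
apply: (filterS3 _ _ n1 n2 n3) => y h1 h2 h3 [i' [ri' hv' vi']].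
have ii : i' = i.
  apply/eqP/negP => /negP ne; have := h1 _ ne.
  by rewrite ((relintP _ _).1 ri').1 ltxx.
rewrite ii in ri' vi'; split=> //; first exact: enorm_unit.
  by rewrite /flight ltr_ndivlMr // mul0r subr_lt0; exact: h1.
apply/relintP; split=> //.
by rewrite dotDl dotZl /flight; field; rewrite lt_eqF.
Qed.

Section Derivative.
Variables (n v : 'rV[R]_d) (tau : R).

(** The projection along [v] onto the hyperplane orthogonal to [n]: displacing a trajectory changes
    its arrival time, which slides the point of impact along [v]. *)
Definition shear (q : 'rV[R]_d) : 'rV[R]_d := q - (dot q n / dot v n) *: v.

Definition dcollision (w : V) : V :=
  (shear (w.1 + tau *: w.2),
   dcontraction f f1 n (Defs.reflect n v) (Defs.reflect n w.2)).

Lemma dcontraction_linear (r : 'rV[R]_d) : linear (dcontraction f f1 n r).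
Proof.
move=> a y z; rewrite /dcontraction /dcontraction_tangent.
have h (u : 'rV[R]_d) : tangential u (a *: y + z) = a *: tangential u y + tangential u z.
  by rewrite /tangential !bilin; apply/rowP => k; rewrite !mxE; ring.
have h' (u w1 w2 : 'rV[R]_d) : tangential u (a *: w1 + w2) = a *: tangential u w1 + tangential u w2.
  by rewrite /tangential !bilin; apply/rowP => k; rewrite !mxE; ring.
rewrite h h'; move: (tangential r y) (tangential r z) => A B.
move: (tangential n A) (tangential n B) (tangential n r) => C D E.
by rewrite !bilin; apply/rowP => k; rewrite !mxE; ring.
Qed.

Lemma dcollision_linear : linear dcollision.
Proof.
move=> a [y1 y2] [z1 z2]; rewrite /dcollision /=; congr (_, _).
  by rewrite /shear !bilin; apply/rowP => k; rewrite !mxE; ring.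
by rewrite reflect_linear dcontraction_linear.
Qed.

HB.instance Definition _ :=
  GRing.isLinear.Build R V V _ dcollision dcollision_linear.

Definition dcollision_lfun : 'End(V) := linfun dcollision.

Lemma dcollision_lfunE w : dcollision_lfun w = dcollision w.
Proof. by rewrite lfunE. Qed.

End Derivative.

End Billiard.

(** * Chain rule for derivatives within a set *)

Section Differentiation.
Context {R : realType} {d : nat}.
Let V := ('rV[R]_d * 'rV[R]_d)%type.
Implicit Types (x y w : V) (A : set V) (F G : V -> V) (L M : 'End(V)).

Lemma lfun_bounded L : exists2 C : R, 0 < C & forall w, `|L w| <= C * `|w|.
Proof.
pose e1 k : V := (delta_mx ord0 k, 0); pose e2 k : V := (0, delta_mx ord0 k).
exists (1 + \sum_(k < d) (`|L (e1 k)| + `|L (e2 k)|)).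
  by rewrite ltr_pwDl // sumr_ge0.
move=> w; have {1}-> : w = \sum_(k < d) (w.1 ord0 k *: e1 k + w.2 ord0 k *: e2 k).
  rewrite big_split /=; case: w => a b /=.
  have h1 (I : finType) (u : I -> 'rV[R]_d) : \sum_i ((u i, 0) : V) = (\sum_i u i, 0).
    by apply: (big_ind2 (fun (p : V) q => p = (q, 0))) => // p q p' q' -> ->;
      rewrite /GRing.add /= /add_pair /= addr0.
  have h2 (I : finType) (u : I -> 'rV[R]_d) : \sum_i ((0, u i) : V) = (0, \sum_i u i).
    by apply: (big_ind2 (fun (p : V) q => p = (0, q))) => // p q p' q' -> ->;
      rewrite /GRing.add /= /add_pair /= addr0.
  have -> : \sum_(k < d) a ord0 k *: e1 k = (a, 0).
    rewrite [X in _ = (X, _)]row_sum_delta -h1; apply: eq_bigr => k _.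
    by rewrite /GRing.scale /= /scale_pair /= scaler0.
  have -> : \sum_(k < d) b ord0 k *: e2 k = (0, b).
    rewrite [X in _ = (_, X)]row_sum_delta -h2; apply: eq_bigr => k _.
    by rewrite /GRing.scale /= /scale_pair /= scaler0.
  by rewrite /GRing.add /= /add_pair /= addr0 add0r.
rewrite linear_sum; apply: le_trans (ler_norm_sum _ _ _) _.
rewrite mulrDl mul1r mulr_suml; apply: le_trans (_ : \sum_(k < d) (`|L (e1 k)| + `|L (e2 k)|) * `|w| <= _).
  apply: ler_sum => k _; rewrite linearD !linearZ /=; apply: le_trans (ler_normD _ _) _.
  rewrite !normrZ mulrDl ![_ * `|w|]mulrC; apply: lerD; rewrite ler_wpM2r //.
    by apply: le_trans (norm_fst_le w); exact: ler_norm_entry.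
  by apply: le_trans (norm_snd_le w); exact: ler_norm_entry.
by rewrite lerDr.
Qed.

Lemma has_diff_on_cvg A F x L : has_diff_on A F x L ->
  F y @[y --> within A (nbhs x)] --> F x.
Proof.
move=> h; have [C C0 hC] := lfun_bounded L.
apply/cvgrPdist_lt => e e0; rewrite near_withinE.
have hb : \forall y \near x, `|x - y| < e / (C + 1).
  apply/nbhs_ballP; exists (e / (C + 1)) => /=; first by rewrite divr_gt0 // addr_gt0.
  by move=> y; rewrite -ball_normE.
have h1 := h 1 ltr01; rewrite near_withinE in h1.
apply: (filterS2 _ _ h1 hb) => y + hy Ay => /(_ Ay) hd.
rewrite distrC; rewrite distrC ltr_pdivlMr ?addr_gt0 // in hy.
have -> : F y - F x = F y - F x - L (y - x) + L (y - x) by rewrite subrK.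
apply: le_lt_trans (ler_normD _ _) _; apply: le_lt_trans (lerD hd (hC _)) _.
by move: hy; lra.
Qed.

Lemma has_diff_on_id A x : has_diff_on A id x (\1%VF : 'End(V)).
Proof.
move=> e e0; apply: nearW => y.
by rewrite id_lfunE subrr normr0 mulr_ge0 // ltW.
Qed.

Lemma has_diff_on_comp A F G x L M : has_diff_on A F x L ->
  (\forall y \near x, A y -> A (F y)) -> has_diff_on A G (F x) M ->
  has_diff_on A (G \o F) x (M \o L)%VF.
Proof.
move=> hF hA hG e e0.
have [C C0 hC] := lfun_bounded L; have [D D0 hD] := lfun_bounded M.
pose e1 := e / (2 * (C + 1)); pose e2 := Num.min 1 (e / (2 * D)).
have e10 : 0 < e1 by rewrite divr_gt0 // mulr_gt0 // addr_gt0.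
have e20 : 0 < e2 by rewrite lt_min ltr01 divr_gt0 // mulr_gt0.
have e21 : e2 <= 1 by rewrite ge_min lexx.
have e2D : e2 * (2 * D) <= e by rewrite -ler_pdivlMr ?mulr_gt0 // ge_min lexx orbT.
have n1 := hF e2 e20; rewrite near_withinE in n1.
have n2 : \forall y \near x, A y -> A (F y) ->
    `|G (F y) - G (F x) - M (F y - F x)| <= e1 * `|F y - F x|.
  have := hG e1 e10; rewrite near_withinE => n2; have := has_diff_on_cvg hF n2.
  by rewrite /nbhs /= /within /=.
rewrite near_withinE; apply: (filterS3 _ _ n1 hA n2) => y + + + Ay.
move=> /(_ Ay) a1 /(_ Ay) AF /(_ Ay AF) a2; rewrite /= comp_lfunE.
have -> : G (F y) - G (F x) - M (L (y - x)) =
    (G (F y) - G (F x) - M (F y - F x)) + M (F y - F x - L (y - x)).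
  by rewrite [M (_ - L _)]linearB /= addrA subrK.
apply: le_trans (ler_normD _ _) _; apply: le_trans (lerD a2 (hD _)) _.
have a3 : `|F y - F x| <= (C + 1) * `|y - x|.
  have -> : F y - F x = F y - F x - L (y - x) + L (y - x) by rewrite subrK.
  apply: le_trans (ler_normD _ _) _; apply: le_trans (lerD a1 (hC _)) _.
  by have := normr_ge0 (y - x); nra.
have a4 : e1 * `|F y - F x| <= e / 2 * `|y - x|.
  apply: (@le_trans _ _ (e1 * ((C + 1) * `|y - x|))); first by rewrite ler_pM2l.
  rewrite le_eqVlt; apply/orP; left; apply/eqP; rewrite /e1; field.
  by rewrite gt_eqF // addr_gt0.
have a5 : D * `|F y - F x - L (y - x)| <= D * (e2 * `|y - x|) by rewrite ler_pM2l.
by have := normr_ge0 (y - x); nra.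
Qed.

End Differentiation.

Section Billiard.
Context {R : realType} {d : nat} (P : polytope R d).
Let V := ('rV[R]_d * 'rV[R]_d)%type.
Variables (f f1 : R -> R) (mu kap : R).
Hypothesis H : law_bounds f f1 mu kap.
Hypotheses (gp : general_position P) (d2 : (2 <= d)%N).
Local Notation N := (nfaces P).
Local Notation eta := (@normal _ _ P).
Local Notation off := (@offset _ _ P).
Local Notation Phi := (billiard_map P f).
Implicit Types (x y : V) (i j k : 'I_N).

Lemma hits_reflected i j tau x : hits i j tau x ->
  [/\ dot (Defs.reflect (eta j) x.2) (Defs.reflect (eta j) x.2) = 1 &
      0 < dot (Defs.reflect (eta j) x.2) (eta j)].
Proof.
move=> h; have neg := hits_incoming gp d2 h; case: h => _ hv _ _ _.
by rewrite reflect_dot ?normal_unit // reflect_normal ?normal_unit // oppr_gt0.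
Qed.

Lemma hits_phase i j tau x : hits i j tau x -> phase P (Phi x).
Proof.
move=> h; have [hr rpos] := hits_reflected h.
rewrite (hits_map f gp d2 h); exists j; split=> /=.
- by case: h.
- exact/unit_enorm/(contraction_unit H (normal_unit j) hr rpos).
- exact: lt_le_trans (law_kap H) (contraction_normal_ge H (normal_unit j) hr rpos).
Qed.

Lemma hits_diff i j tau x : hits i j tau x ->
  has_diff_on (phase P) Phi x (dcollision f f1 (eta j) x.2 tau).
Proof.
move=> h e e0; have [hr rpos] := hits_reflected h.
have neg := hits_incoming gp d2 h; have hx := hits_map f gp d2 h.
have he := normal_unit j.
have D0 : 0 < d.+1%:R :> R by [].
have t0 : 0 < tau by case: h.
(* The error in the position is exactly [dot del (eta j) *: (g x - g y)] with [del] linear in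
   [y - x], so continuity of [g] suffices. *)
pose g y := (dot y.2 (eta j))^-1 *: y.2.
have gc : g y @[y --> x] --> g x.
  apply: cvgZ; last exact: cvg_snd_nbhs.
  by apply: cvgV; [rewrite lt_eqF|exact: (cvg_pdot _ _).2].
have e20 : 0 < e / (d.+1%:R * (1 + tau)) by rewrite divr_gt0 // mulr_gt0 // addr_gt0.
have n1 : \forall y \near x, enorm (g y - g x) < e / (d.+1%:R * (1 + tau)).
  exact: (gc _ (near_enorm (g x) e20)).
have e10 : 0 < e / d.+1%:R by rewrite divr_gt0.
have n2 : \forall y \near x, dot (Defs.reflect (eta j) y.2) (Defs.reflect (eta j) y.2) = 1 ->
    enorm (Defs.contraction f (eta j) (Defs.reflect (eta j) y.2)
      - Defs.contraction f (eta j) (Defs.reflect (eta j) x.2)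
      - dcontraction f f1 (eta j) (Defs.reflect (eta j) x.2)
          (Defs.reflect (eta j) y.2 - Defs.reflect (eta j) x.2))
     <= e / d.+1%:R * enorm (Defs.reflect (eta j) y.2 - Defs.reflect (eta j) x.2).
  have rc : Defs.reflect (eta j) y.2 @[y --> x] --> Defs.reflect (eta j) x.2.
    by apply: (cvg_reflect (F := nbhs x)); exact: cvg_snd_nbhs.
  exact: (rc _ (dcontraction_diff H he hr rpos e10)).
have n3 := hits_near gp d2 h.
rewrite near_withinE; apply: (filterS3 _ _ n1 n2 n3) => y gy + + Py.
move=> + /(_ Py) hy; have neg' := hits_incoming gp d2 hy.
rewrite (hits_map f gp d2 hy) hx; case: (hy) => _ uy _ _ /(relint_faceP gp d2)[qy _].
rewrite reflect_dot // uy => /(_ erefl) hc.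
apply: norm_pair_le => /=.
  case: h => _ _ _ _ /(relint_faceP gp d2)[qx _].
  set del := (y - x).1 + tau *: (y - x).2.
  have -> : y.1 + flight j y *: y.2 - (x.1 + tau *: x.2) - shear (eta j) x.2 del =
      dot del (eta j) *: (g x - g y).
    have hd : dot del (eta j) = (tau - flight j y) * dot y.2 (eta j).
      move: qx qy; rewrite /del /= !bilin => qx qy; lra.
    rewrite /shear hd /g /del /=; apply/rowP => k; rewrite !mxE; field.
    by rewrite !lt_eqF.
  apply: le_trans (norm_le_enorm _) _; rewrite enormZ -enormN opprB.
  have hdel : `|dot del (eta j)| <= d.+1%:R * (1 + tau) * `|y - x|.
    apply: le_trans (dot_norm_le _ _) _; rewrite normal_enorm mulr1.
    apply: le_trans (enorm_le_norm _) _; rewrite -mulrA ler_pM2l //.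
    apply: le_trans (ler_normD _ _) _; rewrite normrZ gtr0_norm // mulrDl mul1r.
    by apply: lerD; [exact: norm_fst_le|rewrite ler_pM2l // norm_snd_le].
  apply: le_trans (ler_pM (normr_ge0 _) (enorm_ge0 _) hdel (ltW gy)) _.
  rewrite le_eqVlt; apply/orP; left; apply/eqP; field.
  by rewrite !gt_eqF // addr_gt0.
have -> : Defs.reflect (eta j) (y.2 - x.2) =
   Defs.reflect (eta j) y.2 - Defs.reflect (eta j) x.2 by rewrite reflectB.
apply: le_trans (norm_le_enorm _) _; apply: le_trans hc _.
rewrite -reflectB reflect_enorm // -mulrA ler_pM2l //.
rewrite ler_pdivrMl //; apply: le_trans (enorm_le_norm _) _.
by rewrite ler_pM2l //; exact: (norm_snd_le (y - x)).
Qed.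

Definition nu x : 'rV[R]_d :=
  xget 0 [set n | exists2 i, relint_face i x.1 & n = eta i].

Lemma nuE i x : relint_face i x.1 -> nu x = eta i.
Proof.
move=> ri; apply: xget_unique; first by exists i.
by move=> _ [k rk ->]; rewrite (relint_face_inj gp d2 rk ri).
Qed.

(** For a velocity of unit length this is the flight time, in a form that inherits its continuity
    from [Phi]. *)
Definition ftime x : R := dot ((Phi x).1 - x.1) x.2.

Lemma hits_data i j tau x : hits i j tau x ->
  [/\ nu x = eta i, nu (Phi x) = eta j & ftime x = tau].
Proof.
move=> h; have hx := hits_map f gp d2 h; case: h => ri ux _ _ rj; split.
- exact: nuE.
- by apply: nuE; rewrite hx; exact: rj.
- by rewrite /ftime hx /= addrAC subrr add0r dotZl ux mulr1.
Qed.

Definition DPhi x : 'End(V) := dcollision_lfun f f1 (nu (Phi x)) x.2 (ftime x).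

Fixpoint DPhin n x : 'End(V) :=
  if n is n'.+1 then (DPhi (iter n' Phi x) \o DPhin n' x)%VF else \1%VF.

Lemma DPhi_diff x : regular P x -> has_diff_on (phase P) Phi x (DPhi x).
Proof.
move=> /(regular_hits gp d2) [i [j [tau h]]]; have [_ nj tx] := hits_data h.
move=> e e0; apply: filterS (hits_diff h e0) => y.
by rewrite dcollision_lfunE nj tx.
Qed.

Lemma regular_near_phase x : regular P x ->
  \forall y \near x, phase P y -> phase P (Phi y).
Proof.
move=> /(regular_hits gp d2) [i [j [tau h]]].
by apply: filterS (hits_near gp d2 h) => y hy /hy; exact: hits_phase.
Qed.

(** The second part is the side condition of the chain rule, which is why both are proved in one
    induction. *)
Lemma DPhin_diff n x : forward_regular P f x ->
  has_diff_on (phase P) (iter n Phi) x (DPhin n x) /\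
  \forall y \near x, phase P y -> phase P (iter n Phi y).
Proof.
move=> rx; elim: n => [|n [IH1 IH2]].
  by split; [exact: (has_diff_on_id _ x)|apply: (@nearW _ (nbhs x)) => y].
split; first exact: (has_diff_on_comp IH1 IH2 (DPhi_diff (rx n))).
have h : \forall y \near x, phase P y -> phase P (iter n Phi y) -> phase P (Phi (iter n Phi y)).
  have hn : \forall z \near iter n Phi x, phase P z -> phase P (Phi z).
    exact: regular_near_phase.
  have := has_diff_on_cvg IH1 hn; by rewrite /nbhs /= /within /=.
by apply: (filterS2 _ _ IH2 h) => y h1 h2 Py; apply: h2 => //; exact: h1.
Qed.

End Billiard.

(** * Expansion of the unstable cocycle *)

Section Expansion.
Context {R : realType} {d : nat}.
Implicit Types (u v w : 'rV[R]_d).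

Lemma norm_le_entries w (a : R) : 0 <= a -> (forall k, `|w ord0 k| <= a) -> `|w| <= a.
Proof.
move=> a0 h; rewrite [leLHS]/Num.norm /= mx_normrE; apply/bigmax_leP.
by split=> // -[i j] _ /=; rewrite ord1.
Qed.

Lemma root_above1 (delta : R) k : 0 < delta ->
  exists2 sigma, 1 < sigma & sigma ^+ k <= 1 + delta.
Proof.
move=> d0; have p3 n : 1 <= 3 ^+ n :> R by rewrite exprn_ege1 // ler1n.
(* For [e <= 1] the power [(1 + e) ^+ k] is at most [1 + 3 ^+ k * e]. *)
pose e : R := Num.min 1 (delta / 3 ^+ k).
have e0 : 0 < e by rewrite lt_min ltr01 divr_gt0 ?exprn_gt0.
have e1 : e <= 1 by rewrite ge_min lexx.
exists (1 + e); first by rewrite ltrDl.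
have h n : (1 + e) ^+ n <= 1 + 3 ^+ n * e.
  elim: n => [|n IH]; first by rewrite !expr0; lra.
  rewrite !exprSr; have := p3 n; set q := 3 ^+ n in IH *; move=> q1.
  apply: (@le_trans _ _ ((1 + q * e) * (1 + e))); last first.
    have h1 : 0 <= (q - 1) * e by rewrite mulr_ge0 ?subr_ge0 // ltW.
    have h2 : 0 <= q * e * (1 - e) by rewrite !mulr_ge0 ?subr_ge0 ?(ltW e0) // (le_trans ler01).
    by move: h1 h2; lra.
  by rewrite ler_wpM2r // addr_ge0 // ltW.
apply: le_trans (h k) _; rewrite lerD2l mulrC -ler_pdivlMr ?exprn_gt0 //.
by rewrite ge_min lexx orbT.
Qed.

Lemma tangential_pythagoras v w : dot v v = 1 ->
  dot (tangential v w) (tangential v w) = dot w w - dot w v ^+ 2.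
Proof. by move=> uv; rewrite /tangential !bilin uv (dotC v); ring. Qed.

Section OneStep.
Variables (n v v' u : 'rV[R]_d) (b g mu : R).
Hypotheses (un : dot n n = 1) (uv : dot v v = 1) (uv' : dot v' v' = 1)
  (hit : dot v n != 0) (hv' : v' = b *: v + g *: n) (hb : 0 <= b <= mu) (mu1 : mu < 1).
Let u' := shear n v u.
Let c := dot u' v.

Lemma shear_orth : dot u' n = 0.
Proof. by rewrite /u' /shear !bilin; field. Qed.

Lemma shear_tangential : tangential v u' = tangential v u.
Proof. by rewrite /u' /shear /tangential !bilin uv; apply/rowP => k; rewrite !mxE; ring. Qed.

Lemma shear_split : u' = tangential v u + c *: v.
Proof. by rewrite -shear_tangential /tangential subrK. Qed.

Let dotv' : dot u' v' = b * c.
Proof. by rewrite hv' dotDr !dotZr shear_orth mulr0 addr0. Qed.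

Let tan_orth : dot (tangential v u) v = 0.
Proof. by rewrite /tangential !bilin uv; ring. Qed.

(* Contracting towards the normal makes the component of u' along v' smaller
   than the one along v by the factor b, hence the component orthogonal to the
   velocity grows. *)
Lemma shear_growth : dot (tangential v' u') (tangential v' u') =
  dot (tangential v u) (tangential v u) + (1 - b ^+ 2) * c ^+ 2.
Proof.
rewrite (tangential_pythagoras _ uv').
have -> : dot u' u' = dot (tangential v u) (tangential v u) + c ^+ 2.
  move: tan_orth shear_split; move: (tangential v u) => t ht ->.
  by rewrite !bilin uv (dotC v) ht; ring.
by rewrite dotv'; ring.
Qed.

(** The change is exactly [c *: (v - b *: v')], so a displacement gaining little at this collision
    hardly moves. *)
Lemma shear_drift : enorm (tangential v' u' - tangential v u) <= 2 * `|c|.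
Proof.
have -> : tangential v' u' - tangential v u = c *: (v - b *: v').
  rewrite {1}/tangential dotv' shear_split.
  by apply/rowP => k; rewrite !mxE; ring.
rewrite enormZ mulrC ler_wpM2r //; apply: le_trans (enormB _ _) _.
case/andP: hb => b0 bm.
rewrite enormZ (unit_enorm uv) (unit_enorm uv') (ger0_norm b0) mulr1.
by rewrite lerD2l ltW // (le_lt_trans bm mu1).
Qed.

Lemma shear_normal : `|dot (tangential v u) n| <= `|c|.
Proof.
have : dot u' n = 0 := shear_orth; rewrite shear_split.
move: (tangential v u) => t; rewrite dotDl dotZl => /eqP; rewrite addr_eq0 => /eqP ->.
rewrite normrN normrM -[leRHS]mulr1 ler_wpM2l //.
by apply: le_trans (dot_norm_le _ _) _; rewrite (unit_enorm uv) (unit_enorm un) mulr1.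
Qed.

End OneStep.

Lemma enorm_tangential_le u v : dot v v = 1 -> enorm (tangential v u) <= enorm u.
Proof.
move=> uv; apply: enorm_le; first exact: enorm_ge0.
rewrite enorm_sqr /tangential !bilin uv (dotC v).
by have := sqr_ge0 (dot u v); lra.
Qed.

(** [kap] bounds from below the sine of the angle between [v] and the plane orthogonal to [w], in
    which [u] lies. *)
Lemma enorm_tangential_ge u v w (kap : R) : dot v v = 1 -> dot w w = 1 ->
  dot u w = 0 -> 0 <= kap <= dot v w -> kap * enorm u <= enorm (tangential v u).
Proof.
move=> uv uw huw /andP[k0 kv].
rewrite -ler_sqr ?nnegrE ?mulr_ge0 ?enorm_ge0 // exprMn !enorm_sqr.
rewrite (tangential_pythagoras _ uv).
have h : dot u v ^+ 2 <= dot u u * (1 - dot v w ^+ 2).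
  have e1 : dot u v = dot u (v - dot v w *: w) by rewrite !bilin huw; ring.
  have e2 : 1 - dot v w ^+ 2 = dot (v - dot v w *: w) (v - dot v w *: w).
    by rewrite !bilin uv uw (dotC w); ring.
  rewrite e1 e2 -!enorm_sqr -exprMn -real_normK ?num_real //.
  by rewrite ler_sqr ?nnegrE ?mulr_ge0 ?enorm_ge0 // dot_norm_le.
have : kap ^+ 2 <= dot v w ^+ 2 by rewrite ler_sqr ?nnegrE // (le_trans k0).
have := dot_ge0 u; nra.
Qed.

End Expansion.

Section ItineraryExpansion.
Context {R : realType} {d : nat} (P : polytope R d).
Local Notation N := (nfaces P).
Local Notation eta := (@normal _ _ P).

(** A right inverse of the transposed matrix of normals recovers [w] from its products with them. *)
Lemma spanning_bound (A : {set 'I_N}) :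
  (forall w, (forall i, i \in A -> dot w (eta i) = 0) -> w = 0) ->
  exists2 C, 0 < C & forall w (a : R), 0 <= a ->
    (forall i, i \in A -> `|dot w (eta i)| <= a) -> enorm w <= C * a.
Proof.
move=> sp; have /row_freeP [B hB] : row_free (normal_mx A)^T.
  apply: inj_row_free => w hw; apply: sp => i iA.
  have := normal_mx_mul w (enum_rank_in iA i); rewrite enum_rankK_in // => <-.
  by rewrite -[normal_mx A]trmxK -trmx_mul hw trmx0 mxE.
pose S := 1 + \sum_k \sum_j `|B k j|.
have S0 : 0 < S by rewrite ltr_pwDl // sumr_ge0 // => k _; exact: sumr_ge0.
exists (d.+1%:R * S); first by rewrite mulr_gt0.
move=> w a a0 h; apply: le_trans (enorm_le_norm _) _; rewrite -mulrA ler_pM2l //.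
apply: norm_le_entries; first by rewrite mulr_ge0 // ltW.
move=> j; rewrite -[w]mulmx1 -hB mulmxA mxE; apply: le_trans (ler_norm_sum _ _ _) _.
rewrite mulrDl mul1r mulr_suml; apply: ler_wpDl => //; apply: ler_sum => k _.
rewrite normrM mulrC; apply: ler_pM => //.
  by rewrite (bigD1 j) //= lerDl sumr_ge0.
have -> : (w *m (normal_mx A)^T) ord0 k = dot w (eta (enum_val k)).
  rewrite -normal_mx_mul.
  by have -> : normal_mx A *m w^T = (w *m (normal_mx A)^T)^T; [rewrite trmx_mul trmxK|rewrite [RHS]mxE].
by apply: h; exact: enum_valP.
Qed.

Variables mu kap : R.
Hypotheses (mu01 : 0 <= mu < 1) (kap0 : 0 < kap).
Hypotheses (gp : general_position P) (ob : obtuse P).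

(** The constant depends only on the set of faces met in the window, and there are finitely many
    such sets. *)
Lemma itinerary_spans_bound : exists k C, 0 < C /\ forall i p v,
  itinerary mu kap i p v -> forall w (a : R), 0 <= a ->
  (forall n, (1 <= n <= k)%N -> `|dot w (eta (i n))| <= a) -> enorm w <= C * a.
Proof.
have [k hk] := itinerary_spans mu01 kap0 gp ob.
pose sp (A : {set 'I_N}) := forall w, (forall i, i \in A -> dot w (eta i) = 0) -> w = 0.
have ex (A : {set 'I_N}) : exists C, sp A -> 0 < C /\ forall w (a : R), 0 <= a ->
    (forall i, i \in A -> `|dot w (eta i)| <= a) -> enorm w <= C * a.
  have [/spanning_bound [C C0 hC]|nA] := pselect (sp A); last by exists 0.
  by exists C.
have [CA hCA] := choice ex.
have [C C0 hC] := fin_upper_bound CA.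
exists k, C; split=> // i p v it w a a0 hw.
pose A : {set 'I_N} := [set l | [exists s : 'I_k.+1, (1 <= s)%N && (l == i s)]]%SET.
have spA : sp A.
  move=> w0 h; apply: (hk _ _ _ it) => n /andP[n1 nk]; apply: h; rewrite inE.
  by apply/existsP; exists (Ordinal (nk : n < k.+1)%N); rewrite n1 eqxx.
apply: le_trans ((hCA A spA).2 w a a0 _) _; last by rewrite ler_wpM2r.
move=> l; rewrite inE => /existsP[s /andP[s1 /eqP ->]].
by rewrite hw // s1 -ltnS ltn_ord.
Qed.

Section Cocycle.
Variables (i : nat -> 'I_N) (p v u : nat -> 'rV[R]_d).
Hypothesis it : itinerary mu kap i p v.
Hypothesis hu : forall n, u n.+1 = shear (eta (i n.+1)) (v n) (u n).
Let ub n := tangential (v n) (u n).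
Let c n := dot (u n.+1) (v n).

Lemma tangential_growth n : dot (ub n) (ub n) + (1 - mu ^+ 2) * c n ^+ 2 <=
  dot (ub n.+1) (ub n.+1).
Proof.
have [b [g [hb _ hv']]] := it_bounce it n.
have hit : dot (v n) (eta (i n.+1)) != 0 by rewrite lt_eqF // (it_hit it).
rewrite /ub /c hu (shear_growth _ (it_unit it n) (it_unit it n.+1) hit hv').
rewrite lerD2l ler_wpM2r ?sqr_ge0 // lerD2l lerN2.
by case/andP: hb => b0 bm; rewrite ler_sqr ?nnegrE // (le_trans b0).
Qed.

Lemma tangential_mono n m : (n <= m)%N -> dot (ub n) (ub n) <= dot (ub m) (ub m).
Proof.
move=> /subnKC <-; elim: (m - n)%N => [|s IH]; first by rewrite addn0.
rewrite addnS; apply: le_trans IH (le_trans _ (tangential_growth _)).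
rewrite lerDl mulr_ge0 ?sqr_ge0 // subr_ge0; case/andP: mu01 => m0 m1.
by rewrite expr_le1 // ltW.
Qed.

Lemma tangential_drift n (s : R) : (forall l, (l < n)%N -> `|c l| <= s) ->
  enorm (ub n - ub 0%N) <= n%:R * (2 * s).
Proof.
elim: n => [|n IH] hs; first by rewrite subrr enorm0 mul0r.
have -> : ub n.+1 - ub 0%N = (ub n.+1 - ub n) + (ub n - ub 0%N) by rewrite addrA subrK.
apply: le_trans (enormD _ _) _; rewrite -natr1 mulrDl mul1r addrC.
apply: lerD; first by apply: IH => l ln; apply: hs; exact: ltnW.
have [b [g [hb _ hv']]] := it_bounce it n.
have hit : dot (v n) (eta (i n.+1)) != 0 by rewrite lt_eqF // (it_hit it).
rewrite /ub hu; apply: le_trans (shear_drift _ (it_unit it n) (it_unit it n.+1)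
  hit hv' hb (andP mu01).2) _.
by rewrite -hu ler_pM2l // hs.
Qed.
End Cocycle.

Lemma itinerary_expansion : exists k delta, 0 < delta /\ forall i p v u,
  itinerary mu kap i p v ->
  (forall n, u n.+1 = shear (eta (i n.+1)) (v n) (u n)) ->
  (1 + delta) * dot (tangential (v 0%N) (u 0%N)) (tangential (v 0%N) (u 0%N)) <=
  dot (tangential (v k) (u k)) (tangential (v k) (u k)).
Proof.
have [k [C [C0 hC]]] := itinerary_spans_bound.
pose K := (2 * k%:R + 1) * C + 1.
have K0 : 0 < K by rewrite ltr_wpDl // mulr_ge0 ?(ltW C0) // addr_ge0 // mulr_ge0.
have mm : 0 < 1 - mu ^+ 2.
  by case/andP: mu01 => m0 m1; rewrite subr_gt0 expr_lt1.
exists k, ((1 - mu ^+ 2) / K ^+ 2); split; first by rewrite divr_gt0 // exprn_gt0.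
move=> i p v u it hu.
set ub := fun n => tangential (v n) (u n).
have [z|nz] := eqVneq (ub 0%N) 0.
  by rewrite -/(ub 0%N) z dot0l mulr0 dot_ge0.
have npos := enorm_gt0 nz.
(* One product above [s] already yields the growth [(1 - mu ^+ 2) * s ^+ 2]. If all stay below, [ub]
   moves by at most [2 * k * s], so [ub 0] has products at most [(2 * k + 1) * s] with the normals
   met; its length would then be at most [C * (2 * k + 1) * s], which is less than [K * s], its
   actual length. *)
pose s := enorm (ub 0%N) / K.
have s0 : 0 < s by rewrite divr_gt0.
have [[n nk hn]|small] := pselect (exists2 n, (n < k)%N & s < `|dot (u n.+1) (v n)|).
  have h1 := tangential_mono it hu (leq0n n); have h2 := tangential_mono it hu nk.
  have h3 := tangential_growth it hu n; rewrite /= in h1 h2 h3.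
  apply: le_trans (le_trans h3 h2).
  rewrite mulrDl mul1r; apply: lerD => //.
  rewrite -mulrA ler_pM2l // mulrC -enorm_sqr -expr_div_n -/(ub 0%N) -/s.
  rewrite -[leRHS]real_normK ?num_real // ler_sqr ?nnegrE //; exact: ltW.
have sm l : (l < k)%N -> `|dot (u l.+1) (v l)| <= s.
  by move=> lk; rewrite leNgt; apply/negP => h; apply: small; exists l.
suff : enorm (ub 0%N) <= C * ((2 * k%:R + 1) * s).
  move=> h; exfalso; have : C * ((2 * k%:R + 1) * s) < K * s.
    by rewrite mulrA ltr_pM2r // /K [C * _]mulrC ltrDl.
  by rewrite ltNge /s (mulrC K) divfK ?gt_eqF // h.
apply: (hC _ _ _ it); first by rewrite mulr_ge0 ?(ltW s0) // addr_ge0 // mulr_ge0.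
case=> // n /andP[_ nk].
have -> : ub 0%N = ub n - (ub n - ub 0%N) by rewrite opprB addrC subrK.
rewrite dotBl; apply: le_trans (ler_normB _ _) _.
have h1 : `|dot (ub n) (eta (i n.+1))| <= s.
  have hit : dot (v n) (eta (i n.+1)) != 0 by rewrite lt_eqF // (it_hit it).
  apply: le_trans (shear_normal _ (normal_unit _) (it_unit it n) hit) _.
  by rewrite -hu sm.
have h2 : `|dot (ub n - ub 0%N) (eta (i n.+1))| <= n%:R * (2 * s).
  apply: le_trans (dot_norm_le _ _) _; rewrite normal_enorm mulr1.
  by apply: (tangential_drift it hu) => l ln; apply: sm; exact: ltn_trans ln nk.
have : n%:R * (2 * s) <= k%:R * (2 * s).
  by apply: ler_wpM2r; [rewrite mulr_ge0 // ltW|rewrite ler_nat ltnW].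
lra.
Qed.

Lemma itinerary_exponential : exists sigma c, [/\ 1 < sigma, 0 < c & forall i p v u,
  itinerary mu kap i p v ->
  (forall n, u n.+1 = shear (eta (i n.+1)) (v n) (u n)) ->
  dot (u 0%N) (eta (i 0%N)) = 0 -> kap <= dot (v 0%N) (eta (i 0%N)) ->
  forall n, c * sigma ^+ n * enorm (u 0%N) <= enorm (u n)].
Proof.
have [k [delta [d0 hd]]] := itinerary_expansion.
have [k0|kpos] := posnP k.
  (* The expansion estimate over an empty window forces u = 0. *)
  exists 2, 1; split=> //; first by rewrite ltr1n.
  move=> i p v u it hu u0 v0 n.
  have := hd _ _ _ _ it hu; rewrite k0 -[leRHS]mul1r => h.
  have z : tangential (v 0%N) (u 0%N) = 0.
    apply: dot_eq0; apply/eqP; rewrite eq_le dot_ge0 andbT.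
    move: h; rewrite mulrDl gerDl; by rewrite pmulr_rle0.
  have := enorm_tangential_ge (it_unit it 0%N) (normal_unit (i 0%N)) u0
    (introT andP (conj (ltW kap0) v0)).
  rewrite z enorm0 pmulr_rle0 // => e0.
  have -> : enorm (u 0%N) = 0 by apply/eqP; rewrite eq_le e0 enorm_ge0.
  by rewrite mulr0 enorm_ge0.
(* The exponent is [2 * k] because the expansion over [k] collisions is stated for squared
   lengths. *)
have [sig sig1 hsig] := root_above1 (2 * k) d0.
have sp : 0 < sig by lra.
(* [kap] pays for passing from [u] to its component orthogonal to the velocity, and [sig ^+ k] for
   the incomplete last block. *)
exists sig, (kap / sig ^+ k); split=> //; first by rewrite divr_gt0 // exprn_gt0.
move=> i p v u it hu u0 v0 n.
pose ub m := tangential (v m) (u m).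
have grow q : (sig ^+ (k * q) * enorm (ub 0%N)) <= enorm (ub (q * k)%N).
  rewrite -ler_sqr ?nnegrE ?mulr_ge0 ?enorm_ge0 ?exprn_ge0 ?(ltW sp) //.
  rewrite exprMn !enorm_sqr; elim: q => [|q IH].
    by rewrite muln0 expr0 expr1n mul1r mul0n.
  have hu' m : u (q * k + m.+1)%N =
      shear (eta (i (q * k + m.+1)%N)) (v (q * k + m)%N) (u (q * k + m)%N).
    by rewrite addnS hu.
  have := hd _ _ _ _ (itinerary_shift (q * k) it) hu'.
  rewrite /= addn0 (addnC (q * k)%N k) -mulSn; apply: le_trans.
  rewrite -/(ub (q * k)%N) mulnS exprD exprMn -exprM (mulnC k 2) -mulrA.
  apply: ler_pM => //; first by rewrite exprn_ge0 // ltW.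
  by rewrite mulr_ge0 ?sqr_ge0 ?dot_ge0.
have mono : enorm (ub ((n %/ k) * k)%N) <= enorm (ub n).
  rewrite -ler_sqr ?nnegrE ?enorm_ge0 // !enorm_sqr.
  by apply: (tangential_mono it hu); exact: leq_divM.
have h0 := enorm_tangential_ge (it_unit it 0%N) (normal_unit (i 0%N)) u0
    (introT andP (conj (ltW kap0) v0)).
apply: le_trans (enorm_tangential_le (u n) (it_unit it n)).
apply: le_trans mono; apply: le_trans (grow _).
rewrite -/(ub 0%N) in h0.
have hp : sig ^+ n <= sig ^+ (k * (n %/ k)) * sig ^+ k.
  by rewrite -exprD ler_eXn2l // addnC -mulnS mulnC ltnW // -ltn_divLR.
have -> : kap / sig ^+ k * sig ^+ n * enorm (u 0%N) =
   sig ^+ n / sig ^+ k * (kap * enorm (u 0%N)) by field; rewrite expf_neq0 // gt_eqF.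
apply: ler_pM => //.
- by rewrite divr_ge0 ?exprn_ge0 // ltW.
- by rewrite mulr_ge0 ?enorm_ge0 // ltW.
- by rewrite ler_pdivrMr // exprn_gt0.
Qed.


End ItineraryExpansion.

(** * The stable graph *)

(** With [C = K / (1 - mu)] the steps are bounded by the differences of [C * mu ^+ m], so
    [u m - C * mu ^+ m] is nondecreasing and bounded. *)
Lemma geometric_limit {R : realType} (u : nat -> R) (K mu : R) : 0 <= mu < 1 ->
  (forall m, `|u m.+1 - u m| <= K * mu ^+ m) ->
  (u m @[m --> \oo] --> lim (u m @[m --> \oo])) /\
  forall m, `|lim (u m @[m --> \oo]) - u m| <= K / (1 - mu) * mu ^+ m.
Proof.
move=> mu01 hu; case/andP: (mu01) => m0 m1; pose C := K / (1 - mu).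
have m1' : 0 < 1 - mu by rewrite subr_gt0.
have CK : C * (1 - mu) = K by rewrite /C divfK // gt_eqF.
have step m : - (C * mu ^+ m - C * mu ^+ m.+1) <= u m.+1 - u m <= C * mu ^+ m - C * mu ^+ m.+1.
  by rewrite -ler_norml (le_trans (hu m)) // -CK exprS; lra.
have tele m s : - (C * mu ^+ m - C * mu ^+ (m + s)) <= u (m + s)%N - u m <=
    C * mu ^+ m - C * mu ^+ (m + s).
  elim: s => [|s /andP[IH1 IH2]]; first by rewrite addn0 !subrr oppr0 lexx.
  by rewrite addnS; have /andP[h1 h2] := step (m + s)%N; apply/andP; split; lra.
have K0 : 0 <= K by have := le_trans (normr_ge0 _) (hu 0%N); rewrite expr0 mulr1.
have C0 : 0 <= C by rewrite divr_ge0 // ltW.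
have pw m : 0 <= C * mu ^+ m by rewrite mulr_ge0 // exprn_ge0.
have geo : C * mu ^+ m @[m --> \oo] --> 0.
  rewrite -[X in _ --> X](mulr0 C); apply: cvgM; first exact: cvg_cst.
  by apply: cvg_expr; rewrite ger0_norm.
have ca : cvg (u m - C * mu ^+ m @[m --> \oo]).
  apply: nondecreasing_is_cvgn.
    apply/nondecreasing_seqP => m; have /andP[h1 _] := step m; lra.
  exists (u 0%N + C) => _ [m _ <-]; have /andP[_ h2] := tele 0%N m.
  by rewrite add0n expr0 in h2; have := pw m; lra.
have cu : u m @[m --> \oo] --> lim (u m @[m --> \oo]).
  suff : cvg (u m @[m --> \oo]) by [].
  apply/cvg_ex; exists (lim (u m - C * mu ^+ m @[m --> \oo]) + 0).
  have e : u = (fun m => u m - C * mu ^+ m) \+ (fun m => C * mu ^+ m).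
    by apply/funext => m /=; rewrite subrK.
  by rewrite {1}e; exact: cvgD ca geo.
split=> // m; have hl : \forall n \near \oo, u m - C * mu ^+ m <= u n <= u m + C * mu ^+ m.
  exists m => // n /= mn; have /andP[h1 h2] := tele m (n - m)%N.
  by rewrite subnKC // in h1 h2; have := pw n => h3; apply/andP; split; lra.
have lo : u m - C * mu ^+ m <= lim (u m @[m --> \oo]).
  by apply: (limr_ge cu); apply: filterS hl => n /andP[].
have up : lim (u m @[m --> \oo]) <= u m + C * mu ^+ m.
  by apply: (limr_le cu); apply: filterS hl => n /andP[].
by rewrite -/C ler_norml; apply/andP; split; lra.
Qed.

Lemma cvg_mulmx {R : realType} {T : Type} {F : set_system T} {FF : Filter F} m n p
    (A : T -> 'M[R]_(m, n)) (B : T -> 'M[R]_(n, p)) (A0 : 'M[R]_(m, n)) (B0 : 'M[R]_(n, p)) :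
  A t @[t --> F] --> A0 -> B t @[t --> F] --> B0 -> A t *m B t @[t --> F] --> A0 *m B0.
Proof.
move=> hA hB; apply: cvg_mx => i j; rewrite mxE; under eq_fun do rewrite mxE.
by apply: cvg_sumr => k _; apply: cvgM; exact: cvg_entry.
Qed.

Lemma enorm_delta {R : realType} d (k : 'I_d) : enorm (delta_mx ord0 k : 'rV[R]_d) = 1.
Proof. by rewrite /enorm dot_delta mxE !eqxx sqrtr1. Qed.

Lemma entry_le_enorm {R : realType} d (w : 'rV[R]_d) k : `|w ord0 k| <= enorm w.
Proof. exact: le_trans (ler_norm_entry w ord0 k) (norm_le_enorm w). Qed.

Lemma enorm_mulmx_le {R : realType} d (M : 'M[R]_d) (K : R) (w : 'rV[R]_d) :
  0 <= K -> (forall i j, `|M i j| <= K) ->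
  enorm (w *m M) <= d.+1%:R * (d%:R * K) * enorm w.
Proof.
move=> K0 hM; apply: le_trans (enorm_le_norm _) _; rewrite -mulrA ler_pM2l //.
have h : 0 <= d%:R * K * enorm w by rewrite !mulr_ge0 // enorm_ge0.
apply: norm_le_entries => // j; rewrite mxE; apply: le_trans (ler_norm_sum _ _ _) _.
apply: (@le_trans _ _ (\sum_(k < d) enorm w * K)).
  by apply: ler_sum => k _; rewrite normrM ler_pM // entry_le_enorm.
by rewrite sumr_const card_ord -[leLHS]mulr_natl -mulrA (mulrC K).
Qed.

(** * The core and the series for the stable graph *)

Section Core.
Context {R : realType} {d : nat} (P : polytope R d).
Let V := ('rV[R]_d * 'rV[R]_d)%type.
Variables (f f1 : R -> R) (mu kap : R).
Hypothesis H : law_bounds f f1 mu kap.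
Hypotheses (gp : general_position P) (d2 : (2 <= d)%N) (ob : obtuse P).
Local Notation N := (nfaces P).
Local Notation eta := (@normal _ _ P).
Local Notation off := (@offset _ _ P).
Local Notation Phi := (billiard_map P f).
Local Notation core := (billiard_core P f).
Local Notation nu := (@nu _ _ P).
Local Notation ftime := (ftime P f).
Implicit Types (x y : V) (u w : 'rV[R]_d) (i j k : 'I_N).

Hypothesis core_bij : set_bij core core Phi.

Lemma core_forward x : core x -> forward_regular P f x.
Proof. by move=> /(_ 0%N Logic.I) [y hy <-]. Qed.

Lemma core_phase x : core x -> phase P x.
Proof. by move=> /core_forward /(_ 0%N) []. Qed.

Lemma core_map x : core x -> core (Phi x).
Proof. by case: core_bij => h _ _; exact: h. Qed.

Lemma core_iter n x : core x -> core (iter n Phi x).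
Proof. by move=> hx; elim: n => //= n; exact: core_map. Qed.

Lemma core_hits x : core x -> exists i j tau, hits i j tau x.
Proof. by move=> /core_forward /(_ 0%N); exact: regular_hits. Qed.

(** A phase point only has a positive normal velocity. The uniform bound [kap] holds because [x] is
    the image of a core point, so its velocity comes out of the contraction. *)
Lemma core_nu x : core x -> exists i,
  [/\ relint_face i x.1, nu x = eta i & kap <= dot x.2 (eta i)].
Proof.
case: core_bij => _ _ /[apply] [[z hz <-]].
have [i [j [tau h]]] := core_hits hz; exists j.
have [hr rpos] := hits_reflected gp d2 h; have [_ nj _] := hits_data f gp d2 h.
split=> //; first by rewrite (hits_map f gp d2 h) /=; case: h.
rewrite (hits_map f gp d2 h) /=.
exact: (contraction_normal_ge H (normal_unit j) hr rpos).
Qed.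

Lemma core_unit x : core x -> dot x.2 x.2 = 1.
Proof. by move=> /core_phase [i [_ hv _]]; exact: enorm_unit. Qed.

Lemma core_nu_unit x : core x -> dot (nu x) (nu x) = 1.
Proof. by move=> /core_nu [i [_ -> _]]; rewrite normal_unit. Qed.

Lemma core_nu_ge x : core x -> kap <= dot x.2 (nu x).
Proof. by move=> /core_nu [i [_ -> ]]. Qed.

Lemma core_nu_neq0 x : core x -> dot x.2 (nu x) != 0.
Proof. by move=> /core_nu_ge h; rewrite gt_eqF // (lt_le_trans (law_kap H)). Qed.

Lemma core_next_neq0 x : core x -> dot x.2 (nu (Phi x)) != 0.
Proof.
move=> /core_hits [i [j [tau h]]]; have [_ -> _] := hits_data f gp d2 h.
by rewrite lt_eqF // (hits_incoming gp d2 h).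
Qed.

Lemma core_itinerary x : core x -> exists2 i : nat -> 'I_N,
  forall n, nu (iter n Phi x) = eta (i n) &
  itinerary mu kap i (fun n => (iter n Phi x).1) (fun n => (iter n Phi x).2).
Proof.
move=> hx; have ex n : exists i, exists j tau, hits i j tau (iter n Phi x).
  exact: core_hits (core_iter n hx).
have [i hi] := choice ex; exists i => [n|].
  by have [j [tau h]] := hi n; have [-> _ _] := hits_data f gp d2 h.
have hnext n : exists tau, hits (i n) (i n.+1) tau (iter n Phi x).
  have [j [tau h]] := hi n; have [j' [tau' h']] := hi n.+1; exists tau.
  suff <- : j = i n.+1 by [].
  case: h' => + _ _ _ _; rewrite iterS (hits_map f gp d2 h) /=.
  by apply: (relint_face_inj gp d2); case: h.
split=> n; have [tau h] := hnext n; have hm := hits_map f gp d2 h.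
- by case: h => /relint_face_body.
- by case: h => /(relint_faceP gp d2)[].
- by case: h.
- by exists tau; [case: h|rewrite /= hm].
- have [b [g [hb hg e]]] := contraction_bounce H (normal_unit (i n.+1))
    (core_unit (core_iter n hx)) (hits_incoming gp d2 h).
  by exists b, g; split=> //=; rewrite hm.
- exact: (hits_incoming gp d2 h).
Qed.

(** The derivative of the [n]-th iterate on position displacements, whose velocity component stays
    zero. *)
Fixpoint drift n x u := if n is n'.+1
  then drift n' (Phi x) (shear (nu (Phi x)) x.2 u) else u.

Lemma driftSr n x u :
  drift n.+1 x u = shear (nu (iter n.+1 Phi x)) (iter n Phi x).2 (drift n x u).
Proof. by elim: n x u => // n IH x u; rewrite [LHS]/= -[LHS]/(drift n.+1 _ _) IH !iterSr. Qed.

Lemma drift_exponential : exists sigma c, [/\ 1 < sigma, 0 < c & forall x u n,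
  core x -> dot u (nu x) = 0 -> c * sigma ^+ n * enorm u <= enorm (drift n x u)].
Proof.
have [sigma [c [s1 c0 h]]] := itinerary_exponential (law_mu H) (law_kap H) gp ob.
exists sigma, c; split=> // x u n hx hu; have [i hi it] := core_itinerary hx.
apply: (h _ _ _ (fun n => drift n x u) it).
- by move=> m; rewrite -hi; exact: driftSr.
- by rewrite -hi.
- by rewrite -hi; exact: core_nu_ge.
Qed.

Lemma core_ftime : exists2 B, 0 < B & forall x, core x -> `|ftime x| <= B.
Proof.
have [B B0 hB] := body_bounded P; exists (2 * B) => [|x hx]; first exact: mulr_gt0.
rewrite /ftime; apply: le_trans (dot_norm_le _ _) _.
rewrite (unit_enorm (core_unit hx)) mulr1; apply: le_trans (enormB _ _) _.
have hb y : core y -> body P y.1 by move=> /core_phase[i [ri _ _]]; exact: relint_face_body ri.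
by have := hB _ (hb _ hx); have := hB _ (hb _ (core_map hx)); lra.
Qed.

Definition bounce (n v w : 'rV[R]_d) := dcontraction f f1 n (Defs.reflect n v) (Defs.reflect n w).

Lemma bounce_linear n v : linear (bounce n v).
Proof. by move=> a u w; rewrite /bounce reflect_linear dcontraction_linear. Qed.

Lemma shear_linear (n v : 'rV[R]_d) : linear (shear n v).
Proof. by move=> a u w; rewrite /shear !bilin; apply/rowP => k; rewrite !mxE; ring. Qed.

HB.instance Definition _ n v := GRing.isLinear.Build R _ _ _ (bounce n v) (bounce_linear n v).
HB.instance Definition _ n v := GRing.isLinear.Build R _ _ _ (shear n v) (shear_linear n v).

Definition bounce_mx x : 'M[R]_d := lin1_mx (bounce (nu (Phi x)) x.2).
Definition proj_mx x : 'M[R]_d := lin1_mx (shear (nu x) x.2).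

Lemma bounce_mxE x w : w *m bounce_mx x = bounce (nu (Phi x)) x.2 w.
Proof. by rewrite mul_rV_lin1. Qed.

Lemma proj_mxE x w : w *m proj_mx x = shear (nu x) x.2 w.
Proof. by rewrite mul_rV_lin1. Qed.

Lemma bounce_bound x w : core x -> enorm (w *m bounce_mx x) <= mu * enorm w.
Proof.
move=> hx; rewrite bounce_mxE; have [i [j [tau h]]] := core_hits hx.
have [_ -> _] := hits_data f gp d2 h; have [hr rpos] := hits_reflected gp d2 h.
apply: le_trans (dcontraction_norm H (normal_unit j) hr rpos _) _.
by rewrite reflect_enorm // normal_unit.
Qed.

Lemma bounce_orth x w : core x -> dot (w *m bounce_mx x) (Phi x).2 = 0.
Proof.
move=> hx; rewrite bounce_mxE; have [i [j [tau h]]] := core_hits hx.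
have [_ -> _] := hits_data f gp d2 h; have [hr rpos] := hits_reflected gp d2 h.
by rewrite (hits_map f gp d2 h) /=; exact: dcontraction_orth (normal_unit j) hr rpos _.
Qed.

Lemma proj_bound x w : core x -> enorm (w *m proj_mx x) <= (1 + kap^-1) * enorm w.
Proof.
move=> hx; rewrite proj_mxE /shear; apply: le_trans (enormB _ _) _.
rewrite mulrDl mul1r lerD2l enormZ (unit_enorm (core_unit hx)) mulr1 normrM normfV mulrC.
have k0 := law_kap H; have kn := core_nu_ge hx; have np := lt_le_trans k0 kn.
apply: ler_pM; rewrite ?invr_ge0 //; first by rewrite gtr0_norm // lef_pV2 ?posrE.
by apply: le_trans (dot_norm_le _ _) _; rewrite (unit_enorm (core_nu_unit hx)) mulr1.
Qed.

Lemma proj_orth x w : core x -> dot (w *m proj_mx x) (nu x) = 0.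
Proof. by move=> hx; rewrite proj_mxE shear_orth // core_nu_neq0. Qed.

Lemma shear_proj x w : core x -> dot w (nu (Phi x)) = 0 ->
  shear (nu (Phi x)) x.2 (w *m proj_mx x) = w.
Proof.
move=> hx hw; rewrite proj_mxE /shear; set a := dot w (nu x) / _.
rewrite dotBl dotZl hw sub0r mulNr mulfK ?core_next_neq0 //.
by rewrite scaleNr opprK subrK.
Qed.

Fixpoint back n x : 'M[R]_d :=
  if n is n'.+1 then back n' (Phi x) *m proj_mx x else 1%:M.

Fixpoint bounces n x : 'M[R]_d :=
  if n is n'.+1 then bounce_mx x *m bounces n' (Phi x) else 1%:M.

(** Both steps project along the same velocity [x.2], one onto the plane of the next face and one
    onto that of the current face, so they are inverse to each other. Expansion of [drift] thereby
    becomes a bound on [back]. *)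
Lemma back_drift n x w : core x -> dot w (nu (iter n Phi x)) = 0 ->
  dot (w *m back n x) (nu x) = 0 /\ drift n x (w *m back n x) = w.
Proof.
elim: n x w => [|n IH] x w hx hw; first by rewrite mulmx1.
have [|h1 h2] := IH _ w (core_map hx); first by rewrite -iterSr.
by split; rewrite /= mulmxA; [exact: proj_orth|rewrite shear_proj].
Qed.

Lemma bounces_bound n x w : core x -> enorm (w *m bounces n x) <= mu ^+ n * enorm w.
Proof.
elim: n x w => [|n IH] x w hx; first by rewrite mulmx1 expr0 mul1r.
rewrite /= mulmxA; apply: le_trans (IH _ _ (core_map hx)) _.
rewrite exprSr -mulrA ler_wpM2l ?bounce_bound // exprn_ge0 //.
by case/andP: (law_mu H).
Qed.

(* With row vectors acted on from the right, these are the partial sums of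
   - sum_n tau_n B_0 .. B_(n-1) Q_n .. Q_0, where B_n is the derivative of the
   n-th velocity change and Q_n projects along the n-th velocity onto the n-th
   face.  The stable space is the graph of the limit: such a graph h is invariant
   iff h_x w = Q_x (h_(Phi x) (B_x w)) - tau Q_x w. *)
Fixpoint stable_sum n x : 'M[R]_d := if n is n'.+1
  then bounce_mx x *m stable_sum n' (Phi x) *m proj_mx x - ftime x *: proj_mx x
  else 0.

Lemma stable_sum_diff n x : stable_sum n.+1 x - stable_sum n x =
  bounces n x *m (- ftime (iter n Phi x) *: proj_mx (iter n Phi x)) *m back n x.
Proof.
elim: n x => [|n IH] x.
  by rewrite /= mulmx0 mul0mx sub0r subr0 mul1mx mulmx1 scaleNr.
rewrite -[stable_sum n.+2 x]/(bounce_mx x *m stable_sum n.+1 (Phi x) *m proj_mx x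
  - ftime x *: proj_mx x) -[stable_sum n.+1 x]/(bounce_mx x *m stable_sum n (Phi x) *m proj_mx x
  - ftime x *: proj_mx x) opprB addrA subrK -mulmxBl -mulmxBr IH iterSr.
by rewrite [bounces n.+1 x]/= [back n.+1 x]/= !mulmxA.
Qed.

(** The factor [mu ^+ n] comes from the velocities alone. [B] bounds the flight time, [1 + kap^-1]
    one projection, and [c^-1] all the projections back, which invert an expanding map. *)
Lemma stable_sum_step : exists2 K, 0 <= K & forall n x w, core x ->
  enorm (w *m (stable_sum n.+1 x - stable_sum n x)) <= K * mu ^+ n * enorm w.
Proof.
have [sigma [c [s1 c0 hexp]]] := drift_exponential.
have [B B0 hB] := core_ftime.
have k0 := law_kap H; have s0 : 0 < sigma by lra.
exists (c^-1 * (B * (1 + kap^-1))) => [|n x w hx].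
  by rewrite !mulr_ge0 ?invr_ge0 ?addr_ge0 ?invr_ge0 ?(ltW c0) ?(ltW B0) ?(ltW k0).
rewrite stable_sum_diff !mulmxA; set a := w *m bounces n x.
have hn := core_iter n hx; set xn := iter n Phi x in hn *.
set q := a *m (- ftime xn *: proj_mx xn).
have hq : enorm q <= B * (1 + kap^-1) * (mu ^+ n * enorm w).
  rewrite /q -scalemxAr enormZ normrN -mulrA.
  apply: ler_pM; rewrite ?enorm_ge0 ?hB //; apply: le_trans (proj_bound _ hn) _.
  by rewrite ler_pM2l ?bounces_bound // addr_gt0 ?invr_gt0.
have [|h1 h2] := @back_drift n x q hx.
  by rewrite /q -scalemxAr dotZl proj_orth ?mulr0.
have h3 := hexp x _ n hx h1; rewrite h2 in h3.
have h4 : c * enorm (q *m back n x) <= enorm q.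
  apply: le_trans h3; rewrite -mulrA ler_pM2l //.
  by rewrite ler_peMl ?enorm_ge0 // exprn_ege1 // ltW.
rewrite -(ler_pM2l c0); apply: le_trans h4 _; apply: le_trans hq _.
by rewrite !mulrA mulfV ?gt_eqF // mul1r.
Qed.

End Core.

(** * Invariance and continuity of the stable graph *)

Section StableMatrix.
Context {R : realType} {d : nat} (P : polytope R d).
Let V := ('rV[R]_d * 'rV[R]_d)%type.
Variables (f f1 : R -> R) (mu kap : R).
Hypothesis H : law_bounds f f1 mu kap.
Hypotheses (gp : general_position P) (d2 : (2 <= d)%N) (ob : obtuse P).
Local Notation N := (nfaces P).
Local Notation eta := (@normal _ _ P).
Local Notation off := (@offset _ _ P).
Local Notation Phi := (billiard_map P f).
Local Notation core := (billiard_core P f).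
Local Notation nu := (@nu _ _ P).
Local Notation ftime := (ftime P f).
Implicit Types (x y : V) (u w : 'rV[R]_d) (i j k : 'I_N).

Hypothesis core_bij : set_bij core core Phi.
Local Notation bounce := (bounce f f1).
Local Notation bounce_mx := (bounce_mx P f f1).
Local Notation proj_mx := (@proj_mx _ _ P).
Local Notation stable_sum := (stable_sum P f f1).

Definition stable_mx x : 'M[R]_d :=
  \matrix_(i, j) lim (stable_sum m x i j @[m --> \oo]).

Lemma stable_mx_lim : exists2 C, 0 <= C & forall x, core x -> forall i j : 'I_d,
  stable_sum m x i j @[m --> \oo] --> stable_mx x i j /\
  forall m, `|stable_mx x i j - stable_sum m x i j| <= C * mu ^+ m.
Proof.
have [K K0 hK] := stable_sum_step H gp d2 ob core_bij.
have m1 : 0 < 1 - mu by rewrite subr_gt0; case/andP: (law_mu H).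
exists (K / (1 - mu)); first by rewrite divr_ge0 // ltW.
move=> x hx i j; rewrite mxE; apply: geometric_limit; first exact: law_mu H.
move=> m; apply: le_trans (_ : enorm (delta_mx ord0 i *m (stable_sum m.+1 x - stable_sum m x)) <= _).
  apply: le_trans (entry_le_enorm _ j).
  by rewrite -rowE !mxE.
by apply: le_trans (hK _ _ _ hx) _; rewrite enorm_delta mulr1.
Qed.

Lemma stable_mx_bound : exists2 C, 0 <= C & forall x w, core x ->
  enorm (w *m stable_mx x) <= C * enorm w.
Proof.
have [C C0 hC] := stable_mx_lim; exists (d.+1%:R * (d%:R * C)).
  by rewrite !mulr_ge0.
move=> x w hx; apply: enorm_mulmx_le => // i j.
have [_ /(_ 0%N)] := hC x hx i j.
have -> : stable_sum 0 x i j = 0 by rewrite /= mxE.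
by rewrite expr0 mulr1 subr0.
Qed.

Lemma stable_mx_rec x : core x ->
  stable_mx x = bounce_mx x *m stable_mx (Phi x) *m proj_mx x - ftime x *: proj_mx x.
Proof.
move=> hx; have [C _ hC] := stable_mx_lim.
have cv y : core y -> stable_sum m y @[m --> \oo] --> stable_mx y.
  by move=> hy; apply: cvg_mx => i j; exact: (hC y hy i j).1.
have h1 : stable_sum m.+1 x @[m --> \oo] -->
    bounce_mx x *m stable_mx (Phi x) *m proj_mx x - ftime x *: proj_mx x.
  apply: cvgB; last exact: cvg_cst.
  apply: cvg_mulmx; last exact: cvg_cst.
  by apply: cvg_mulmx; [exact: cvg_cst|exact: cv (core_map core_bij hx)].
apply/matrixP => i j.
have c1 : stable_sum m.+1 x i j @[m --> \oo] --> stable_mx x i j.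
  by have := (hC x hx i j).1; rewrite -(cvg_shiftS (fun m => stable_sum m x i j)).
have c2 : stable_sum m.+1 x i j @[m --> \oo] -->
    (bounce_mx x *m stable_mx (Phi x) *m proj_mx x - ftime x *: proj_mx x) i j.
  exact: cvg_entry h1.
by rewrite -(cvg_lim (@Rhausdorff R) c1) (cvg_lim (@Rhausdorff R) c2).
Qed.

Lemma stable_mx_orth x w : core x -> dot (w *m stable_mx x) (nu x) = 0.
Proof.
move=> hx; rewrite stable_mx_rec // mulmxBr -scalemxAr mulmxA dotBl dotZl.
by rewrite !(proj_orth H gp d2 core_bij) // mulr0 subrr.
Qed.

Lemma core_near x : core x -> \forall y \near x, core y ->
  nu y = nu x /\ nu (Phi y) = nu (Phi x).
Proof.
move=> hx; have [i [j [tau h]]] := core_hits gp d2 hx.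
apply: filterS (hits_near gp d2 h) => y hy cy.
have h' := hy (core_phase cy).
have [a1 a2 _] := hits_data f gp d2 h; have [b1 b2 _] := hits_data f gp d2 h'.
by split; [exact: etrans b1 (esym a1)|exact: etrans b2 (esym a2)].
Qed.

Lemma core_map_cvg x : core x -> Phi y @[y --> within core (nbhs x)] --> Phi x.
Proof.
move=> hx; have h := has_diff_on_cvg (DPhi_diff H gp d2 (core_forward hx 0)).
apply: cvg_trans h; apply: cvg_app; apply: within_subset => y; exact: core_phase.
Qed.

Lemma core_map_within x (T : topologicalType) (g : V -> T) (l : T) : core x ->
  g y @[y --> within core (nbhs (Phi x))] --> l ->
  g (Phi y) @[y --> within core (nbhs x)] --> l.
Proof.
move=> hx hg A /hg hA; have := core_map_cvg hx hA.
rewrite /nbhs /= /within /= => h; apply: filterS h => y h cy.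
by apply: h => //; exact: core_map.
Qed.

Lemma fst_cvg x : y.1 @[y --> within core (nbhs x)] --> x.1.
Proof. by apply: cvg_within_filter; exact: cvg_fst_nbhs. Qed.

Lemma snd_cvg x : y.2 @[y --> within core (nbhs x)] --> x.2.
Proof. by apply: cvg_within_filter; exact: cvg_snd_nbhs. Qed.

Lemma ftime_cvg x : core x -> ftime y @[y --> within core (nbhs x)] --> ftime x.
Proof.
move=> hx; apply: cvg_dot; last exact: snd_cvg.
apply: cvgB; last exact: fst_cvg.
by apply: (core_map_within hx); exact: fst_cvg.
Qed.

Lemma shear_cvg x n w : dot x.2 n != 0 ->
  shear n y.2 w @[y --> within core (nbhs x)] --> shear n x.2 w.
Proof.
move=> h0; apply: cvgB; first exact: cvg_cst.
apply: cvgZ; last exact: snd_cvg.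
apply: cvgM; first exact: cvg_cst.
by apply: cvgV => //; apply: cvg_dot; [exact: snd_cvg|exact: cvg_cst].
Qed.

Lemma proj_mx_cvg x : core x ->
  proj_mx y @[y --> within core (nbhs x)] --> proj_mx x.
Proof.
move=> hx; apply: cvg_mx => i j; rewrite mxE.
have h : shear (nu x) y.2 (delta_mx ord0 i) ord0 j @[y --> within core (nbhs x)]
    --> shear (nu x) x.2 (delta_mx ord0 i) ord0 j.
  by apply: cvg_entry; apply: shear_cvg; exact: (core_nu_neq0 H gp d2 core_bij hx).
apply: cvg_trans h; apply: near_eq_cvg; rewrite near_withinE.
by apply: filterS (core_near hx) => y hy /hy [e _]; rewrite [proj_mx y i j]mxE e.
Qed.

Lemma bounce_mx_cvg x : core x ->
  bounce_mx y @[y --> within core (nbhs x)] --> bounce_mx x.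
Proof.
move=> hx; apply: cvg_mx => k l.
have [i [j [tau h]]] := core_hits gp d2 hx.
have [hr rpos] := hits_reflected gp d2 h; have [_ nj _] := hits_data f gp d2 h.
have ent n y : nu (Phi y) = n -> bounce_mx y k l = bounce n y.2 (delta_mx ord0 k) ord0 l.
  by move=> <-; rewrite [LHS]mxE.
have cv : bounce (eta j) y.2 (delta_mx ord0 k) @[y --> within core (nbhs x)]
   --> bounce (eta j) x.2 (delta_mx ord0 k).
  apply: (dcontraction_cvg H (normal_unit j) hr rpos).
    by apply: cvg_reflect; exact: snd_cvg.
  rewrite near_withinE; apply: nearW => y cy.
  by rewrite reflect_dot ?normal_unit // (core_unit cy).
have h' : bounce (eta j) y.2 (delta_mx ord0 k) ord0 l
    @[y --> within core (nbhs x)] --> bounce (eta j) x.2 (delta_mx ord0 k) ord0 l.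
  exact: cvg_entry.
apply: (@eq_ind_r _ _ (fun z => bounce_mx y k l @[y --> within core (nbhs x)] --> z)
  _ _ (ent _ _ nj)).
apply: cvg_trans h'; apply: near_eq_cvg; rewrite near_withinE.
apply: filterS (core_near hx) => y hy /hy [_ e].
exact: esym (ent _ _ (etrans e nj)).
Qed.

Lemma stable_sum_cvg m x : core x ->
  stable_sum m y @[y --> within core (nbhs x)] --> stable_sum m x.
Proof.
elim: m x => [|m IH] x hx; first exact: cvg_cst.
apply: cvgB; last by apply: cvgZ; [exact: ftime_cvg|exact: proj_mx_cvg].
apply: cvg_mulmx; last exact: proj_mx_cvg.
apply: cvg_mulmx; first exact: bounce_mx_cvg.
by apply: (core_map_within hx); apply: IH; exact: core_map.
Qed.

Lemma stable_mx_cvg x : core x ->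
  stable_mx y @[y --> within core (nbhs x)] --> stable_mx x.
Proof.
move=> hx; apply: cvg_mx => i j; have [C C0 hC] := stable_mx_lim.
apply/cvgrPdist_lt => e e0.
have C1 : 0 < C + 1 by rewrite ltr_wpDl.
have [m hm] := exp_small (law_mu H) (divr_gt0 (divr_gt0 e0 (ltr0Sn R 2)) C1).
have {}hm : C * mu ^+ m <= e / 3.
  have := hm m (leqnn m); rewrite ltr_pdivlMr // => /ltW h.
  apply: le_trans h; rewrite mulrC mulrDr mulr1 lerDl exprn_ge0 //.
  by case/andP: (law_mu H).
have cve : stable_sum m y i j @[y --> within core (nbhs x)] --> stable_sum m x i j.
  by apply: cvg_entry; exact: stable_sum_cvg.
have /cvgrPdist_lt /(_ _ (divr_gt0 e0 (ltr0Sn R 2))) h := cve.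
rewrite near_withinE in h; rewrite near_withinE; apply: filterS h => y + cy => /(_ cy) hy.
have a1 := (hC x hx i j).2 m; have a2 := (hC y cy i j).2 m.
rewrite distrC in a2.
have -> : stable_mx x i j - stable_mx y i j = (stable_mx x i j - stable_sum m x i j) +
  (stable_sum m x i j - stable_sum m y i j) + (stable_sum m y i j - stable_mx y i j) by ring.
apply: le_lt_trans (ler_normD _ _) _; apply: le_lt_trans (lerD (ler_normD _ _) (lexx _)) _.
lra.
Qed.

End StableMatrix.

(** * The hyperbolic splitting *)

Section Subspaces.
Context {R : realType} {d : nat}.
Let V := ('rV[R]_d * 'rV[R]_d)%type.
Implicit Types (u v n : 'rV[R]_d) (w : V).

Definition pair_map (M N : 'M[R]_d) u : V := (u *m M, u *m N).

Lemma pair_map_linear M N : linear (pair_map M N).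
Proof. by move=> a u v; rewrite /pair_map !mulmxDl -!scalemxAl. Qed.

HB.instance Definition _ M N :=
  GRing.isLinear.Build R _ _ _ (pair_map M N) (pair_map_linear M N).

Lemma pair_mapE M N u : linfun (pair_map M N) u = (u *m M, u *m N).
Proof. by rewrite lfunE. Qed.

Definition orthv n : {vspace 'rV[R]_d} := lker (linfun (mulmxr n^T : 'rV[R]_d -> 'M[R]_1)).

Lemma mem_orthv n u : (u \in orthv n) = (dot u n == 0).
Proof.
rewrite memv_ker lfunE /= /dot; apply/eqP/eqP => [->|h]; first by rewrite mxE.
by apply/matrixP => i j; rewrite !ord1 h mxE.
Qed.

Lemma enorm2_le w : enorm2 w <= enorm w.1 + enorm w.2.
Proof.
rewrite /enorm2 -[leRHS]ger0_norm ?addr_ge0 ?enorm_ge0 // -sqrtr_sqr.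
rewrite ler_sqrt ?sqr_ge0 // sqrrD !enorm_sqr lerD2r lerDl.
by rewrite mulrn_wge0 // mulr_ge0 ?enorm_ge0.
Qed.

Lemma enorm2_snd w : enorm w.2 <= enorm2 w.
Proof. by rewrite /enorm2 /enorm ler_sqrt ?addr_ge0 ?dot_ge0 // lerDr dot_ge0. Qed.

(** The derivative of the billiard is injective on tangent vectors only: on the whole space it kills
    the position displacement along the velocity. *)
Lemma lfun_inverse_on (L : 'End(V)) (U : {vspace V}) :
  {in U &, injective L} -> exists K : 'End(V), forall w, w \in U -> K (L w) = w.
Proof.
move=> inj; pose F := (L \o projv U)%VF; exists (projv U \o F^-1)%VF => w wU.
have FL : F w = L w by rewrite comp_lfunE projv_id.
have Lw : L w \in limg F by rewrite -FL memv_img ?memvf.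
have := limg_lfunVK Lw; rewrite {1}comp_lfunE => h.
by rewrite comp_lfunE; apply: inj => //; rewrite memv_proj.
Qed.

Lemma basis_of_image (U : {vspace 'rV[R]_d}) (W : {vspace V}) (F : 'Hom('rV[R]_d, V))
    (g : 'rV[R]_d -> V) : F =1 g -> (U :&: lker F = 0)%VS -> (F @: U = W)%VS ->
  basis_of W [tuple g (vbasis U)`_i | i < \dim U].
Proof.
move=> Fg ker im; have := limg_basis_of ker (vbasisP U); rewrite im.
congr (basis_of _ _); apply: (@eq_from_nth _ 0).
  by rewrite size_map !size_tuple.
move=> i; rewrite size_map size_tuple => hi.
rewrite (nth_map 0) ?size_tuple // (nth_mktuple _ _ (Ordinal hi)) Fg //.
Qed.

End Subspaces.

Section Hyperbolicity.
Context {R : realType} {d : nat} (P : polytope R d).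
Let V := ('rV[R]_d * 'rV[R]_d)%type.
Variables (f f1 : R -> R) (mu kap : R).
Hypothesis H : law_bounds f f1 mu kap.
Hypotheses (gp : general_position P) (d2 : (2 <= d)%N) (ob : obtuse P).
Local Notation eta := (@normal _ _ P).
Local Notation Phi := (billiard_map P f).
Local Notation core := (billiard_core P f).
Local Notation nu := (@nu _ _ P).
Local Notation ftime := (ftime P f).
Local Notation DPhi := (DPhi P f f1).
Local Notation DPhin := (DPhin P f f1).
Local Notation stable_mx := (stable_mx P f f1).
Implicit Types (x y w : V) (u : 'rV[R]_d).

Hypothesis inv : invertible_on_core P f.
Let core_bij : set_bij core core Phi := inv.1.

Definition unstable x : {vspace V} := (linfun (pair_map 1%:M 0) @: orthv (nu x))%VS.
Definition stable x : {vspace V} := (linfun (pair_map (stable_mx x) 1%:M) @: orthv x.2)%VS.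

Lemma mem_unstable x w : w \in unstable x <-> dot w.1 (nu x) = 0 /\ w.2 = 0.
Proof.
split=> [/memv_imgP [u + ->]|[h1 h2]].
  by rewrite mem_orthv pair_mapE mulmx1 mulmx0 => /eqP.
have -> : w = linfun (pair_map 1%:M 0) w.1.
  by rewrite pair_mapE mulmx1 mulmx0 -h2; case: (w).
by rewrite memv_img // mem_orthv h1.
Qed.

Lemma mem_stable x w : w \in stable x <-> dot w.2 x.2 = 0 /\ w.1 = w.2 *m stable_mx x.
Proof.
split=> [/memv_imgP [u + ->]|[h1 h2]].
  by rewrite mem_orthv pair_mapE mulmx1 => /eqP.
have -> : w = linfun (pair_map (stable_mx x) 1%:M) w.2.
  by rewrite pair_mapE mulmx1 -h2; case: (w).
by rewrite memv_img // mem_orthv h1.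
Qed.

Lemma tangentP x w : core x ->
  tangent P x w <-> dot w.1 (nu x) = 0 /\ dot w.2 x.2 = 0.
Proof.
move=> hx; have [i [ri e _]] := core_nu H gp d2 core_bij hx; rewrite e.
split=> [[j [rj h1 h2]]|[h1 h2]]; last by exists i.
by rewrite (relint_face_inj gp d2 ri rj).
Qed.

Lemma stable_unstable0 x w : w \in stable x -> w \in unstable x -> w = 0.
Proof.
move=> /mem_stable [_ h1] /mem_unstable [_ h2].
by case: w h1 h2 => a b /= -> ->; rewrite mul0mx.
Qed.

Lemma tangent_split x w : core x -> tangent P x w ->
  exists s u : V, [/\ s \in stable x, u \in unstable x & w = s + u].
Proof.
move=> hx /(tangentP _ hx) [h1 h2].
exists (w.2 *m stable_mx x, w.2), (w.1 - w.2 *m stable_mx x, 0); split.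
- by apply/mem_stable.
- apply/mem_unstable; split=> //=.
  by rewrite dotBl h1 (stable_mx_orth H gp d2 ob core_bij) // subr0.
- by case: (w) => a b; rewrite /GRing.add /= /add_pair /= addrC subrK addr0.
Qed.

Lemma stable_tangent x w : core x -> w \in stable x -> tangent P x w.
Proof.
move=> hx /mem_stable [h1 h2]; apply/(tangentP _ hx); split=> //.
by rewrite h2 (stable_mx_orth H gp d2 ob core_bij).
Qed.

Lemma unstable_tangent x w : core x -> w \in unstable x -> tangent P x w.
Proof.
by move=> hx /mem_unstable [h1 h2]; apply/(tangentP _ hx); rewrite h2 dot0l.
Qed.

Lemma splitting x : core x ->
  [set w | w \in (stable x + unstable x)%VS] = tangent P x /\
  (stable x :&: unstable x = 0)%VS.
Proof.
move=> hx; split; last first.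
  apply/eqP; rewrite -subv0; apply/subvP => w; rewrite memv_cap => /andP[ws wu].
  by rewrite (stable_unstable0 ws wu) mem0v.
apply/seteqP; split=> w /=.
  move=> /memv_addP [s /(stable_tangent hx) hs [u /(unstable_tangent hx) hu ->]].
  move: hs hu => /(tangentP _ hx) [s1 s2] /(tangentP _ hx) [u1 u2].
  by apply/(tangentP _ hx); rewrite !dotDl s1 s2 u1 u2 addr0.
move=> /(tangent_split hx) [s [u [hs hu ->]]].
by apply/memv_addP; exists s => //; exists u.
Qed.

Lemma DPhiE x w : DPhi x w =
  (shear (nu (Phi x)) x.2 (w.1 + ftime x *: w.2), w.2 *m bounce_mx P f f1 x).
Proof. by rewrite dcollision_lfunE bounce_mxE. Qed.

Lemma DPhi_unstable x w : core x -> w \in unstable x ->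
  DPhi x w = (shear (nu (Phi x)) x.2 w.1, 0) /\ DPhi x w \in unstable (Phi x).
Proof.
move=> hx /mem_unstable [h1 h2].
have e : DPhi x w = (shear (nu (Phi x)) x.2 w.1, 0).
  by rewrite DPhiE h2 scaler0 addr0 mul0mx.
split; first exact: e.
rewrite e; apply/mem_unstable; split; last by [].
exact: (shear_orth w.1 (core_next_neq0 gp d2 hx)).
Qed.

Lemma DPhi_stable x w : core x -> w \in stable x ->
  (DPhi x w).2 = w.2 *m bounce_mx P f f1 x /\ DPhi x w \in stable (Phi x).
Proof.
move=> hx /mem_stable [h1 h2]; rewrite DPhiE; split=> //.
have hx' := core_map core_bij hx.
apply/mem_stable; split=> /=; first exact: (bounce_orth f1 gp d2 _ hx).
rewrite h2 (stable_mx_rec H gp d2 ob core_bij hx) mulmxBr -scalemxAr mulmxA mulmxA.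
set a := w.2 *m bounce_mx P f f1 x *m stable_mx (Phi x).
have ha : dot a (nu (Phi x)) = 0 by exact: (stable_mx_orth H gp d2 ob core_bij).
rewrite -[RHS](shear_proj gp d2 hx ha).
have hn := core_next_neq0 gp d2 hx.
rewrite -addrA; move: (a *m _) => q.
(* A displacement and its projection differ by a multiple of the velocity, which the shear kills. *)
have -> : - (ftime x *: (w.2 *m proj_mx P x)) + ftime x *: w.2 =
    (ftime x * (dot w.2 (nu x) / dot x.2 (nu x))) *: x.2.
  by rewrite proj_mxE /shear -scalerN -scalerDr opprB subrK scalerA.
move: (ftime x * _) => t; rewrite /shear dotDl dotZl.
rewrite mulrDl mulfK // scalerDl.
by apply/rowP => k; rewrite !mxE; ring.
Qed.

Lemma DPhin_unstable n x w : core x -> w \in unstable x ->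
  DPhin n x w = (drift P f n x w.1, 0) /\ DPhin n x w \in unstable (iter n Phi x).
Proof.
move=> hx wu; elim: n => [|n [IH1 IH2]].
  rewrite /= id_lfunE; split=> //.
  by have [_ h] := (mem_unstable x w).1 wu; rewrite -h; case: (w).
have [e m] := DPhi_unstable (core_iter core_bij n hx) IH2.
rewrite [DPhin n.+1 x]/= comp_lfunE; split=> //.
by rewrite e IH1 driftSr.
Qed.

Lemma DPhin_stable n x w : core x -> w \in stable x ->
  enorm (DPhin n x w).2 <= mu ^+ n * enorm w.2 /\ DPhin n x w \in stable (iter n Phi x).
Proof.
move=> hx ws; elim: n => [|n [IH1 IH2]].
  by rewrite /= id_lfunE expr0 mul1r.
have hn := core_iter core_bij n hx; have [e m] := DPhi_stable hn IH2.
rewrite [DPhin n.+1 x]/= comp_lfunE; split=> //.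
rewrite e; apply: le_trans (bounce_bound H gp d2 _ hn) _.
by rewrite exprS -mulrA ler_wpM2l //; case/andP: (law_mu H).
Qed.

Lemma DPhi_bij x : core x -> set_bij (tangent P x) (tangent P (Phi x)) (DPhi x).
Proof.
move=> hx; apply: inv.2 => //.
exact: (DPhi_diff H gp d2 (core_forward hx 0)).
Qed.

Lemma DPhin_bij n x : core x ->
  set_bij (tangent P x) (tangent P (iter n Phi x)) (DPhin n x).
Proof.
move=> hx; elim: n => [|n IH].
  split=> [w|w w' _ _|w tw] /=; rewrite ?id_lfunE //.
  by exists w => //; rewrite id_lfunE.
have -> : (DPhin n.+1 x : V -> V) = DPhi (iter n Phi x) \o DPhin n x.
  by apply/funext => w /=; rewrite comp_lfunE.
exact: (set_bij_comp IH (DPhi_bij (core_iter core_bij n hx))).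
Qed.

(** Each subspace is sent into the corresponding one. The derivative maps the tangent space onto the
    next one and the next splitting is direct, so neither inclusion is strict. *)
Lemma DPhi_images x : core x ->
  (DPhi x @: stable x = stable (Phi x))%VS /\
  (DPhi x @: unstable x = unstable (Phi x))%VS.
Proof.
move=> hx; have [_ _ sur] := DPhi_bij hx; have hx' := core_map core_bij hx.
have dec w : tangent P (Phi x) w -> exists s u : V, [/\ s \in stable x, u \in unstable x,
    DPhi x s \in stable (Phi x), DPhi x u \in unstable (Phi x) & w = DPhi x s + DPhi x u].
  move=> /sur [t ht <-]; have [s [u [hs hu ->]]] := tangent_split hx ht.
  exists s, u; split; [exact: hs|exact: hu| | |by rewrite linearD].
    exact: (DPhi_stable hx hs).2.
  exact: (DPhi_unstable hx hu).2.
have ss : (DPhi x @: stable x <= stable (Phi x))%VS.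
  by apply/subvP => _ /memv_imgP [s hs ->]; exact: (DPhi_stable hx hs).2.
have uu : (DPhi x @: unstable x <= unstable (Phi x))%VS.
  by apply/subvP => _ /memv_imgP [u hu ->]; exact: (DPhi_unstable hx hu).2.
split; apply/eqP; rewrite eqEsubv ?ss ?uu /=; apply/subvP => w hw.
- have [s [u [hs hu ls lu e]]] := dec w (stable_tangent hx' hw).
  have z : DPhi x u = 0.
    apply: (@stable_unstable0 (Phi x) _ _ lu).
    by rewrite -(addKr (DPhi x s) (DPhi x u)) -e memvD // memvN.
  rewrite e z addr0; exact: memv_img hs.
- have [s [u [hs hu ls lu e]]] := dec w (unstable_tangent hx' hw).
  have z : DPhi x s = 0.
    apply: (@stable_unstable0 (Phi x) _ ls).
    by rewrite -(addrK (DPhi x u) (DPhi x s)) -e memvB.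
  rewrite e z add0r; exact: memv_img hu.
Qed.

End Hyperbolicity.

(** * Continuous frames and uniform rates *)

Section UniformHyperbolicity.
Context {R : realType} {d : nat} (P : polytope R d).
Let V := ('rV[R]_d * 'rV[R]_d)%type.
Variables (f f1 : R -> R) (mu kap : R).
Hypothesis H : law_bounds f f1 mu kap.
Hypotheses (gp : general_position P) (d2 : (2 <= d)%N) (ob : obtuse P).
Local Notation eta := (@normal _ _ P).
Local Notation Phi := (billiard_map P f).
Local Notation core := (billiard_core P f).
Local Notation nu := (@nu _ _ P).
Local Notation ftime := (ftime P f).
Local Notation DPhi := (DPhi P f f1).
Local Notation DPhin := (DPhin P f f1).
Local Notation stable_mx := (stable_mx P f f1).
Implicit Types (x y w : V) (u : 'rV[R]_d).

Hypothesis inv : invertible_on_core P f.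
Let core_bij : set_bij core core Phi := inv.1.

Local Notation stable := (stable P f f1).
Local Notation unstable := (@unstable _ _ P).

(** [nu] is locally constant on the core, so constant vectors form a local frame. *)
Lemma unstable_subbundle : continuous_subbundle core unstable.
Proof.
move=> x hx; pose U := orthv (nu x).
exists (\dim U), (fun i _ => pair_map 1%:M 0 (vbasis U)`_i),
  [set y | core y -> nu y = nu x]; split.
- by apply: filterS (core_near gp d2 hx) => y hy /hy [].
- by move=> i; apply/subspace_continuousP => y _; exact: cvg_cst.
move=> y cy /(_ cy) e; apply: (basis_of_image (F := linfun (pair_map 1%:M 0))).
- by move=> u; rewrite lfunE.
- apply/eqP; rewrite -subv0; apply/subvP => u.
  rewrite memv_cap => /andP[_]; rewrite memv_ker => /eqP hu.
  have := congr1 fst (etrans (esym (pair_mapE 1%:M 0 u)) hu).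
  rewrite /= mulmx1 => ->.
  exact: mem0v.
- exact: (congr1 (fun n => (linfun (pair_map 1%:M 0) @: orthv n)%VS) (esym e)).
Qed.

(* Projection along x.2 carries a basis of the hyperplane orthogonal to x.2 to
   bases of the hyperplanes orthogonal to nearby velocities. *)
Lemma stable_subbundle : continuous_subbundle core stable.
Proof.
move=> x hx; pose U := orthv x.2.
pose T y u := shear y.2 x.2 u.
pose E y u := pair_map (stable_mx y) 1%:M (T y u).
have lin y : linear (E y).
  move=> a u v; rewrite /E /T shear_linear; exact: pair_map_linear.
have ux := core_unit hx.
exists (\dim U), (fun i y => E y (vbasis U)`_i), [set y | 0 < dot x.2 y.2]; split.
- have h : dot x.2 y.2 @[y --> x] --> dot x.2 x.2.
    by apply: (cvg_dot (F := nbhs x)); [exact: cvg_cst|exact: cvg_snd_nbhs].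
  by apply: (cvgr_gt _ h); rewrite ux.
- move=> i; apply/subspace_continuousP => y [cy ypos].
  have cT : T z (vbasis U)`_i @[z --> within core (nbhs y)] --> T y (vbasis U)`_i.
    apply: cvgB; first exact: cvg_cst.
    apply: cvgZ; last exact: cvg_cst.
    apply: cvgM; first by apply: cvg_dot; [exact: cvg_cst|exact: snd_cvg].
    by apply: cvgV; [rewrite gt_eqF|apply: cvg_dot; [exact: cvg_cst|exact: snd_cvg]].
  have cE : E z (vbasis U)`_i @[z --> within core (nbhs y)] --> E y (vbasis U)`_i.
    have c1 : T z (vbasis U)`_i *m stable_mx z @[z --> within core (nbhs y)]
        --> T y (vbasis U)`_i *m stable_mx y.
      by apply: cvg_mulmx => //; exact: (stable_mx_cvg H gp d2 ob core_bij).
    have c2 : T z (vbasis U)`_i *m 1%:M @[z --> within core (nbhs y)]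
        --> T y (vbasis U)`_i *m 1%:M.
      by apply: cvg_mulmx => //; exact: cvg_cst.
    exact: (cvg_pair c1 c2).
  by apply: cvg_trans cE; apply: cvg_app; apply: within_subset => z [].
move=> y cy /= ypos; have ny : dot x.2 y.2 != 0 by rewrite gt_eqF.
pose EL : {linear 'rV[R]_d -> V} := HB.pack (E y)
  (GRing.isLinear.Build R _ _ _ (E y) (lin y)).
have ELE u : linfun EL u = E y u by rewrite lfunE.
apply: (basis_of_image (F := linfun EL)) => //.
  apply/eqP; rewrite -subv0; apply/subvP => u.
  rewrite memv_cap mem_orthv => /andP[/eqP hu]; rewrite memv_ker ELE => /eqP hE.
  have h : T y u = 0 by have := congr1 snd hE; rewrite /E /pair_map /= mulmx1.
  suff -> : u = 0 by exact: mem0v.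
  have e : u = (dot u y.2 / dot x.2 y.2) *: x.2 by apply/eqP; rewrite -subr_eq0; apply/eqP.
  have c0 : dot u y.2 / dot x.2 y.2 = 0 by move: hu; rewrite {1}e dotZl ux mulr1.
  by rewrite e c0 scale0r.
apply/eqP; rewrite eqEsubv; apply/andP; split; apply/subvP => w.
  move=> /memv_imgP [u _ ->]; rewrite ELE; apply/mem_stable.
  by rewrite /E /pair_map /= mulmx1; split=> //; exact: shear_orth.
move=> /mem_stable [h1 h2].
have -> : w = linfun EL (w.2 - dot w.2 x.2 *: x.2).
  have h : T y (w.2 - dot w.2 x.2 *: x.2) = w.2.
    rewrite /T /shear dotBl dotZl h1 sub0r mulNr mulfK // scaleNr opprK subrK //.
  by rewrite ELE /E /pair_map h mulmx1 -h2; case: (w).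
by apply: memv_img; rewrite mem_orthv dotBl dotZl ux mulr1 subrr.
Qed.

(** On a graph over the velocities with bounded slope the norm is comparable to that of the velocity
    component, which contracts by [mu]. *)
Lemma stable_contraction : exists2 C, 0 < C & forall n x w, core x ->
  w \in stable x -> enorm2 (DPhin n x w) <= C * mu ^+ n * enorm2 w.
Proof.
have [C C0 hC] := stable_mx_bound H gp d2 ob core_bij.
exists (C + 1); first by rewrite ltr_wpDl.
move=> n x w hx hw; have [h1 h2] := DPhin_stable H gp d2 ob inv n hx hw.
move/mem_stable: h2 => [_ h2]; apply: le_trans (enorm2_le _) _.
have h3 := hC _ (DPhin n x w).2 (core_iter core_bij n hx); rewrite -h2 in h3.
have mun : 0 <= mu ^+ n by rewrite exprn_ge0 //; case/andP: (law_mu H).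
have h4 : (C + 1) * (mu ^+ n * enorm w.2) <= (C + 1) * (mu ^+ n * enorm2 w).
  by rewrite ler_pM2l ?ltr_wpDl // ler_wpM2l // enorm2_snd.
have h5 : (C + 1) * enorm (DPhin n x w).2 <= (C + 1) * (mu ^+ n * enorm w.2).
  by rewrite ler_pM2l ?ltr_wpDl.
rewrite -mulrA; lra.
Qed.

Lemma unstable_expansion : exists sigma c, [/\ 1 < sigma, 0 < c & forall n x w,
  core x -> w \in unstable x -> c * sigma ^+ n * enorm2 w <= enorm2 (DPhin n x w)].
Proof.
have [sigma [c [s1 c0 h]]] := drift_exponential H gp d2 ob core_bij.
exists sigma, c; split=> // n x w hx hw.
have [e _] := DPhin_unstable f1 gp d2 inv n hx hw.
have [w1 w2] := (mem_unstable P x w).1 hw.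
have ez (u : 'rV[R]_d) : enorm2 ((u, 0) : V) = enorm u by rewrite /enorm2 /= dot0l addr0.
have -> : enorm2 w = enorm w.1 by rewrite -ez -w2; case: (w).
by rewrite e ez; apply: h.
Qed.

Lemma core_preimage n x : core x -> exists2 y, core y & iter n Phi y = x.
Proof.
elim: n x => [|n IH] x hx; first by exists x.
have [_ _ sur] := core_bij; have [z hz <-] := sur x hx.
by have [y hy <-] := IH z hz; exists y.
Qed.

(** The stable part of the preimage is sent into both subspaces, hence to zero, and injectivity on
    tangent vectors makes it vanish. *)
Lemma DPhin_preimage_unstable n y w : core y -> tangent P y w ->
  DPhin n y w \in unstable (iter n Phi y) -> w \in unstable y.
Proof.
move=> hy tw; have [s [t [hs ht e]]] := tangent_split H gp d2 ob inv hy tw.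
rewrite e linearD => hsum.
have ls := (DPhin_stable H gp d2 ob inv n hy hs).2.
have lt := (DPhin_unstable f1 gp d2 inv n hy ht).2.
have z : DPhin n y s = 0.
  apply: (stable_unstable0 ls).
  by rewrite -(addrK (DPhin n y t) (DPhin n y s)) memvB.
have [_ inj _] := DPhin_bij H gp d2 inv n hy.
have -> : s = 0.
  apply: inj; rewrite ?inE.
  - exact: (stable_tangent H gp d2 ob inv hy hs).
  - exact: (stable_tangent H gp d2 ob inv hy (mem0v _)).
  - by rewrite z linear0.
rewrite add0r; exact: ht.
Qed.

Lemma diff_iter_inv_unstable n x : core x -> exists y (K : 'End(V)),
  [/\ core y, iter n Phi y = x, diff_iter_inv P f n x K &
    forall w, w \in unstable x ->
      exists2 v, v \in unstable y & w = DPhin n y v /\ K w = v].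
Proof.
move=> hx; have [y hy e] := core_preimage n hx.
have [fn inj sur] := DPhin_bij H gp d2 inv n hy.
pose U := (stable y + unstable y)%VS.
have [tU _] := splitting H gp d2 ob inv hy.
have UT w : w \in U <-> tangent P y w by rewrite -tU.
have injU : {in U &, injective (DPhin n y)}.
  by move=> w w' hw hw'; apply: inj; rewrite inE; exact/UT.
have [K hK] := lfun_inverse_on injU.
exists y, K; split=> //.
  exists y, (DPhin n y); split=> //.
  - exact: (DPhin_diff H gp d2 n (core_forward hy)).1.
  - rewrite -e; apply/seteqP; split=> [_ [w hw <-]|w /sur//]; exact: fn.
  - by move=> w /UT; exact: hK.
move=> w hw; have [|v tv ev] := sur w.
  by rewrite e; exact: (unstable_tangent H gp d2 inv hx hw).
exists v; last by rewrite -ev; split=> //; apply: hK; exact/UT.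
by apply: (DPhin_preimage_unstable (n := n) hy tv); rewrite ev e.
Qed.

Lemma obtuse_uniformly_hyperbolic : uniformly_hyperbolic P f.
Proof.
have [C C0 hC] := stable_contraction.
have [sigma [c [s1 c0 hc]]] := unstable_expansion.
have s0 : 0 < sigma by lra.
exists stable, unstable; split.
- by move=> x hx; exact: (splitting H gp d2 ob inv hx).
- exact: stable_subbundle.
- exact: unstable_subbundle.
- move=> x hx; exists (DPhi x); have [h1 h2] := DPhi_images H gp d2 ob inv hx.
  by split=> //; exact: (DPhi_diff H gp d2 (core_forward hx 0)).
have /andP[m0 m1] := law_mu H.
(* The rate has to be positive while the bounds allow [mu = 0], hence the midpoint of [mu] and [1];
   [C] serves the stable estimate and [c^-1] the inverse on the unstable space. *)
exists ((mu + 1) / 2), sigma, (C + c^-1); split=> //.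
- by apply/andP; split; lra.
- by rewrite addr_gt0 ?invr_gt0.
move=> n x _ hx; split.
  exists (DPhin n x); first exact: (DPhin_diff H gp d2 n (core_forward hx)).1.
  move=> w hw; apply: le_trans (hC n x w hx hw) _.
  rewrite ler_wpM2r ?sqrtr_ge0 //; apply: ler_pM => //; rewrite ?exprn_ge0 ?(ltW C0) //.
    by rewrite lerDl invr_ge0 ltW.
  by rewrite lerXn2r ?nnegrE //; lra.
have [y [K [hy e dK hK]]] := diff_iter_inv_unstable n hx.
exists K => // w hw; have [v hv [wv ->]] := hK w hw.
have h := hc n y v hy hv; rewrite -wv in h.
have sn : 0 < sigma ^+ n by rewrite exprn_gt0.
apply: (@le_trans _ _ (c^-1 * sigma ^- n * enorm2 w)).
  by rewrite -invfM mulrC ler_pdivlMr ?mulr_gt0 // mulrC.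
rewrite ler_wpM2r ?sqrtr_ge0 // ler_wpM2r ?invr_ge0 ?(ltW sn) //.
by rewrite lerDr ltW.
Qed.

End UniformHyperbolicity.

Theorem corollary1p4 (R : realType) (d : nat) (P : polytope R d) (f : R -> R) :
  (2 <= d)%N ->
  general_position P ->
  contracting_reflection_law f ->
  invertible_on_core P f ->
  obtuse P ->
  uniformly_hyperbolic P f.
Proof.
move=> d2 gp law inv ob; have [f1 [mu [kap H]]] := contracting_law_bounds law.
exact: (obtuse_uniformly_hyperbolic H gp d2 ob inv).
Qed.
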